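(* Let $(a_k)_{k\ge 1}$ and $(b_k)_{k\ge 1}$ be sequences of real random variables such that all the variables $a_k, b_k$ ($k\geq 1$) are independent and identically distributed, centered, with variance one, with a finite moment of order $5$, and with common law in the class $\mathcal C(1,\beta)$ for some $0\le \beta<1$. Let $(\theta_k)_{k\ge 1}$ be any sequence of real numbers, and for $n\ge 1$ and $t\in\mathbb R$ set $$P_n(t):=\sum_{k=1}^n a_k\cos(kt+\theta_k)+b_k\sin(kt+\theta_k).$$ Let $a<b$ be real numbers and let $\mathcal Z_n([a,b])$ denote the number of real zeros of $P_n$ in the interval $[a,b]$. Then $$\lim_{n\to+\infty}\frac{\mathbb E[\mathcal Z_n([a,b])]}{n}=\frac{b-a}{\pi\sqrt3}.$$
   Context: For a random vector $X$ in $\mathbb R^d$, $\phi_X(t):=\mathbb E[e^{it\cdot X}]$ denotes its characteristic function. For an exponent $\beta\geq 0$, the law of $X$ belongs to the class $\mathcal C(d,\beta)$ if there exist constants $C>0$ and $R>0$ such that for all $t\in\mathbb R^d$ with $\|t\|_2>R$, $$|\phi_X(t)|\le 1-\frac{C}{\|t\|_2^{\beta}}.$$ (For $\beta=0$ this is the classical Cramer condition $\limsup_{\|t\|_2\to\infty}|\phi_X(t)|<1$.) Convention: on the event that $P_n$ vanishes identically (which may have positive probability when the law of the coefficients has an atom at $0$), $\mathcal Z_n([a,b])$ is set equal to $0$. *)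

(* Defs.v *)
From HB Require Import structures.
From mathcomp Require Import all_boot all_order all_algebra finmap.
From mathcomp Require Import all_classical all_reals all_analysis.
From mathcomp Require Import complex.

Set Implicit Arguments.
Unset Strict Implicit.
Unset Printing Implicit Defensive.

Import Order.TTheory GRing.Theory Num.Theory.
Import numFieldNormedType.Exports.

Local Open Scope classical_set_scope.
Local Open Scope ring_scope.

Section random_variables.
Context (d : measure_display) (T : measurableType d) (R : realType).
Variable P : probability T R.

Definition mutually_independent (I : choiceType) (X : I -> {RV P >-> R}) :=
  forall (J : {fset I}) (B : I -> set R), (forall i, measurable (B i)) ->
    P (\bigcap_(i in [set` J]) (X i @^-1` B i)) =
    (\prod_(i <- J) P (X i @^-1` B i))%E.

(* Restricted to measurable sets: the library's measures are total functions
   on sets, with unconstrained values on nonmeasurable ones. *)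
Definition identically_distributed (I : Type) (X : I -> {RV P >-> R}) :=
  forall (i j : I) (A : set R), measurable A ->
    distribution P (X i) A = distribution P (X j) A.

Definition dotv (m : nat) (s t : 'rV[R]_m) : R := \sum_(i < m) s 0 i * t 0 i.

(* The norm `|t| of the library on 'rV[R]_m is the sup norm. *)
Definition norm2 (m : nat) (t : 'rV[R]_m) : R := Num.sqrt (dotv t t).

(* E[exp(i t.X)], with real part E[cos(t.X)] and imaginary part E[sin(t.X)]. *)
Definition char_fun (m : nat) (X : T -> 'rV[R]_m) (t : 'rV[R]_m) : R[i] :=
  Complex (\int[P]_w cos (dotv t (X w))) (\int[P]_w sin (dotv t (X w))).

Definition cramer_class (m : nat) (beta : R) (X : T -> 'rV[R]_m) :=
  exists C r : R, [/\ 0 < C, 0 < r &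
    forall t : 'rV[R]_m, r < norm2 t ->
      ComplexField.Normc.normc (char_fun X t) <= 1 - C / norm2 t `^ beta].

(* Pairs up (a_k)_{k >= 1} and (b_k)_{k >= 1} in one family: the values of the
   sequences at index 0 are unused. *)
Definition coefficients (a b : nat -> {RV P >-> R}) (i : nat + nat) :
    {RV P >-> R} :=
  match i with inl k => a k.+1 | inr k => b k.+1 end.

Definition trig_poly (a b : nat -> {RV P >-> R}) (theta : nat -> R)
    (n : nat) (w : T) (t : R) : R :=
  \sum_(1 <= k < n.+1)
    (a k w * cos (k%:R * t + theta k) + b k w * sin (k%:R * t + theta k)).

End random_variables.

(* Number of distinct zeros of f in [u, v], set to 0 when f vanishes
   identically. *)
Definition nb_zeros (R : realType) (f : R -> R) (u v : R) : \bar R :=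
  if `[< forall t, f t = 0 >] then 0%E
  else counting [set t | t \in `[u, v] /\ f t = 0].

(* Main.v *)
Require Import Defs.
From HB Require Import structures.
From mathcomp Require Import all_boot all_order all_algebra finmap.
From mathcomp Require Import all_classical all_reals all_analysis.
From mathcomp Require Import complex measurable_realfun ring lra zify.

(** The interval [u, v] is cut into J = p^3 n steps of length h, where p is a
    large integer that stays fixed while n tends to infinity. Put
    X = P_n / sqrt n and let X' be its derivative divided by n; the
    normalised length of a step is eps = n h = (v - u) / p^3.

    Most zeros are sign changes. The number of steps over which X changes
    sign is a lower bound for the number of zeros, and it is also an upper
    bound up to the steps that hold clustered zeros. By Rolle's theorem,
    k >= 2 zeros in a step starting at x force |X(x)| <= eps^k sup |X^(k)|
    with X^(k) the k-th derivative divided by n^k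
    ([many_zeros_bound], [same_sign_zero_bound]). That supremum has a second
    moment bounded uniformly in k and n ([pr_sup_bound]), so the event is
    rare once X(x) is known to have no concentration near 0.

    This is the role of the Cramer type condition. As beta < 1, the
    characteristic function of X(x) is small up to frequencies n^(3/2), and
    P(|X(x)| <= eta) <= K eta + r_n with n r_n tending to 0 ([small_ball]).
    A step holds at most 2 n zeros ([trig_poly_few_zeros]), hence about n
    events with remainder r_n each are enough, and their total n r_n is
    negligible. In the mean, clusters account for O(n / p) zeros
    ([zeros_le_events], [zero_count_estimate]).

    It remains to find the probability that X changes sign over one step.
    Up to a Taylor error X(x + h) is X(x) + eps X'(x), where X(x) and X'(x)
    are uncorrelated with variances 1 and about 1/3. So with
    tan phi = eps / sqrt 3 the form cos phi (X + eps X') is X turned by the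
    angle phi, and has correlation about cos phi with X
    ([covariance_tilt]). For a Gaussian pair the signs would be opposite with
    probability phi / pi. The same value is found directly for linear forms:
    by the central limit theorem for characteristic functions, all pairs of
    linear forms with limiting correlation cos phi have nearly the same
    expectations against trigonometric polynomials ([trig2_close]), which
    approximate the sign away from 0 ([soft_sign_approx]); so all of them have nearly the
    same probability of a sign change. Among them are the successive values
    at multiples of phi of the random sinusoid cos x U + sin x V, with U and
    V the normalised sums of the a_k and of the b_k. As a sinusoid changes
    sign once per half period, this probability is close to phi / pi
    ([sign_change_angle]).

    Altogether the mean number of zeros is p^3 n phi / pi + O(n / p), and
    p^3 phi is (v - u) / sqrt 3 + O(1 / p). Letting n and then p tend to
    infinity gives the limit. *)

Set Implicit Arguments.
Unset Strict Implicit.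
Unset Printing Implicit Defensive.

Import Order.TTheory GRing.Theory Num.Theory.
Import numFieldNormedType.Exports.

Local Open Scope classical_set_scope.
Local Open Scope ring_scope.

(** * Elementary inequalities *)

Section trigonometric_estimates.
Context (R : realType).
Implicit Types x y : R.

Lemma ge0_of_derive_ge0 (f f' : R -> R) : (forall x, is_derive x 1 f (f' x)) ->
  0 <= f 0 -> (forall x, 0 <= x -> 0 <= f' x) -> forall x, 0 <= x -> 0 <= f x.
Proof.
move=> df f0 f'0 x x0.
have [|c + E] := @MVT_segment R f f' 0 x x0 (fun z _ => df z).
  apply: continuous_subspaceT => z; apply: differentiable_continuous.
  by apply/derivable1_diffP; have := df z => -[].
rewrite in_itv /= => /andP[c0 _].
have : 0 <= f' c * (x - 0) by rewrite mulr_ge0 ?f'0// subr0.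
by rewrite -E; lra.
Qed.

Lemma sin_le x : 0 <= x -> sin x <= x.
Proof.
move=> x0; rewrite -subr_ge0.
apply: (@ge0_of_derive_ge0 (fun x => x - sin x) (fun x => 1 - cos x)) => //=.
  by rewrite sin0 subr0.
Qed.

Lemma cos_ge x : 1 - x ^+ 2 / 2 <= cos x.
Proof.
wlog x0 : x / 0 <= x => [H|].
  by case: (leP 0 x) => [/H//|x0]; rewrite -cosN -[x ^+ 2]sqrrN; apply: H; lra.
rewrite -subr_ge0.
apply: (@ge0_of_derive_ge0 (fun x => cos x - (1 - x ^+ 2 / 2))
  (fun x => x - sin x)) => //.
- move=> z; by apply: is_derive_eq; rewrite /GRing.scale/=; field.
- by rewrite /= cos0; lra.
- by move=> z z0; rewrite subr_ge0 sin_le.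
Qed.

Lemma sin_ge x : 0 <= x -> x - x ^+ 3 / 6 <= sin x.
Proof.
move=> x0; rewrite -subr_ge0.
apply: (@ge0_of_derive_ge0 (fun x => sin x - (x - x ^+ 3 / 6))
  (fun x => cos x - (1 - x ^+ 2 / 2))) => //.
- move=> z; by apply: is_derive_eq; rewrite /GRing.scale/=; field.
- by rewrite /= sin0; lra.
- by move=> z z0; rewrite subr_ge0 cos_ge.
Qed.

Lemma cos_le x : cos x <= 1 - x ^+ 2 / 2 + x ^+ 4 / 24.
Proof.
wlog x0 : x / 0 <= x => [H|].
  case: (leP 0 x) => [/H//|x0]; rewrite -cosN -[x ^+ 2]sqrrN.
  by rewrite (_ : x ^+ 4 = (- x) ^+ 4); [apply: H; lra|ring].
rewrite -subr_ge0.
apply: (@ge0_of_derive_ge0 (fun x => 1 - x ^+ 2 / 2 + x ^+ 4 / 24 - cos x)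
  (fun x => sin x - (x - x ^+ 3 / 6))) => //.
- move=> z; by apply: is_derive_eq; rewrite /GRing.scale/=; field.
- by rewrite /= cos0; lra.
- by move=> z z0; rewrite subr_ge0 sin_ge.
Qed.

Lemma norm_sin_sub_le x : `|sin x - x| <= `|x| ^+ 3.
Proof.
wlog x0 : x / 0 <= x => [H|].
  case: (leP 0 x) => [/H//|x0].
  have -> : sin x - x = - (sin (- x) - - x) by rewrite sinN; ring.
  by rewrite normrN -(normrN x); apply: H; lra.
have h1 := sin_le x0; have h2 := sin_ge x0; have h3 : 0 <= x ^+ 3 by rewrite exprn_ge0.
by rewrite (ger0_norm x0) ler_norml; lra.
Qed.

Lemma norm_cos_sub_le x : `|cos x - (1 - x ^+ 2 / 2)| <= `|x| ^+ 3.
Proof.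
wlog x0 : x / 0 <= x => [H|].
  case: (leP 0 x) => [/H//|x0].
  by rewrite -cosN -[x ^+ 2]sqrrN -(normrN x); apply: H; lra.
have h1 := cos_ge x; have h2 := cos_le x; have h3 := cos_le1 x.
rewrite (ger0_norm x0) ger0_norm ?subr_ge0//.
have [x1|x1] := leP x 1; last by have : x ^+ 2 <= x ^+ 3; [rewrite !exprS; nra|lra].
have : x ^+ 4 <= x ^+ 3 by rewrite exprS ler_piMl// exprn_ge0.
have : 0 <= x ^+ 3 by rewrite exprn_ge0.
lra.
Qed.

Lemma cos_ge_half x : `|x| <= 1 -> 1 / 2 <= cos x.
Proof.
move=> x1; apply: le_trans (cos_ge x).
have : x ^+ 2 <= 1 by rewrite -real_normK ?num_real// expr_le1.
lra.
Qed.

Lemma expR_sub_le y : 0 <= y -> `|expR (- y) - (1 - y)| <= y ^+ 2.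
Proof.
move=> y0.
have h1 := expR_ge1Dx (- y).
have h2 := expR_ge1Dx y.
have e : expR (- y) * expR y = 1 by rewrite -expRD addNr expR0.
have e0 := expR_gt0 (- y).
rewrite ger0_norm; last by lra.
nra.
Qed.

Lemma expR_lipschitz (x y : R) : 0 <= x -> 0 <= y ->
  `|expR (- x) - expR (- y)| <= `|x - y|.
Proof.
wlog xy : x y / x <= y => [H|].
  case: (leP x y) => [/H//|/ltW/H h x0 y0].
  by rewrite distrC [X in _ <= X]distrC; exact: h.
move=> x0 y0.
have -> : expR (- y) = expR (- x) * expR (- (y - x)).
  by rewrite -expRD; congr expR; ring.
have := expR_ge1Dx (- (y - x)).
have : expR (- x) <= 1 by rewrite -expR0 ler_expR; lra.
have := expR_gt0 (- x).
have : expR (- (y - x)) <= 1 by rewrite -expR0 ler_expR; lra.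
set a := expR (- x); set b := expR _ => h1 h2 h3 h4.
rewrite [X in _ <= X]distrC [X in _ <= X]ger0_norm ?subr_ge0// ler_norml; apply/andP; split; nra.
Qed.

(** Makes exp(C n^g) beat every power of n, by raising 1 + y <= exp y to the
    power k + 1. *)
Lemma expR_ge_pow (x : R) k : 0 <= x -> (x / k.+1%:R) ^+ k.+1 <= expR x.
Proof.
move=> x0; rewrite -[in leRHS](divfK (_ : k.+1%:R != 0) x)//.
rewrite expRM_natr; apply: lerXn2r; rewrite ?nnegrE ?expR_ge0//.
  by rewrite divr_ge0.
by apply: le_trans (expR_ge1Dx _); rewrite lerDr.
Qed.

Lemma geometric_sum_le (q : R) n : 0 <= q < 1 -> \sum_(i < n) q ^+ i <= (1 - q)^-1.
Proof.
move=> /andP[q0 q1]; rewrite -[leRHS]div1r ler_pdivlMr ?subr_gt0//.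
suff -> : (\sum_(i < n) q ^+ i) * (1 - q) = 1 - q ^+ n.
  by rewrite gerBl exprn_ge0.
elim: n => [|n IH]; first by rewrite big_ord0 mul0r expr0 subrr.
by rewrite big_ord_recr /= mulrDl IH exprS; ring.
Qed.

End trigonometric_estimates.

(** * Expectations and probabilities as real numbers *)

Section expectation.
Context (d : measure_display) (T : measurableType d) (R : realType).
Variable P : probability T R.

Definition bounded_meas (f : T -> R) :=
  measurable_fun setT f /\ exists M, forall w, `|f w| <= M.

Local Notation int f := (P.-integrable setT (EFin \o f)).
Definition Ex (f : T -> R) : R := \int[P]_w (f w).

Lemma measurable_le (f g : T -> R) : measurable_fun setT f ->
  measurable_fun setT g -> measurable [set w | f w <= g w].
Proof.
move=> mf mg; have := measurable_fun_ler mf mg.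
by move=> /(_ measurableT [set true]); rewrite setTI preimage_true; exact.
Qed.

Lemma measurable_lt (f g : T -> R) : measurable_fun setT f ->
  measurable_fun setT g -> measurable [set w | f w < g w].
Proof.
move=> mf mg; have := measurable_fun_ltr mf mg.
by move=> /(_ measurableT [set true]); rewrite setTI preimage_true; exact.
Qed.

Definition pr (A : set T) : R := fine (P A).

Lemma prE (A : set T) : measurable A -> (pr A)%:E = P A.
Proof. by move=> mA; rewrite /pr fineK// fin_num_measure. Qed.

Lemma bounded_meas_int f : bounded_meas f -> int f.
Proof.
case=> mf [M fM]; apply: (@measurable_bounded_integrable _ _ _ P f setT) => //.
  by apply: (@le_lt_trans _ _ 1%E); [exact: probability_le1|exact: ltry].
exists M; split; first exact: num_real.
by move=> x Mx w _; apply: (le_trans (fM w)); exact: ltW.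
Qed.

Lemma ExD f g : int f -> int g -> Ex (fun w => f w + g w) = Ex f + Ex g.
Proof. by move=> *; rewrite /Ex RintegralD. Qed.

Lemma ExB f g : int f -> int g -> Ex (fun w => f w - g w) = Ex f - Ex g.
Proof. by move=> *; rewrite /Ex RintegralB. Qed.

Lemma ExZ c f : int f -> Ex (fun w => c * f w) = c * Ex f.
Proof. by move=> *; rewrite /Ex RintegralZl. Qed.

Lemma Ex_cst (c : R) : Ex (fun _ => c) = c.
Proof.
rewrite /Ex Rintegral_cst// [X in fine X](_ : _ = 1%E) ?mulr1//.
exact: probability_setT.
Qed.

Lemma int_cst (c : R) : int (fun=> c).
Proof. by apply: bounded_meas_int; split=> //; exists `|c|. Qed.

Lemma intD f g : int f -> int g -> int (fun w => f w + g w).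
Proof. by move=> hf hg; exact: (integrableD measurableT hf hg). Qed.

Lemma intB f g : int f -> int g -> int (fun w => f w - g w).
Proof. by move=> hf hg; exact: (integrableB measurableT hf hg). Qed.

Lemma intZ c f : int f -> int (fun w => c * f w).
Proof. by move=> hf; exact: (integrableZl measurableT c hf). Qed.

Lemma int_sum (I : Type) (s : seq I) (F : I -> T -> R) :
  (forall i, int (F i)) -> int (fun w => \sum_(i <- s) F i w).
Proof.
move=> iF; elim: s => [|i s IH].
  by under [X in _.-integrable _ (_ \o X)]eq_fun do rewrite big_nil; exact: int_cst.
under [X in _.-integrable _ (_ \o X)]eq_fun do rewrite big_cons.
exact: intD.
Qed.

Lemma Ex_sum (I : Type) (s : seq I) (F : I -> T -> R) :
  (forall i, int (F i)) ->
  Ex (fun w => \sum_(i <- s) F i w) = \sum_(i <- s) Ex (F i).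
Proof.
move=> iF; elim: s => [|i s IH].
  by rewrite big_nil -[RHS]Ex_cst; apply: eq_Rintegral => w _; rewrite big_nil.
rewrite big_cons -IH -ExD//; last exact: int_sum.
by apply: eq_Rintegral => w _; rewrite big_cons.
Qed.

Lemma Ex_le f g : int f -> int g -> (forall w, f w <= g w) -> Ex f <= Ex g.
Proof. by move=> hf hg fg; apply: le_Rintegral. Qed.

Lemma eq_Ex f g : f =1 g -> Ex f = Ex g.
Proof. by move=> fg; apply: eq_Rintegral => w _; exact: fg. Qed.

Lemma Ex_abs_le (f : T -> R) M : measurable_fun setT f -> (forall w, `|f w| <= M) ->
  `|Ex f| <= M.
Proof.
move=> mf fM; have bf : bounded_meas f by split=> //; exists M.
apply: (le_trans (le_normr_Rintegral _ (bounded_meas_int bf))) => //.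
rewrite -[leRHS]Ex_cst; apply: Ex_le => //; last exact: int_cst.
apply: bounded_meas_int; split; first exact: measurableT_comp.
by exists M => w; rewrite normr_id.
Qed.

Lemma Ex_indic (A : set T) : measurable A -> Ex (\1_A) = pr A.
Proof. by move=> mA; rewrite /Ex /Rintegral integral_indic// setIT. Qed.

Lemma bounded_meas_indic A : measurable A -> bounded_meas (\1_A).
Proof.
move=> mA; split; first exact: measurable_indic.
by exists 1 => w; rewrite indicE; case: (_ \in _); rewrite ?normr1 ?normr0.
Qed.

Lemma pr_le1 A : measurable A -> pr A <= 1.
Proof. by move=> mA; rewrite -lee_fin prE// probability_le1. Qed.

Lemma pr_le A B : measurable A -> measurable B -> A `<=` B -> pr A <= pr B.
Proof. by move=> mA mB AB; rewrite -lee_fin !prE// le_measure// inE. Qed.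

Lemma pr_leU A B : measurable A -> measurable B -> pr (A `|` B) <= pr A + pr B.
Proof.
move=> mA mB; rewrite -lee_fin EFinD !prE//; last exact: measurableU.
exact: measureU2.
Qed.

Lemma bounded_measM f g : bounded_meas f -> bounded_meas g ->
  bounded_meas (fun w => f w * g w).
Proof.
move=> [mf [M fM]] [mg [N gN]]; split; first exact: measurable_funM.
exists (M * N) => w; rewrite normrM; apply: ler_pM => //.
Qed.

Lemma bounded_measD f g : bounded_meas f -> bounded_meas g ->
  bounded_meas (fun w => f w + g w).
Proof.
move=> [mf [M fM]] [mg [N gN]]; split; first exact: measurable_funD.
by exists (M + N) => w; apply: (le_trans (ler_normD _ _)); apply: lerD.
Qed.

Lemma bounded_meas_cst c : bounded_meas (fun=> c).
Proof. by split=> //; exists `|c|. Qed.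

Lemma bounded_meas_prod (I : Type) (s : seq I) (F : I -> T -> R) :
  (forall i, bounded_meas (F i)) -> bounded_meas (fun w => \prod_(i <- s) F i w).
Proof.
move=> bF; elim: s => [|i s IH].
  by under eq_fun do rewrite big_nil; exact: bounded_meas_cst.
by under eq_fun do rewrite big_cons; exact: bounded_measM.
Qed.

Lemma bounded_meas_sum (I : Type) (s : seq I) (F : I -> T -> R) :
  (forall i, bounded_meas (F i)) -> bounded_meas (fun w => \sum_(i <- s) F i w).
Proof.
move=> bF; elim: s => [|i s IH].
  by under eq_fun do rewrite big_nil; exact: bounded_meas_cst.
by under eq_fun do rewrite big_cons; exact: bounded_measD.
Qed.

Lemma bounded_meas_comp (f : R -> R) (X : T -> R) : measurable_fun setT X ->
  measurable_fun setT f -> (exists M, forall x, `|f x| <= M) ->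
  bounded_meas (fun w => f (X w)).
Proof.
move=> mX mf [M fM]; split; first exact: measurableT_comp.
by exists M => w.
Qed.

Lemma markov_pr (f : T -> R) (A : set T) (c : R) : measurable A -> int f ->
  (forall w, 0 <= f w) -> (forall w, A w -> c <= f w) -> c * pr A <= Ex f.
Proof.
move=> mA intf f0 cf; rewrite -Ex_indic// -ExZ; last first.
  by apply: bounded_meas_int; exact: bounded_meas_indic.
apply: Ex_le => //.
  by apply: intZ; apply: bounded_meas_int; exact: bounded_meas_indic.
move=> w; rewrite indicE; case: (boolP (w \in A)); last by rewrite mulr0.
by rewrite inE mulr1 => /cf.
Qed.

End expectation.

(** * Independence and products of bounded functions *)

Section independence.
Context (d : measure_display) (T : measurableType d) (R : realType).
Variable P : probability T R.
Local Notation Ex := (Ex P).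
Local Notation pr := (pr P).

(** Rounds y down to a multiple of e, written as a sum of indicators:
    identities that are linear in a test function and known for indicators
    then hold for staircases. *)
Definition staircase (e : R) (N : nat) (y : R) : R :=
  \sum_(l < N) e * \1_[set z | l.+1%:R * e <= z] y.

Lemma staircase_approx e N y : 0 < e -> 0 <= y <= N%:R * e ->
  `|y - staircase e N y| <= e.
Proof.
move=> e0 /andP[y0 yN].
suff H : (N%:R * e <= y -> staircase e N y = N%:R * e) /\
         (y < N%:R * e -> staircase e N y <= y <= staircase e N y + e).
  case: H => H1 H2; case: (leP (N%:R * e) y) => [/[dup] Ny /H1 ->|/H2 h].
    have -> : y = N%:R * e by apply/eqP; rewrite eq_le yN Ny.
    by rewrite subrr normr0 ltW.
  by rewrite ler_norml; lra.
elim: N {yN} => [|N [IH1 IH2]].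
  rewrite /staircase big_ord0 mul0r; split => // h; lra.
rewrite /staircase big_ord_recr /= -/(staircase e N y) indicE.
have eN : N.+1%:R * e = N%:R * e + e by rewrite -natr1 mulrDl mul1r.
split.
- move=> Ny; rewrite mem_set//= IH1; lra.
- move=> Ny; rewrite memNset/=; last by move=> h; lra.
  rewrite mulr0 addr0; case: (leP (N%:R * e) y) => [/[dup] h /IH1 ->|/IH2//].
  lra.
Qed.

Lemma bounded_meas_indic_comp (X : T -> R) (B : set R) :
  measurable_fun setT X -> measurable B -> bounded_meas (fun w => \1_B (X w) : R).
Proof.
move=> mX mB; apply: (@bounded_meas_comp _ _ R (\1_B)) => //.
by exists 1 => x; rewrite indicE; case: (_ \in _); rewrite ?normr1 ?normr0.
Qed.

(** Every bounded f is within e of a staircase of its level sets, and both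
    sides move by at most a multiple of e when f does. *)
Lemma indic_to_bounded (X : T -> R) (Phi : T -> R) (c : R) (f : R -> R) :
  measurable_fun setT X -> bounded_meas Phi ->
  (forall B : set R, measurable B ->
    Ex (fun w => \1_B (X w) * Phi w) = Ex (fun w => \1_B (X w)) * c) ->
  measurable_fun setT f -> (exists M, forall x, `|f x| <= M) ->
  Ex (fun w => f (X w) * Phi w) = Ex (fun w => f (X w)) * c.
Proof.
move=> mX bPhi H mf [M fM].
have [mPhi [K PhiK]] := bPhi.
have M0 : 0 <= M by apply: le_trans (fM 0).
have K0 : 0 <= K by apply: le_trans (PhiK point).
have HZ : forall B : set R, measurable B -> bounded_meas (fun w => \1_B (X w) : R).
  by move=> B mB; exact: bounded_meas_indic_comp.
(* the constant c is forced by the test set B = setT *)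
have H1 : Ex Phi = c.
  have := H setT measurableT.
  rewrite (@eq_Ex _ _ _ P (fun w => \1_setT (X w) * Phi w) Phi); last first.
    by move=> w; rewrite indicT mul1r.
  rewrite (@eq_Ex _ _ _ P (fun w => \1_setT (X w)) (fun=> 1)); last first.
    by move=> w; rewrite indicT.
  by rewrite Ex_cst mul1r.
suff eps (e : R) : 0 < e -> `|Ex (fun w => f (X w) * Phi w)
     - Ex (fun w => f (X w)) * c| <= e * (K + `|c|).
  apply/eqP; rewrite -subr_eq0 -normr_eq0 eq_le normr_ge0 andbT.
  apply/ler_addgt0Pl => e e0; rewrite addr0.
  have D0 : 0 < K + `|c| + 1 by rewrite ltr_wpDl// addr_ge0.
  apply: (le_trans (eps (e / (K + `|c| + 1)) _)); first exact: divr_gt0.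
  by rewrite mulrAC ler_pdivrMr// ler_wpM2l ?(ltW e0)// lerDl.
move=> e0.
pose N := (Num.truncn (2 * M / e)).+1.
have NM : 2 * M <= N%:R * e.
  by rewrite -ler_pdivrMr// ltW// truncnS_gt.
pose B l := [set x | l.+1%:R * e <= f x + M].
have mB l : measurable (B l).
  by apply: measurable_le => //; exact: measurable_funD.
pose g x := \sum_(l < N) e * \1_(B l) x - M.
have gf x : `|f x - g x| <= e.
  have -> : f x - g x = f x + M - staircase e N (f x + M).
    rewrite /g /staircase (eq_bigr (fun l : 'I_N =>
        e * \1_[set z | l.+1%:R * e <= z] (f x + M))); first by ring.
    by move=> l _; rewrite !indicE; congr (_ * _%:R); congr (nat_of_bool _);
      apply/idP/idP; rewrite !inE.
  apply: staircase_approx => //.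
  by have := fM x; rewrite ler_norml => /andP[h1 h2]; apply/andP; split; lra.
have bf : bounded_meas (fun w => f (X w)) by apply: bounded_meas_comp => //; exists M.
have bB l : bounded_meas (fun w => e * \1_(B l) (X w)).
  by apply: bounded_measM; [exact: bounded_meas_cst|exact: HZ].
have bg : bounded_meas (fun w => g (X w)).
  apply: bounded_measD; last exact: bounded_meas_cst.
  exact: bounded_meas_sum.
have Hg : Ex (fun w => g (X w) * Phi w) = Ex (fun w => g (X w)) * c.
  rewrite (@eq_Ex _ _ _ P _ (fun w => \sum_(l < N) (e * (\1_(B l) (X w) * Phi w)) - M * Phi w)); last first.
    by move=> w; rewrite /g mulrBl mulr_suml; congr (_ - _); apply: eq_bigr => l _; rewrite mulrA.
  rewrite ExB; last 2 first.
  - apply: int_sum => l; apply: intZ; apply: bounded_meas_int.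
    by apply: bounded_measM => //; exact: HZ.
  - by apply: intZ; exact: bounded_meas_int.
  rewrite ExZ; last exact: bounded_meas_int.
  rewrite H1 Ex_sum; last first.
    move=> l; apply: intZ; apply: bounded_meas_int.
    by apply: bounded_measM => //; exact: HZ.
  rewrite /g ExB; last 2 first.
  - by apply: bounded_meas_int; exact: bounded_meas_sum.
  - exact: int_cst.
  rewrite Ex_cst Ex_sum; last by move=> l; exact: bounded_meas_int.
  rewrite mulrBl mulr_suml; congr (_ - _); apply: eq_bigr => l _.
  rewrite ExZ; last by apply: bounded_meas_int; apply: bounded_measM => //; exact: HZ.
  by rewrite ExZ; [rewrite H// mulrA | apply: bounded_meas_int; exact: HZ].
have d1 : `|Ex (fun w => f (X w) * Phi w) - Ex (fun w => g (X w) * Phi w)| <= e * K.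
  rewrite -ExB; [|exact/bounded_meas_int/bounded_measM|exact/bounded_meas_int/bounded_measM].
  apply: Ex_abs_le.
    by apply: measurable_funB; apply: measurable_funM => //; [exact: bf.1|exact: bg.1].
  by move=> w; rewrite -mulrBl normrM; apply: ler_pM.
have d2 : `|Ex (fun w => f (X w)) - Ex (fun w => g (X w))| <= e.
  rewrite -ExB; [|exact: bounded_meas_int..].
  apply: Ex_abs_le; last by move=> w; exact: gf.
  by apply: measurable_funB; [exact: bf.1|exact: bg.1].
rewrite -[X in `|X|](subrKA (Ex (fun w => g (X w) * Phi w))).
apply: (le_trans (ler_normD _ _)); rewrite mulrDr; apply: lerD => //.
by rewrite Hg -mulrBl normrM; apply: ler_wpM2r => //; rewrite distrC.
Qed.

Context (I : choiceType) (X : I -> {RV P >-> R}).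
Hypothesis indep : mutually_independent X.

Lemma Ex_prod_indic (s : seq I) (B : I -> set R) : uniq s ->
  (forall i, measurable (B i)) ->
  Ex (fun w => \prod_(i <- s) \1_(B i) (X i w)) =
  \prod_(i <- s) Ex (fun w => \1_(B i) (X i w)).
Proof.
move=> us mB.
pose J : {fset I} := [fset i | i in s]%fset.
have mX i : measurable (X i @^-1` B i).
  by rewrite -[X in measurable X]setTI; exact: (measurable_funPT (X i)).
have mcap : measurable (\bigcap_(i in [set` J]) (X i @^-1` B i)).
  by apply: fin_bigcap_measurable => //; exact: finite_fset.
have EB i : Ex (fun w => \1_(B i) (X i w)) = pr (X i @^-1` B i).
  by rewrite -Ex_indic.
have sJ : perm_eq s J.
  apply: uniq_perm => // i; by rewrite !inE/=.
transitivity (pr (\bigcap_(i in [set` J]) (X i @^-1` B i))).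
  rewrite -Ex_indic//; apply: eq_Ex => w; rewrite indicE.
  rewrite (eq_bigr (fun i => ((X i w) \in B i)%:R)); last by move=> i _; rewrite indicE.
  case: (boolP (w \in _)) => [|h].
    rewrite inE => h; rewrite big1_seq// => i /andP[_ si].
    by rewrite mem_set//; apply: h => /=; rewrite !inE.
  apply/eqP; rewrite prodf_seq_eq0; apply/hasP.
  move: h; rewrite notin_setE => h.
  apply: contrapT => h2; apply: h => i /=; rewrite !inE/= => si.
  apply: contrapT => h3; apply: h2; exists i => //=.
  by rewrite memNset.
apply: EFin_inj; rewrite -prodEFin prE// indep//.
rewrite (perm_big _ sJ)/=; apply: eq_bigr => i _.
by rewrite EB prE.
Qed.

(** Independence is a statement about indicators; the factors are turned into
    arbitrary bounded functions one at a time, s1 listing those already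
    treated and s2 those that are still indicators. *)
Lemma Ex_prod_indep (s : seq I) (f : I -> R -> R) : uniq s ->
  (forall i, measurable_fun setT (f i)) ->
  (forall i, exists M, forall x, `|f i x| <= M) ->
  Ex (fun w => \prod_(i <- s) f i (X i w)) =
  \prod_(i <- s) Ex (fun w => f i (X i w)).
Proof.
move=> us mf bf.
suff gen s1 s2 (B : I -> set R) : uniq (s1 ++ s2) -> (forall i, measurable (B i)) ->
  Ex (fun w => (\prod_(i <- s1) f i (X i w)) * \prod_(i <- s2) \1_(B i) (X i w)) =
  (\prod_(i <- s1) Ex (fun w => f i (X i w))) *
  \prod_(i <- s2) Ex (fun w => \1_(B i) (X i w)).
  have := gen s [::] (fun=> setT); rewrite cats0 => /(_ us (fun=> measurableT)).
  by rewrite big_nil mulr1 => <-; apply: eq_Ex => w; rewrite big_nil mulr1.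
elim: s1 s2 B => [|k s1 IH] s2 B /=.
  move=> us2 mB; rewrite big_nil mul1r -Ex_prod_indic//.
  by apply: eq_Ex => w; rewrite big_nil mul1r.
move=> /andP[ks us12] mB.
rewrite big_cons -mulrA [X in _ = X]mulrC.
pose Phi w := (\prod_(i <- s1) f i (X i w)) * \prod_(i <- s2) \1_(B i) (X i w).
have bPhi : bounded_meas Phi.
  apply: bounded_measM; apply: bounded_meas_prod => i.
    exact: bounded_meas_comp.
  exact: bounded_meas_indic_comp.
rewrite [RHS]mulrC -(@indic_to_bounded (X k) Phi _ (f k))//.
  by apply: eq_Ex => w; rewrite /Phi big_cons mulrA.
move=> C mC.
pose B' i := if i == k then C else B i.
have := IH (k :: s2) B'.
have -> : uniq (s1 ++ k :: s2) by rewrite -cat1s uniq_catCA /= ks us12.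
have sB i : i \in s2 -> B' i = B i.
  by rewrite /B'; case: eqP => // -> h; move: ks; rewrite mem_cat h orbT.
have Bk : B' k = C by rewrite /B' eqxx.
move=> /(_ isT) IH'; transitivity (Ex (fun w => (\prod_(i <- s1) f i (X i w)) *
    \prod_(i <- k :: s2) \1_(B' i) (X i w))).
  apply: eq_Ex => w; rewrite /Phi big_cons Bk mulrCA; congr (_ * (_ * _)).
  by apply: eq_big_seq => i /sB ->.
rewrite IH'; last by move=> i; rewrite /B'; case: ifP.
rewrite big_cons Bk mulrCA; congr (_ * (_ * _)).
by apply: eq_big_seq => i /sB ->.
Qed.

End independence.

(** * Characteristic functions of linear forms *)

Section characteristic_functions.
Context (d : measure_display) (T : measurableType d) (R : realType).
Variable P : probability T R.
Local Notation Ex := (Ex P).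
Local Notation normc := ComplexField.Normc.normc.

Definition chf (X : T -> R) : R[i] :=
  Complex (Ex (fun w => cos (X w))) (Ex (fun w => sin (X w))).

Lemma bounded_meas_cos (X : T -> R) : measurable_fun setT X ->
  bounded_meas (fun w => cos (X w)).
Proof.
move=> mX; apply: bounded_meas_comp => //.
  by apply: continuous_measurable_fun; exact: continuous_cos.
by exists 1 => x; exact: cos_max.
Qed.

Lemma bounded_meas_sin (X : T -> R) : measurable_fun setT X ->
  bounded_meas (fun w => sin (X w)).
Proof.
move=> mX; apply: bounded_meas_comp => //.
  by apply: continuous_measurable_fun; exact: continuous_sin.
by exists 1 => x; exact: sin_max.
Qed.

Lemma one_sub_cos_double (y : R) : 1 - cos (2 * y) <= 4 * (1 - cos y).
Proof.
have -> : 2 * y = y + y by ring.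
rewrite cosD -!expr2; have := cos2Dsin2 y; have := cos_le1 y.
have := cos_geN1 y; set u := cos _; set v := sin _ => *; nra.
Qed.

Lemma Ex_sqr (f : T -> R) : bounded_meas f -> (Ex f) ^+ 2 <= Ex (fun w => f w ^+ 2).
Proof.
move=> bf; have bf2 : bounded_meas (fun w => f w ^+ 2) by exact: bounded_measM.
suff : 0 <= Ex (fun w => f w ^+ 2 - (2 * Ex f) * f w + Ex f ^+ 2).
  rewrite ExD; [|apply: intB|exact: int_cst]; last 2 first.
  - exact: bounded_meas_int.
  - by apply: intZ; exact: bounded_meas_int.
  rewrite ExB; [|exact: bounded_meas_int|by apply: intZ; exact: bounded_meas_int].
  rewrite ExZ; last exact: bounded_meas_int.
  by rewrite Ex_cst; lra.
apply: Rintegral_ge0 => w _.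
have -> : f w ^+ 2 - 2 * Ex f * f w + Ex f ^+ 2 = (f w - Ex f) ^+ 2 by ring.
exact: sqr_ge0.
Qed.

Lemma normc_sqr (z : R[i]) : normc z ^+ 2 = complex.Re z ^+ 2 + complex.Im z ^+ 2.
Proof. by case: z => a b /=; rewrite sqr_sqrtr// addr_ge0// sqr_ge0. Qed.

Lemma normc_ge0 (z : R[i]) : 0 <= normc z.
Proof. by case: z => a b /=; exact: sqrtr_ge0. Qed.

Lemma normc_Re (z : R[i]) : `|complex.Re z| <= normc z.
Proof.
rewrite -ler_sqr ?nnegrE ?normr_ge0 ?normc_ge0// normc_sqr real_normK ?num_real//.
by rewrite lerDl sqr_ge0.
Qed.

Lemma normc_chf_le1 X : measurable_fun setT X -> normc (chf X) <= 1.
Proof.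
move=> mX; rewrite -(@ler_pXn2r _ 2)// ?nnegrE ?normc_ge0// normc_sqr expr1n /=.
have bc := bounded_meas_cos mX; have bs := bounded_meas_sin mX.
apply: (le_trans (lerD (Ex_sqr bc) (Ex_sqr bs))).
rewrite -ExD; [|exact/bounded_meas_int/bounded_measM|exact/bounded_meas_int/bounded_measM].
rewrite (@eq_Ex _ _ _ P _ (fun=> 1)) ?Ex_cst// => w.
by rewrite cos2Dsin2.
Qed.

Context (I : choiceType) (xi : I -> {RV P >-> R}).
Hypothesis indep : mutually_independent xi.

Definition lin (s : seq I) (c : I -> R) (w : T) : R := \sum_(i <- s) c i * xi i w.

Lemma measurable_lin s c : measurable_fun setT (lin s c).
Proof. by apply: measurable_sum => i; apply: measurable_funM. Qed.

(** The multiplicativity of characteristic functions in real form. Peeling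
    off one summand with the addition formulas leaves a cosine or a sine of c
    k * xi k, which is absorbed into the product over r; this extra product
    is what makes the induction go through. *)
Lemma chf_lin_joint (c : I -> R) (s r : seq I) (f : I -> R -> R) :
  uniq (s ++ r) -> (forall i, measurable_fun setT (f i)) ->
  (forall i, exists M, forall x, `|f i x| <= M) ->
  let z := \prod_(i <- s) chf (fun w => c i * xi i w) in
  let g := \prod_(i <- r) Ex (fun w => f i (xi i w)) in
  Ex (fun w => cos (lin s c w) * \prod_(i <- r) f i (xi i w)) = complex.Re z * g /\
  Ex (fun w => sin (lin s c w) * \prod_(i <- r) f i (xi i w)) = complex.Im z * g.
Proof.
elim: s r f => [|k s IH] r f us mf bf z g.
  rewrite {}/z big_nil /= mul1r mul0r /g -Ex_prod_indep//; split.
    by apply: eq_Ex => w; rewrite /lin big_nil cos0 mul1r.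
  rewrite (@eq_Ex _ _ _ P _ (fun=> 0)) ?Ex_cst// => w.
  by rewrite /lin big_nil sin0 mul0r.
have us' : uniq (s ++ k :: r) by rewrite -cat1s uniq_catCA.
have kr : k \notin r by move: us => /= /andP[+ _]; rewrite mem_cat negb_or => /andP[].
pose fx (F : R -> R) i := if i == k then (fun x => F (c k * x)) else f i.
pose nice (F : R -> R) := measurable_fun setT F /\ exists M, forall x, `|F x| <= M.
have nc : nice cos.
  split; first by apply: continuous_measurable_fun; exact: continuous_cos.
  by exists 1 => x; exact: cos_max.
have ns : nice sin.
  split; first by apply: continuous_measurable_fun; exact: continuous_sin.
  by exists 1 => x; exact: sin_max.
have mfx F : nice F -> forall i, measurable_fun setT (fx F i).
  move=> [mF _] i; rewrite /fx; case: ifP => // _; apply: (measurableT_comp mF).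
  exact: measurable_funM.
have bfx F : nice F -> forall i, exists M, forall x, `|fx F i x| <= M.
  by move=> [_ [M FM]] i; rewrite /fx; case: ifP => // _; exists M.
have rk F i : i \in r -> fx F i = f i.
  by rewrite /fx => ir; case: eqP => // ik; move: kr; rewrite -ik ir.
have prx F w : \prod_(i <- k :: r) fx F i (xi i w) =
    F (c k * xi k w) * \prod_(i <- r) f i (xi i w).
  rewrite big_cons {1}/fx eqxx; congr (_ * _).
  by apply: eq_big_seq => i /(rk F) ->.
have gx F : \prod_(i <- k :: r) Ex (fun w => fx F i (xi i w)) =
    Ex (fun w => F (c k * xi k w)) * g.
  rewrite big_cons {1}/fx eqxx; congr (_ * _).
  by apply: eq_big_seq => i /(rk F) ->.
have [C1 S1] := IH (k :: r) (fx cos) us' (mfx _ nc) (bfx _ nc).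
have [C2 S2] := IH (k :: r) (fx sin) us' (mfx _ ns) (bfx _ ns).
move: C1 S1 C2 S2; rewrite !gx.
set z' := \prod_(i <- s) _ => C1 S1 C2 S2.
have zE : z = chf (fun w => c k * xi k w) * z' by rewrite /z big_cons.
have int_fx F G : nice F -> nice G ->
    P.-integrable setT (EFin \o (fun w => F (lin s c w) * \prod_(i <- k :: r) fx G i (xi i w))).
  move=> [mF bF] nG; apply: bounded_meas_int; apply: bounded_measM.
    exact: bounded_meas_comp (measurable_lin s c) mF bF.
  by apply: bounded_meas_prod => i; apply: bounded_meas_comp => //; [exact: mfx|exact: bfx].
split.
- rewrite (@eq_Ex _ _ _ P _ (fun w => cos (lin s c w) * \prod_(i <- k :: r) fx cos i (xi i w)
    - sin (lin s c w) * \prod_(i <- k :: r) fx sin i (xi i w))); last first.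
    by move=> w; rewrite !prx /lin big_cons cosD; ring.
  rewrite ExB; [|exact: int_fx..].
  by rewrite C1 S2 zE /chf; case: z' {C1 S1 C2 S2 zE} => ? ? /=; ring.
- rewrite (@eq_Ex _ _ _ P _ (fun w => sin (lin s c w) * \prod_(i <- k :: r) fx cos i (xi i w)
    + cos (lin s c w) * \prod_(i <- k :: r) fx sin i (xi i w))); last first.
    by move=> w; rewrite !prx /lin big_cons sinD; ring.
  rewrite ExD; [|exact: int_fx..].
  by rewrite S1 C2 zE /chf; case: z' {C1 S1 C2 S2 zE} => ? ? /=; ring.
Qed.

Lemma chf_lin (c : I -> R) (s : seq I) : uniq s ->
  chf (lin s c) = \prod_(i <- s) chf (fun w => c i * xi i w).
Proof.
move=> us.
have [] := @chf_lin_joint c s [::] (fun _ _ => 0).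
- by rewrite cats0.
- by [].
- by move=> _; exists 0 => x; rewrite normr0.
rewrite !big_nil !mulr1 => C S.
rewrite [RHS]complexE /chf; move: C S; set z := \prod_(_ <- _) _ => C S.
have -> : Ex (fun w => cos (lin s c w)) = complex.Re z.
  by rewrite -C; apply: eq_Ex => w; rewrite mulr1.
have E2 : Ex (fun w => sin (lin s c w)) = complex.Im z.
  by rewrite -S; apply: eq_Ex => w; rewrite mulr1.
by rewrite -complexE E2; case: z {C S E2}.
Qed.

Lemma normc_prod (J : Type) (s : seq J) (F : J -> R[i]) :
  normc (\prod_(i <- s) F i) = \prod_(i <- s) normc (F i).
Proof.
elim: s => [|k s IH]; first by rewrite !big_nil ComplexField.Normc.normc1.
by rewrite !big_cons ComplexField.Normc.normcM IH.
Qed.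

Hypothesis idistr : identically_distributed xi.

Lemma Ex_idistr (f : R -> R) i j : measurable_fun setT f ->
  (exists M, forall x, `|f x| <= M) ->
  Ex (fun w => f (xi i w)) = Ex (fun w => f (xi j w)).
Proof.
move=> mf bf.
have H k : Ex (fun w => f (xi k w)) = \int[distribution P (xi k)]_x f x.
  rewrite /Rintegral integral_distribution//; first exact/measurable_EFinP.
  by apply: bounded_meas_int; exact: bounded_meas_comp.
rewrite !H; congr fine; apply: eq_measure_integral => A mA _.
exact: idistr.
Qed.

Lemma chf_idistr (s : R) i j : chf (fun w => s * xi i w) = chf (fun w => s * xi j w).
Proof.
have mck : measurable_fun setT (fun x : R => s * x) by apply: measurable_funM.
rewrite /chf; congr Complex.
- apply: (@Ex_idistr (fun x => cos (s * x))).
    by apply: (measurableT_comp _ mck); apply: continuous_measurable_fun; exact: continuous_cos.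
  by exists 1 => x; exact: cos_max.
- apply: (@Ex_idistr (fun x => sin (s * x))).
    by apply: (measurableT_comp _ mck); apply: continuous_measurable_fun; exact: continuous_sin.
  by exists 1 => x; exact: sin_max.
Qed.

Context (i0 j0 : I).
Hypothesis ij0 : i0 != j0.

Definition phi (s : R) : R[i] := chf (fun w => s * xi i0 w).

Lemma normc_phi_le1 s : normc (phi s) <= 1.
Proof. by apply: normc_chf_le1; apply: measurable_funM. Qed.

(** The squared modulus is the characteristic function of the symmetrised
    variable xi i0 - xi j0, which is real. *)
Lemma normc_phi_sqrE s :
  normc (phi s) ^+ 2 = Ex (fun w => cos (s * (xi i0 w - xi j0 w))).
Proof.
pose c i : R := if i == i0 then s else - s.
have u2 : uniq [:: i0; j0] by rewrite /= inE ij0.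
have := chf_lin c u2; rewrite !big_cons big_nil mulr1 /c eqxx eq_sym (negbTE ij0).
rewrite (chf_idistr _ j0 i0) => E.
have -> : (fun w => cos (s * (xi i0 w - xi j0 w))) = (fun w => cos (lin [:: i0; j0] c w)).
  apply/funext => w; rewrite /lin !big_cons big_nil addr0 /c eqxx eq_sym (negbTE ij0).
  by congr cos; ring.
have -> : Ex (fun w => cos (lin [:: i0; j0] c w)) = complex.Re (chf (lin [:: i0; j0] c)).
  by [].
rewrite E normc_sqr /phi /chf /=.
have -> : Ex (fun w => cos (- s * xi i0 w)) = Ex (fun w => cos (s * xi i0 w)).
  by apply: eq_Ex => w; rewrite mulNr cosN.
have -> : Ex (fun w => sin (- s * xi i0 w)) = - Ex (fun w => sin (s * xi i0 w)).
  rewrite -[RHS]mulN1r -[RHS](@ExZ _ _ _ P (-1) (fun w => sin (s * xi i0 w))); last first.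
    by apply: bounded_meas_int; apply: bounded_meas_sin; exact: measurable_funM.
  by apply: eq_Ex => w; rewrite mulNr sinN mulN1r.
by ring.
Qed.

(** By the previous identity both sides are integrals of 1 - cos, and 1 - cos
    2y <= 4 (1 - cos y) pointwise. *)
Lemma phi_doubling s : 1 - normc (phi (2 * s)) ^+ 2 <= 4 * (1 - normc (phi s) ^+ 2).
Proof.
rewrite !normc_phi_sqrE.
have mc (a : R) : P.-integrable setT (EFin \o (fun w => cos (a * (xi i0 w - xi j0 w)))).
  apply: bounded_meas_int; apply: bounded_meas_cos; apply: measurable_funM => //.
  exact: measurable_funB.
rewrite -(Ex_cst P 1) -!ExB//; [|exact: int_cst..].
rewrite -ExZ; last by apply: intB => //; exact: int_cst.
apply: Ex_le => //; first by apply: intB => //; exact: int_cst.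
  by apply: intZ; apply: intB => //; exact: int_cst.
by move=> w; rewrite Ex_cst -mulrA; exact: one_sub_cos_double.
Qed.

(** Near the origin the gap 1 - |phi s|^2 is at least quadratic. Doubling s
    until it lies between r and 2 r, where the Cramer bound leaves a definite
    gap, multiplies s^2 by 4 at each stage and the gap by at most 4. *)
Lemma phi_gaussian_decay (C0 r beta : R) : 0 < C0 -> 0 < r -> 0 <= beta ->
  (forall s, r < `|s| -> normc (phi s) <= 1 - C0 / `|s| `^ beta) ->
  exists2 c0, 0 < c0 & forall s, `|s| <= 2 * r ->
    c0 * s ^+ 2 <= 1 - normc (phi s) ^+ 2.
Proof.
move=> C00 r0 b0 H.
pose m := C0 / (2 * r) `^ beta.
have m0 : 0 < m by rewrite divr_gt0// powR_gt0// mulr_gt0.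
have r20 : 0 < (2 * r) ^+ 2 by rewrite exprn_gt0// mulr_gt0.
exists (m / (2 * r) ^+ 2); first by rewrite divr_gt0.
suff gen k s : r / 2 ^+ k < `|s| -> `|s| <= 2 * r ->
    m / (2 * r) ^+ 2 * s ^+ 2 <= 1 - normc (phi s) ^+ 2.
  move=> s sr; have [->|s0] := eqVneq s 0.
    rewrite expr0n mulr0 subr_ge0 expr_le1 ?normc_phi_le1//.
    exact: normc_ge0.
  have s0' : 0 < `|s| by rewrite normr_gt0.
  pose k := Num.truncn (r / `|s|).
  have kr : r / `|s| < k.+1%:R by exact: truncnS_gt.
  apply: (@gen k.+1) => //; rewrite ltr_pdivrMr ?exprn_gt0//.
  rewrite -ltr_pdivrMl//  mulrC; apply: (lt_trans kr).
  by rewrite -natrX ltr_nat ltn_expl.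
elim: k s => [|k IH] s.
  rewrite expr0 divr1 => rs sr.
  have s2 : s ^+ 2 <= (2 * r) ^+ 2.
    by rewrite -real_normK ?num_real// ler_sqr ?nnegrE// mulr_ge0// ltW.
  apply: (@le_trans _ _ m).
    by rewrite mulrAC ler_pdivrMr// ler_wpM2l// ltW.
  have h1 := H s rs; have h2 := normc_ge0 (phi s); have h3 := normc_phi_le1 s.
  have : m <= C0 / `|s| `^ beta.
    have spos : 0 < `|s| by apply: lt_trans rs.
    rewrite /m ler_wpM2l// ?(ltW C00)// lef_pV2 ?posrE ?powR_gt0// ?mulr_gt0//.
    by apply: ge0_ler_powR => //; rewrite ?nnegrE ?mulr_ge0// ltW.
  move: h1 h2 h3; set x := normc _; set y := C0 / _ => *; nra.
move=> sk sr.
case: (ltP (r / 2 ^+ k) `|s|) => [sk'|sk']; first exact: IH.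
have n2 : `|2 * s| = 2 * `|s| by rewrite normrM ger0_norm.
have := IH (2 * s); rewrite n2 => /(_ _ _)/le_trans.
have h1 : r / 2 ^+ k < 2 * `|s|.
  have -> : r / 2 ^+ k = 2 * (r / 2 ^+ k.+1).
    by rewrite exprS; field; rewrite expf_neq0.
  by rewrite ltr_pM2l.
have h2 : 2 * `|s| <= 2 * r.
  rewrite ler_pM2l//; apply: (le_trans sk').
  by rewrite ler_pdivrMr ?exprn_gt0// ler_peMr ?(ltW r0)// -natrX ler1n expn_gt0.
move=> /(_ _ h1 h2 (phi_doubling s)).
have -> : m / (2 * r) ^+ 2 * (2 * s) ^+ 2 = 4 * (m / (2 * r) ^+ 2 * s ^+ 2).
  by field; rewrite gt_eqF.
by rewrite ler_pM2l.
Qed.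

End characteristic_functions.

(** * Small ball probabilities of linear forms *)

Section index_set.

Definition idx (n : nat) : seq (nat + nat) :=
  [seq inl k | k <- iota 0 n] ++ [seq inr k | k <- iota 0 n].

Lemma uniq_idx n : uniq (idx n).
Proof.
rewrite cat_uniq !map_inj_uniq ?iota_uniq//; try by move=> ? ? [].
by rewrite andbT; apply/hasPn => _ /mapP[k _ ->]; apply/negP => /mapP[].
Qed.

Lemma big_idx (R : Type) (z : R) (op : Monoid.com_law z) n (F : nat + nat -> R) :
  \big[op/z]_(i <- idx n) F i = \big[op/z]_(k < n) op (F (inl (k : nat))) (F (inr (k : nat))).
Proof.
rewrite big_cat !big_map big_split /=.
have -> : iota 0 n = index_iota 0 n by rewrite /index_iota subn0.
by rewrite !big_mkord.
Qed.

End index_set.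

Section small_ball.
Context (d : measure_display) (T : measurableType d) (R : realType).
Variable P : probability T R.
Local Notation Ex := (Ex P).
Local Notation pr := (pr P).
Local Notation normc := ComplexField.Normc.normc.

(** Each distance |l - j| is attained at most twice as j varies. *)
Lemma sum_dist_le (m l : nat) (B : nat -> R) : (l < m)%N -> (forall i, 0 <= B i) ->
  \sum_(j < m) B (maxn l j - minn l j)%N <= 2 * \sum_(i < m) B i.
Proof.
move=> lm B0.
have sumS a b : (a <= b)%N -> \sum_(0 <= i < a) B i <= \sum_(0 <= i < b) B i.
  by move=> ab; rewrite (big_cat_nat _ ab)//= lerDl sumr_ge0.
rewrite -(big_mkord xpredT (fun j => B (maxn l j - minn l j)%N)).
rewrite -(big_mkord xpredT B) (@big_cat_nat _ _ _ l)//=; last exact: ltnW.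
rewrite mulr2n mulrDl mul1r; apply: lerD.
  rewrite big_nat_rev/= add0n.
  apply: (le_trans _ (sumS l.+1 m lm)).
  rewrite [leRHS]big_nat_recl//=.
  rewrite ler_wpDl// le_eqVlt; apply/orP; left; apply/eqP.
  apply: eq_big_nat => i /andP[_ il]; congr B; lia.
rewrite -{1}[l]add0n big_addn.
apply: (le_trans _ (sumS (m - l)%N m (leq_subr _ _))).
rewrite le_eqVlt; apply/orP; left; apply/eqP.
apply: eq_big_nat => i _; congr B; lia.
Qed.

(** On the event that |S| <= 1/m each of the m cosines cos(l S) is at least
    1/2, so the squared modulus D of the sum of the exp(i l S) is at least
    m^2 / 4. Its mean is a double sum of E cos((l - j) S), so Markov's
    inequality bounds the probability by real parts of the characteristic
    function of S at the integers below m. *)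
Lemma fejer_small_ball (S : T -> R) (m : nat) (B : nat -> R) :
  measurable_fun setT S -> (0 < m)%N -> (forall l, 0 <= B l) ->
  (forall l, (l < m)%N -> Ex (fun w => cos (l%:R * S w)) <= B l) ->
  pr [set w | `|S w| <= m%:R^-1] <= 8 / m%:R * \sum_(l < m) B l.
Proof.
move=> mS m0 B0 HB.
have mR : 0 < m%:R :> R by rewrite ltr0n.
have mE (c : R) : m%:R * c = \sum_(l < m) c by rewrite sumr_const card_ord mulr_natl.
have mlS (l : R) : measurable_fun setT (fun w => l * S w) by apply: measurable_funM.
have bc (l : R) : bounded_meas (fun w => cos (l * S w)) by exact: bounded_meas_cos.
have bs (l : R) : bounded_meas (fun w => sin (l * S w)) by exact: bounded_meas_sin.
pose D w := (\sum_(l < m) cos (l%:R * S w)) ^+ 2 + (\sum_(l < m) sin (l%:R * S w)) ^+ 2.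
have DE w : D w = \sum_(l < m) \sum_(j < m) cos ((maxn l j - minn l j)%:R * S w).
  rewrite /D !expr2 !big_distrlr /= -big_split /=; apply: eq_bigr => l _.
  rewrite -big_split /=; apply: eq_bigr => j _.
  case: (leqP l j) => lj.
    rewrite natrB// mulrBl cosB; ring.
  by rewrite natrB ?(ltnW lj)// mulrBl cosB.
have key : m%:R ^+ 2 / 4 * pr [set w | `|S w| <= m%:R^-1] <= Ex D.
  apply: markov_pr.
  - apply: measurable_le => //; exact: measurableT_comp.
  - apply: bounded_meas_int; apply: bounded_measD; apply: bounded_measM;
      exact: bounded_meas_sum.
  - by move=> w; rewrite addr_ge0// sqr_ge0.
  - move=> w /= Sw; rewrite /D.
    have : m%:R / 2 <= \sum_(l < m) cos (l%:R * S w).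
      rewrite mE.
      apply: ler_sum => l _; rewrite -[2^-1]mul1r; apply: cos_ge_half; rewrite normrM.
      apply: (@le_trans _ _ (m%:R * m%:R^-1)); last by rewrite mulfV// gt_eqF.
      by rewrite ler_pM// normr_nat ler_nat ltnW.
    set u := \sum_(_ < _) _; set v := \sum_(_ < _) _; nra.
have ExD : Ex D <= m%:R * (2 * \sum_(l < m) B l).
  rewrite (@eq_Ex _ _ _ P _ _ DE) Ex_sum; last first.
    by move=> l; apply: int_sum => j; exact: bounded_meas_int.
  rewrite mE; apply: ler_sum => l _.
  rewrite Ex_sum; last by move=> j; exact: bounded_meas_int.
 apply: (le_trans _ (sum_dist_le (ltn_ord l) B0)).
  apply: ler_sum => j _; apply: HB.
  have := ltn_ord l; have := ltn_ord j; lia.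
have := le_trans key ExD; set p := pr _; set s := \sum_(_ < _) _ => h.
rewrite mulrAC ler_pdivlMr//.
have : m%:R * (p * m%:R) <= m%:R * (8 * s) by lra.
by rewrite ler_pM2l.
Qed.

Context (xi : nat + nat -> {RV P >-> R}).
Hypothesis indep : mutually_independent xi.
Hypothesis idistr : identically_distributed xi.
Context (beta : R).
Hypothesis beta_ge0 : 0 <= beta.
Hypothesis beta_lt1 : beta < 1.
Hypothesis cramer : cramer_class P beta (fun w => \row_(j < 1) xi (inl 0%N) w).

Let phi0 := phi xi (inl 0%N).

Lemma phi_cramer : exists C r : R, [/\ 0 < C, 0 < r &
  forall s, r < `|s| -> normc (phi0 s) <= 1 - C / `|s| `^ beta].
Proof.
have [C [r [C0 r0 H]]] := cramer; exists C, r; split => // s rs.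
pose t : 'rV[R]_1 := \row_(j < 1) s.
have nt : norm2 t = `|s|.
  by rewrite /norm2 /dotv big_ord1 !mxE -expr2 sqrtr_sqr.
have := H t; rewrite nt => /(_ rs); congr (normc _ <= _).
rewrite /char_fun /phi0 /chf; congr Complex; apply: eq_Ex => w;
  by rewrite /dotv big_ord1 !mxE.
Qed.

(** The larger of |a| and |b| is comparable with rho. Either it is at most 2
    r, and the quadratic gap applies, or it is beyond r, and the Cramer bound
    applies. *)
Lemma phi_pair_decay : exists c C : R, [/\ 0 < c, 0 < C &
  forall a b rho : R, 0 < rho -> rho ^+ 2 <= a ^+ 2 + b ^+ 2 <= (2 * rho) ^+ 2 ->
  normc (phi0 a) * normc (phi0 b) <=
    expR (- Num.min (c * rho ^+ 2) (C / (2 * rho) `^ beta))].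
Proof.
have [C [r [C0 r0 H]]] := phi_cramer.
have ij : (inl 0%N : nat + nat) != inr 0%N by [].
have [c c0 Hc] := phi_gaussian_decay indep idistr ij C0 r0 beta_ge0 H.
exists (c / 4), (C / 2); split; rewrite ?divr_gt0//.
move=> a b rho rho0.
wlog ab : a b / `|b| <= `|a| => [Hw|].
  case: (leP `|b| `|a|) => [|/ltW ba]; first exact: Hw.
  move=> h; rewrite [X in X <= _]mulrC; apply: Hw => //; by rewrite addrC.
have a2 : `|a| ^+ 2 = a ^+ 2 by rewrite real_normK ?num_real.
have b2 : `|b| ^+ 2 = b ^+ 2 by rewrite real_normK ?num_real.
have a0 := normr_ge0 a; have b0 := normr_ge0 b.
have [p0 p1] := (normc_ge0 (phi0 a), normc_phi_le1 xi (inl 0%N : nat + nat) a : normc (phi0 a) <= 1).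
have [q0 q1] := (normc_ge0 (phi0 b), normc_phi_le1 xi (inl 0%N : nat + nat) b : normc (phi0 b) <= 1).
move=> /andP[h1 h2].
have rho2 : 0 < rho ^+ 2 by rewrite exprn_gt0.
have ale : `|a| <= 2 * rho by nra.
have age : rho ^+ 2 / 2 <= a ^+ 2 by nra.
have apos : 0 < `|a| by nra.
apply: (@le_trans _ _ (normc (phi0 a))); first by nra.
suff D : 2 * Num.min (c / 4 * rho ^+ 2) (C / 2 / (2 * rho) `^ beta) <=
    1 - normc (phi0 a) ^+ 2.
  rewrite -ler_sqr ?nnegrE ?expR_ge0//.
  rewrite -expRM_natr; apply: le_trans (expR_ge1Dx _).
  by move: D; set m := Num.min _ _; lra.
(* r is the radius beyond which the Cramer bound holds *)
case: (leP `|a| (2 * r)) => ar.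
  apply: (@le_trans _ _ (2 * (c / 4 * rho ^+ 2))); first by rewrite ler_pM2l// ge_min lexx.
  by apply: (le_trans _ (Hc _ ar)); nra.
apply: (@le_trans _ _ (2 * (C / 2 / (2 * rho) `^ beta))).
  by rewrite ler_pM2l// ge_min lexx orbT.
have ra : r < `|a| by apply: le_lt_trans ar; lra.
have := H _ ra.
have : 2 * (C / 2 / (2 * rho) `^ beta) <= C / `|a| `^ beta.
  have -> : 2 * (C / 2 / (2 * rho) `^ beta) = C / (2 * rho) `^ beta by field; rewrite gt_eqF// powR_gt0// mulr_gt0.
  rewrite ler_wpM2l// ?(ltW C0)// lef_pV2 ?posrE ?powR_gt0// ?mulr_gt0//.
  by apply: ge0_ler_powR => //; rewrite ?nnegrE ?mulr_ge0// ltW.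
move: p0 p1; set x := normc _; set y := C / _; nra.
Qed.

(** The n pairs of coefficients contribute n factors, each at the scale rho =
    l / sqrt n. In the quadratic regime they multiply to exp(- c l^2), in the
    Cramer regime to exp(- C n / rho^beta), and rho <= n because l <=
    n^(3/2): this restriction on the frequency is what keeps the second term
    at exp(- C n^(1 - beta)). *)
Lemma chf_lin_decay : exists c C : R, [/\ 0 < c, 0 < C &
  forall (n l : nat) (a : nat + nat -> R), (0 < n)%N -> (l ^ 2 <= n ^ 3)%N ->
  (forall k, (k < n)%N -> n%:R^-1 <= a (inl k) ^+ 2 + a (inr k) ^+ 2 <= 4 / n%:R) ->
  normc (chf P (fun w => l%:R * lin xi (idx n) a w)) <=
    expR (- c) ^+ l + expR (- (C * n%:R `^ (1 - beta)))].
Proof.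
have [c [C [c0 C0 H]]] := phi_pair_decay.
exists c, (C / 2); split => //; first by rewrite divr_gt0.
move=> n l a n0 ln ha.
have nR : 0 < n%:R :> R by rewrite ltr0n.
case: (posnP l) => [->|l0].
  rewrite expr0; apply: (@le_trans _ _ 1); last by rewrite lerDl expR_ge0.
  apply: normc_chf_le1; apply: measurable_funM => //; exact: measurable_lin.
have lR : 0 < l%:R :> R by rewrite ltr0n.
have -> : (fun w => l%:R * lin xi (idx n) a w) = lin xi (idx n) (fun i => l%:R * a i).
  by apply/funext => w; rewrite /lin mulr_sumr; apply: eq_bigr => i _; rewrite mulrA.
rewrite (chf_lin indep _ (uniq_idx n)) normc_prod.
rewrite (eq_bigr (fun i => normc (phi0 (l%:R * a i)))); last first.
  by move=> i _; rewrite /phi0 /phi (chf_idistr idistr _ i (inl 0%N)).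
rewrite big_idx /=.
pose rho : R := l%:R / Num.sqrt n%:R.
have sn : 0 < Num.sqrt n%:R :> R by rewrite sqrtr_gt0.
have sn2 : Num.sqrt n%:R ^+ 2 = n%:R :> R by rewrite sqr_sqrtr// ler0n.
have rho0 : 0 < rho by rewrite divr_gt0.
have rho2 : rho ^+ 2 = l%:R ^+ 2 / n%:R by rewrite /rho expr_div_n sn2.
set m := Num.min (c * rho ^+ 2) (C / (2 * rho) `^ beta) in H *.
apply: (@le_trans _ _ (\prod_(k < n) expR (- Num.min (c * rho ^+ 2) (C / (2 * rho) `^ beta)))).
  apply: ler_prod => k _; rewrite mulr_ge0 ?normc_ge0//=.
  apply: H => //; have /andP[h1 h2] := ha _ (ltn_ord k).
  have -> : (2 * rho) ^+ 2 = 4 * rho ^+ 2 by ring.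
  have -> : forall x y : R, (l%:R * x) ^+ 2 + (l%:R * y) ^+ 2 =
    l%:R ^+ 2 * (x ^+ 2 + y ^+ 2) by move=> x y; ring.
  rewrite rho2; apply/andP; split.
    by rewrite ler_wpM2l// sqr_ge0.
  rewrite mulrCA ler_wpM2l// ?sqr_ge0//; apply: (le_trans h2); lra.
rewrite prodr_const card_ord -expRM_natr.
set M := Num.min _ _.
have : M = c * rho ^+ 2 \/ M = C / (2 * rho) `^ beta.
  by rewrite /M /Order.min; case: ifP; [left|right].
case=> ->.
  rewrite rho2 -[leLHS]addr0; apply: lerD; last exact: expR_ge0.
  rewrite -expRM_natr ler_expR.
  have -> : - (c * (l%:R ^+ 2 / n%:R)) * n%:R = - c * l%:R ^+ 2 :> R by field; rewrite gt_eqF.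
  have : l%:R <= l%:R ^+ 2 :> R by rewrite -natrX ler_nat -{1}(expn1 l) leq_pexp2l.
  nra.
rewrite -[leLHS]add0r; apply: lerD; first by rewrite exprn_ge0// expR_ge0.
rewrite ler_expR mulNr lerN2 mulrAC -mulrA -mulrA ler_pM2l//.
have rn : 2 * rho <= 2 * n%:R.
  rewrite ler_pM2l// /rho ler_pdivrMr//.
  have : l%:R ^+ 2 <= (n%:R * Num.sqrt n%:R) ^+ 2 :> R.
    by rewrite exprMn sn2 -exprSr -!natrX ler_nat.
  by rewrite ler_sqr ?nnegrE ?mulr_ge0 ?ler0n ?(ltW sn).
have rb : (2 * rho) `^ beta <= (2 * n%:R) `^ beta.
  by apply: ge0_ler_powR => //; rewrite ?nnegrE ?mulr_ge0// ltW.
have nb : (2 * n%:R) `^ beta <= 2 * n%:R `^ beta :> R.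
  rewrite powRM// ler_wpM2r ?powR_ge0//.
  rewrite -[leRHS]powRr1 ?ler0n//; apply: ler_powR; first by rewrite ler1n.
  exact: ltW.
have e : n%:R `^ (1 - beta) * n%:R `^ beta = n%:R :> R.
  by rewrite -powRD ?subrK ?powRr1// gt_eqF// implybT.
have pb : 0 < n%:R `^ beta :> R by rewrite powR_gt0.
have p1b : 0 < n%:R `^ (1 - beta) :> R by rewrite powR_gt0.
rewrite [X in _ <= X]mulrC ler_pdivlMr ?powR_gt0 ?mulr_gt0 ?invr_gt0//.
move: rb nb e pb p1b; set x := n%:R `^ (1 - beta); set y := n%:R `^ beta => rb nb e pb p1b.
have := le_trans rb nb; set z := _ `^ _ => hz; nra.
Qed.

Lemma n_small_exp_cvg0 (C g : R) : 0 < C -> 0 < g ->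
  n%:R * expR (- (C * n%:R `^ g)) @[n --> \oo] --> (0 : R).
Proof.
move=> C0 g0.
pose k := Num.truncn (2 / g).
have kg : 2 <= k.+1%:R * g.
  by rewrite -ler_pdivrMr// ltW// truncnS_gt.
pose A := (k.+1%:R / C) ^+ k.+1.
have A0 : 0 < A by rewrite exprn_gt0// divr_gt0.
apply: (@squeeze_cvgr _ _ _ _ (fun=> 0) (fun n => A * n%:R^-1)); last 2 first.
- exact: cvg_cst.
- rewrite -[X in _ --> X](mulr0 A); apply: cvgM; first exact: cvg_cst.
  by rewrite -(cvg_shiftS _); exact: cvg_harmonic.
near=> n.
have n0 : (0 < n)%N by near: n; exists 1%N.
have nR : 0 < n%:R :> R by rewrite ltr0n.
rewrite mulr_ge0 ?expR_ge0//=.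
have h : (C * n%:R `^ g / k.+1%:R) ^+ k.+1 <= expR (C * n%:R `^ g).
  by apply: expR_ge_pow; rewrite mulr_ge0// ?powR_ge0// ltW.
have h2 : A^-1 * n%:R ^+ 2 <= expR (C * n%:R `^ g).
  apply: le_trans h; rewrite mulrAC exprMn; apply: ler_pM => //.
  - by rewrite invr_ge0 ltW.
  - by rewrite /A -exprVn invf_div.
  - rewrite -!powR_mulrn ?powR_ge0 ?ler0n// -powRrM; apply: ler_powR; first by rewrite ler1n.
    by rewrite mulrC.
rewrite expRN ler_pdivrMr ?expR_gt0//.
apply: (@le_trans _ _ (A / n%:R * (A^-1 * n%:R ^+ 2))).
  by rewrite le_eqVlt; apply/orP; left; apply/eqP; field; rewrite !gt_eqF.
by rewrite ler_wpM2l// divr_ge0// ltW.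
Unshelve. all: by end_near. Qed.

(** Linear forms of variance of order 1, spread evenly over the pairs of
    coefficients, have no atoms down to scale n^(-3/2). The remainder rn is
    o(1/n); this is essential, since it will be paid for about n events on
    each step of the grid. It is where beta < 1 is used. *)
Lemma small_ball : exists (K : R) (rn : nat -> R), [/\ 0 <= K,
  forall n, 0 <= rn n, n%:R * rn n @[n --> \oo] --> (0 : R) &
  forall (n : nat) (a : nat + nat -> R), (0 < n)%N ->
  (forall k, (k < n)%N -> n%:R^-1 <= a (inl k) ^+ 2 + a (inr k) ^+ 2 <= 4 / n%:R) ->
  forall eta, 0 <= eta ->
  pr [set w | `|lin xi (idx n) a w| <= eta] <= K * eta + rn n].
Proof.
have [c [C [c0 C0 H]]] := chf_lin_decay.
have g0 : 0 < 1 - beta by rewrite subr_gt0.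
pose q := expR (- c); pose e n := expR (- (C * n%:R `^ (1 - beta))).
have q01 : 0 <= q < 1 by rewrite expR_ge0/= -expR0 ltr_expR; lra.
have q0 : 0 < 1 - q by case/andP: q01; lra.
pose K1 := 8 / (1 - q).
have K10 : 1 <= K1 by rewrite ler_pdivlMr//; case/andP: q01; lra.
(* u n is the finest scale that frequencies up to n^(3/2) resolve; m below is
   about 1 / max(eta, u n) *)
pose u n : R := (n%:R * Num.sqrt n%:R)^-1.
have u0 n : 0 <= u n by rewrite invr_ge0 mulr_ge0// sqrtr_ge0.
exists (2 * K1), (fun n => 2 * K1 * u n + 8 * e n); split.
- by rewrite mulr_ge0//; lra.
- by move=> n; rewrite addr_ge0// mulr_ge0// ?expR_ge0//; lra.
- have -> : (fun n => n%:R * (2 * K1 * u n + 8 * e n)) =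
     (fun n => 2 * K1 * (n%:R * u n) + 8 * (n%:R * e n)).
    by apply/funext => n; ring.
  rewrite -[X in _ --> X](_ : 2 * K1 * 0 + 8 * 0 = 0); last by ring.
  apply: cvgD; apply: cvgM; try exact: cvg_cst; last exact: n_small_exp_cvg0.
  have -> : (fun n => n%:R * u n) = (fun n => Num.sqrt (n%:R^-1)).
    apply/funext => n; rewrite /u; have [->|n0] := posnP n.
      by rewrite invr0 sqrtr0 mul0r.
    have nR : 0 < n%:R :> R by rewrite ltr0n.
    by rewrite sqrtrV ?ler0n// invfM mulrA mulfV ?mul1r// gt_eqF.
  suff : Num.sqrt (n%:R^-1) @[n --> \oo] --> Num.sqrt (0 : R) by rewrite sqrtr0.
  rewrite -(cvg_shiftS _).
  by apply: (cvg_comp _ _ cvg_harmonic); exact: sqrt_continuous.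
move=> n a n0 ha eta eta0.
have nR : 0 < n%:R :> R by rewrite ltr0n.
have sn : 0 < Num.sqrt n%:R :> R by rewrite sqrtr_gt0.
have un : 0 < u n by rewrite invr_gt0 mulr_gt0.
have un1 : u n <= 1.
  have sn1 : 1 <= Num.sqrt n%:R :> R by rewrite -[leLHS]sqrtr1 ler_wsqrtr// ler1n.
  by rewrite invf_le1 ?mulr_gt0// mulr_ege1// ler1n.
have e0 : 0 <= e n by exact: expR_ge0.
set E := [set _ | _].
have mlin : measurable_fun setT (lin xi (idx n) a) by exact: measurable_lin.
have mE z : measurable [set w | `|lin xi (idx n) a w| <= z].
  by apply: measurable_le => //; exact: measurableT_comp.
have pE1 : pr E <= 1 by apply: pr_le1; exact: mE.
case: (leP 1 eta) => eta1.
  apply: (le_trans pE1); rewrite -[leLHS]addr0; apply: lerD; first by nra.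
  by rewrite addr_ge0// mulr_ge0//; lra.
pose z := Num.max eta (u n).
have z0 : 0 < z by rewrite lt_max un orbT.
have z1 : z <= 1 by rewrite ge_max un1 ltW.
have uz : u n <= z by rewrite le_max lexx orbT.
have zs : z <= eta + u n by rewrite ge_max lerDl lerDr u0 eta0.
pose m := Num.truncn z^-1.
have zi : 1 <= z^-1 by rewrite invf_ge1.
have m0 : (0 < m)%N by rewrite truncn_gt0.
have mz : m%:R <= z^-1 by rewrite truncn_le invr_ge0 ltW.
have mz2 : z^-1 < m.+1%:R by exact: truncnS_gt.
have mR : 0 < m%:R :> R by rewrite ltr0n.
have zm : z <= m%:R^-1 by rewrite -[z]invrK lef_pV2// posrE ?invr_gt0.
have m2z : m%:R^-1 <= 2 * z.
  rewrite -[leLHS]mul1r ler_pdivrMr//.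
  have h1 : 1 <= z * m.+1%:R by rewrite mulrC -ler_pdivrMr// mul1r ltW.
  apply: (le_trans h1); rewrite -mulrA mulrCA; apply: ler_wpM2l; first exact: ltW.
  by rewrite -natrM ler_nat mul2n -addnn -addn1 leq_add2l.
have mn : (m ^ 2 <= n ^ 3)%N.
  rewrite -(ler_nat R) !natrX.
  have h : m%:R <= n%:R * Num.sqrt n%:R :> R.
    by apply: (le_trans mz); rewrite -[leRHS]invrK lef_pV2// posrE.
  have : m%:R ^+ 2 <= (n%:R * Num.sqrt n%:R) ^+ 2 :> R.
    by rewrite ler_sqr ?nnegrE ?mulr_ge0 ?ler0n ?(ltW sn).
  by rewrite exprMn sqr_sqrtr ?ler0n// -exprSr.
apply: (@le_trans _ _ (pr [set w | `|lin xi (idx n) a w| <= m%:R^-1])).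
  apply: pr_le; [exact: mE|exact: mE|move=> w /= hw; apply: (le_trans hw)].
  by apply: (le_trans _ zm); rewrite le_max lexx.
apply: (@le_trans _ _ (8 / m%:R * \sum_(l < m) (q ^+ l + e n))).
  apply: (@fejer_small_ball (lin xi (idx n) a) m (fun l => q ^+ l + e n)) => //.
    by move=> l; rewrite addr_ge0// exprn_ge0//; case/andP: q01.
  move=> l lm; apply: (le_trans (ler_norm _)).
  apply: (le_trans (normc_Re (chf P (fun w => l%:R * lin xi (idx n) a w)))).
  apply: H => //; apply: leq_trans mn.
  by rewrite leq_exp2r// ltnW.
rewrite big_split /= sumr_const card_ord -[e n *+ m]mulr_natr mulrDr.
rewrite addrA; apply: lerD; last first.
  by rewrite le_eqVlt; apply/orP; left; apply/eqP; field; rewrite gt_eqF.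
apply: (@le_trans _ _ (K1 / m%:R)).
  have -> : K1 / m%:R = 8 / m%:R * (1 - q)^-1 by rewrite /K1 mulrAC.
  by apply: ler_wpM2l; [exact: divr_ge0|exact: geometric_sum_le].
have K0 : 0 <= K1 by lra.
apply: (@le_trans _ _ (K1 * (2 * z))); first by rewrite ler_wpM2l.
rewrite mulrA [K1 * 2]mulrC -mulrDr ler_wpM2l//; lra.
Qed.

End small_ball.

(** * Moments and the central limit theorem for cosines *)

Section moments.
Context (d : measure_display) (T : measurableType d) (R : realType).
Variable P : probability T R.
Local Notation Ex := (Ex P).
Local Notation int f := (P.-integrable setT (EFin \o f)).

Lemma int_le (f g : T -> R) : measurable_fun setT f -> int g ->
  (forall w, `|f w| <= g w) -> int f.
Proof.
move=> mf intg fg; apply: (le_integrable measurableT _ _ intg).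
  exact/measurable_EFinP.
by move=> w _ /=; rewrite lee_fin (le_trans (fg w))// ler_norm.
Qed.

Lemma int_abs (f : T -> R) : int f -> int (fun w => `|f w|).
Proof. by move=> h; exact: (integrable_norm h). Qed.

Lemma Ex_norm_le (f g : T -> R) : int f -> int g ->
  (forall w, `|f w| <= g w) -> `|Ex f| <= Ex g.
Proof.
move=> intf intg fg; apply: (le_trans (le_normr_Rintegral measurableT intf)).
by apply: Ex_le => //; exact: int_abs.
Qed.

Variable X : {RV P >-> R}.
Hypothesis m5 : ('E_P[(fun w => `|X w| ^+ 5)%R] < +oo)%E.
Hypothesis EX : ('E_P[X] = 0)%E.
Hypothesis VX : ('V_P[X] = 1)%E.

Let mX : measurable_fun setT X. Proof. by []. Qed.

Lemma int_pow5 : int (fun w => `|X w| ^+ 5).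
Proof.
apply/integrableP; split.
  by apply/measurable_EFinP; apply: measurable_funX; exact: measurableT_comp.
move: m5; rewrite unlock; congr (_ < _)%E; apply: eq_integral => w _ /=.
by rewrite normrX normr_id.
Qed.

Lemma int_pow k : (k <= 5)%N -> int (fun w => `|X w| ^+ k).
Proof.
move=> k5; apply: (@int_le _ (fun w => 1 + `|X w| ^+ 5)).
- by apply: measurable_funX; exact: measurableT_comp.
- by apply: intD; [exact: int_cst|exact: int_pow5].
- move=> w; rewrite ger0_norm ?exprn_ge0//.
  have [x1|x1] := leP `|X w| 1.
    by apply: (@le_trans _ _ 1); [rewrite exprn_ile1|rewrite lerDl exprn_ge0].
  apply: (@le_trans _ _ (`|X w| ^+ 5)); last by rewrite lerDr.
  by rewrite ler_weXn2l// ltW.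
Qed.

Lemma int_id : int X.
Proof.
apply: (int_le _ (@int_pow 1 _)) => // w; exact: lexx.
Qed.

Lemma int_sqr : int (fun w => X w ^+ 2).
Proof.
apply: (int_le _ (@int_pow 2 _)) => //; first exact: measurable_funX.
by move=> w; rewrite normrX.
Qed.

Lemma Ex_centered : Ex X = 0.
Proof. by have := EX; rewrite unlock /Ex /Rintegral => ->. Qed.

Lemma Ex_sqr1 : Ex (fun w => X w ^+ 2) = 1.
Proof.
have := VX; rewrite /variance unlock EX /= unlock => h.
rewrite /Ex /Rintegral -[RHS]/(fine 1%E) -h; congr fine.
apply: eq_integral => w _ /=; congr (_%:E).
by rewrite -[RHS]/((X w - 0) * (X w - 0)) subr0 expr2.
Qed.

Definition trunc (M x : R) := Num.max (- M) (Num.min x M).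

Lemma measurable_trunc M : measurable_fun setT (trunc M).
Proof.
by apply: measurable_maxr => //; apply: measurable_minr.
Qed.

Lemma trunc_le M x : 0 <= M -> `|trunc M x| <= M.
Proof.
move=> M0; rewrite ler_norml /trunc le_max lexx /= ge_max.
by rewrite ge_min lexx orbT andbT; lra.
Qed.

Lemma trunc_err M x : 0 < M ->
  `|x - trunc M x| ^+ 2 <= `|x| ^+ 3 / M /\ `|x - trunc M x| <= `|x| ^+ 3 / M ^+ 2.
Proof.
move=> M0; rewrite !ler_pdivlMr ?exprn_gt0//.
have [xM|xM] := leP `|x| M.
  have -> : trunc M x = x.
    move: xM; rewrite ler_norml => /andP[h1 h2].
    by rewrite /trunc (min_idPl h2) (max_idPr h1).
  by rewrite subrr normr0 expr0n !mul0r exprn_ge0.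
have h : `|x - trunc M x| <= `|x|.
  rewrite /trunc; have [x0|x0] := leP 0 x.
    move: xM; rewrite ger0_norm// => xM.
    rewrite (min_idPr (ltW xM)) (max_idPr (_ : - M <= M)); last by lra.
    by rewrite ger0_norm; lra.
  move: xM; rewrite ltr0_norm// => xM.
  rewrite (min_idPl (_ : x <= M)); last by lra.
  rewrite (max_idPl (_ : x <= - M)); last by lra.
  by rewrite ler_norml; lra.
have := normr_ge0 (x - trunc M x); set y := `|x - _| in h *.
set z := `|x| in xM h * => y0.
have zy2 : y ^+ 2 <= z ^+ 2 by rewrite ler_sqr ?nnegrE//; lra.
split; last first.
  apply: (@le_trans _ _ (z * M ^+ 2)); first by rewrite ler_wpM2r// sqr_ge0.
  by rewrite exprS ler_wpM2l// ?ler_sqr ?nnegrE//; lra.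
apply: (@le_trans _ _ (z ^+ 2 * M)); first by rewrite ler_wpM2r// ltW.
by rewrite [z ^+ 3]exprSr ler_wpM2l ?sqr_ge0// ltW.
Qed.

End moments.

Section family_moments.
Context (d : measure_display) (T : measurableType d) (R : realType).
Variable P : probability T R.
Local Notation Ex := (Ex P).
Local Notation int f := (P.-integrable setT (EFin \o f)).
Local Notation normc := ComplexField.Normc.normc.
Context (I : choiceType) (xi : I -> {RV P >-> R}).
Hypothesis indep : mutually_independent xi.
Hypothesis idistr : identically_distributed xi.
Hypothesis centered : forall i, ('E_P[xi i] = 0)%E.
Hypothesis variance1 : forall i, ('V_P[xi i] = 1)%E.
Hypothesis moment5 : forall i, ('E_P[(fun w => `|xi i w| ^+ 5)%R] < +oo)%E.

Lemma int_mul i j : int (fun w => xi i w * xi j w).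
Proof.
apply: (@int_le _ _ _ P _ (fun w => xi i w ^+ 2 + xi j w ^+ 2)).
- exact: measurable_funM.
- by apply: intD; apply: int_sqr.
- move=> w; rewrite normrM -[xi i w ^+ 2]real_normK ?num_real//.
  rewrite -[xi j w ^+ 2]real_normK ?num_real//.
  have := normr_ge0 (xi i w); have := normr_ge0 (xi j w).
  set x := `|_|; set y := `|_|; nra.
Qed.

(** Independence gives product formulas for bounded functions only, so the
    variables are truncated at M = l^2. The truncated ones have means of
    order M^-2, and the third moments make the truncation error O(1 / l). *)
Lemma Ex_mul_indep i j : i != j -> Ex (fun w => xi i w * xi j w) = 0.
Proof.
move=> ij.
pose M3 k := Ex (fun w => `|xi k w| ^+ 3).
have int3 k : int (fun w => `|xi k w| ^+ 3) by apply: int_pow.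
have M30 k : 0 <= M3 k by apply: Rintegral_ge0 => w _; rewrite exprn_ge0.
have [mi mj] : measurable_fun setT (xi i) /\ measurable_fun setT (xi j) by split.
pose K := M3 i * M3 j + M3 i + M3 j + 1.
suff bound l : 1 <= l -> `|Ex (fun w => xi i w * xi j w)| <= K / l.
  apply/eqP; rewrite -normr_eq0 eq_le normr_ge0 andbT.
  apply/ler_addgt0Pl => e e0; rewrite addr0.
  have K0 : 0 <= K by rewrite !addr_ge0// mulr_ge0.
  have l1 : 1 <= K / e + 1 by rewrite lerDr divr_ge0// ltW.
  apply: (le_trans (bound _ l1)).
  rewrite ler_pdivrMr; last by lra.
  by rewrite mulrDr mulrCA divff ?gt_eqF// !mulr1 lerDl ltW.
move=> l1; have l0 : 0 < l by lra.
pose M := l ^+ 2; have M0 : 0 < M by rewrite exprn_gt0.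
pose t k w := trunc M (xi k w).
have bt k : bounded_meas (t k).
  apply: bounded_meas_comp => //; first exact: measurable_trunc.
  by exists M => x; apply: trunc_le; exact: ltW.
have mt k : measurable_fun setT (t k) by exact: (bt k).1.
have intt k : int (t k) by exact: bounded_meas_int.
have Et k : `|Ex (t k)| <= M3 k / M ^+ 2.
  have -> : Ex (t k) = Ex (fun w => t k w - xi k w).
    by rewrite ExB// ?Ex_centered ?subr0//; exact: int_id.
  rewrite mulrC /M3 -ExZ//; apply: Ex_norm_le.
  - by apply: intB => //; exact: int_id.
  - exact: intZ.
  - by move=> w; rewrite distrC mulrC; have [] := trunc_err (xi k w) M0.
have prod : Ex (fun w => t i w * t j w) = Ex (t i) * Ex (t j).
  have u2 : uniq [:: i; j] by rewrite /= inE ij.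
  have := Ex_prod_indep indep u2 (fun _ => measurable_trunc M)
    (fun _ => ex_intro _ M (fun x => trunc_le x (ltW M0))).
  rewrite !big_cons big_nil mulr1 => <-; apply: eq_Ex => w.
  by rewrite !big_cons big_nil mulr1.
have diff : `|Ex (fun w => xi i w * xi j w - t i w * t j w)| <= (M3 i + M3 j + 2) / (2 * l).
  (* an integrable majorant of the truncation error, obtained from p q <= l
     p^2 / 2 + q^2 / (2 l) *)
  pose g w := l / 2 / M * `|xi i w| ^+ 3 + l / 2 / M * `|xi j w| ^+ 3 +
    ((2 * l)^-1 * xi i w ^+ 2 + (2 * l)^-1 * xi j w ^+ 2).
  have intg : int g.
    by apply: intD; apply: intD; apply: intZ => //; exact: int_sqr.
  have -> : (M3 i + M3 j + 2) / (2 * l) = Ex g.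
    rewrite /g ExD; [|by apply: intD; apply: intZ|by apply: intD; apply: intZ; exact: int_sqr].
    rewrite ExD; [|exact: intZ|exact: intZ].
    rewrite ExD; [|by apply: intZ; exact: int_sqr|by apply: intZ; exact: int_sqr].
    rewrite !ExZ//; try exact: int_sqr.
    rewrite !Ex_sqr1// -/(M3 i) -/(M3 j) /M; field.
    by rewrite gt_eqF.
  apply: Ex_norm_le => //.
    by apply: intB; [exact: int_mul|apply: bounded_meas_int; exact: bounded_measM].
  move=> w; rewrite /g.
  have [ei _] := trunc_err (xi i w) M0; have [ej _] := trunc_err (xi j w) M0.
  have tj : `|t i w| <= `|xi i w|.
    rewrite /t /trunc ler_norml; apply/andP; split.
      have := ler_norm (- xi i w); have := normr_ge0 (xi i w); rewrite normrN.
      by rewrite le_max le_min => *; apply/orP; right; apply/andP; split; lra.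
    rewrite ge_max ge_min ler_norm andbT.
    by have := normr_ge0 (xi i w); lra.
  have -> : xi i w * xi j w - t i w * t j w =
    (xi i w - t i w) * xi j w + t i w * (xi j w - t j w) by ring.
  apply: (le_trans (ler_normD _ _)); rewrite !normrM.
  rewrite -[xi i w ^+ 2]real_normK ?num_real// -[xi j w ^+ 2]real_normK ?num_real//.
  move: ei ej tj; rewrite -/(t i w) -/(t j w).
  set a := `|xi i w - _|; set b := `|xi j w - _|; set x := `|xi i w|; set y := `|xi j w|.
  set z := `|t i w| => ei ej zx.
  have [a0 b0 x0 y0 z0] : [/\ 0 <= a, 0 <= b, 0 <= x, 0 <= y & 0 <= z] by split; exact: normr_ge0.
  have amgm (p q : R) : p * q <= l / 2 * p ^+ 2 + (2 * l)^-1 * q ^+ 2.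
    have -> : l / 2 * p ^+ 2 + (2 * l)^-1 * q ^+ 2 = p * q + (l * p - q) ^+ 2 / (2 * l).
      by field; rewrite gt_eqF.
    by rewrite lerDl divr_ge0 ?sqr_ge0// mulr_ge0// ltW.
  have h1 := amgm a y.
  have h2 := amgm b x.
  have h3 : z * b <= b * x by rewrite mulrC ler_wpM2l.
  have h4 : l / 2 * a ^+ 2 <= l / 2 / M * x ^+ 3.
    by rewrite [leRHS]mulrAC -[leRHS]mulrA ler_wpM2l// divr_ge0// ltW.
  have h5 : l / 2 * b ^+ 2 <= l / 2 / M * y ^+ 3.
    by rewrite [leRHS]mulrAC -[leRHS]mulrA ler_wpM2l// divr_ge0// ltW.
  by move: h1 h2 h3 h4 h5; lra.
have E1 : `|Ex (fun w => t i w * t j w)| <= M3 i * M3 j / l.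
  rewrite prod normrM; apply: (le_trans (ler_pM _ _ (Et i) (Et j))) => //.
  rewrite mulrACA ler_wpM2l ?mulr_ge0// -invfM lef_pV2 ?posrE ?mulr_gt0 ?exprn_gt0//.
  rewrite /M -!exprM -exprD /= -[leLHS]expr1.
  exact: ler_weXn2l.
have E2 : Ex (fun w => xi i w * xi j w) =
  Ex (fun w => xi i w * xi j w - t i w * t j w) + Ex (fun w => t i w * t j w).
  rewrite ExB ?subrK//; [exact: int_mul|by apply: bounded_meas_int; exact: bounded_measM].
rewrite E2; apply: (le_trans (ler_normD _ _)); apply: (le_trans (lerD diff E1)).
have -> : (M3 i + M3 j + 2) / (2 * l) = (M3 i + M3 j + 2) / 2 / l by field; rewrite gt_eqF.
rewrite -mulrDl ler_wpM2r ?invr_ge0 ?(ltW l0)//.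
by rewrite /K; have := M30 i; have := M30 j; lra.
Qed.

Lemma Ex_lin_sqr (s : seq I) (c : I -> R) : uniq s ->
  int (fun w => lin xi s c w ^+ 2) /\
  Ex (fun w => lin xi s c w ^+ 2) = \sum_(i <- s) c i ^+ 2.
Proof.
have E w (r : seq I) : lin xi r c w ^+ 2 =
    \sum_(i <- r) \sum_(j <- r) (c i * c j) * (xi i w * xi j w).
  rewrite expr2 /lin big_distrlr /=; apply: eq_bigr => i _.
  by apply: eq_bigr => j _; ring.
have intE r : int (fun w => \sum_(i <- r) \sum_(j <- r) (c i * c j) * (xi i w * xi j w)).
  by apply: int_sum => i; apply: int_sum => j; apply: intZ; exact: int_mul.
move=> us; split.
  by under [X in _.-integrable _ (_ \o X)]eq_fun do rewrite E; exact: intE.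
rewrite (@eq_Ex _ _ _ P _ _ (fun w => E w s)) Ex_sum; last first.
  by move=> i; apply: int_sum => j; apply: intZ; exact: int_mul.
apply: eq_big_seq => i si.
rewrite Ex_sum; last by move=> j; apply: intZ; exact: int_mul.
rewrite (bigD1_seq i)//= big1_seq ?addr0.
  rewrite ExZ; last exact: int_mul.
  rewrite -expr2 -[RHS]mulr1 -(Ex_sqr1 (centered i) (variance1 i)); congr (_ * _).
move=> j /andP[ji _]; rewrite ExZ; last exact: int_mul.
by rewrite Ex_mul_indep ?mulr0// eq_sym.
Qed.

Lemma normcN (z : R[i]) : normc (- z) = normc z.
Proof. by case: z => a b /=; rewrite !sqrrN. Qed.

Lemma normcR (x : R) : normc (x%:C%C) = `|x|.
Proof. by rewrite /= expr0n addr0 sqrtr_sqr. Qed.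

(** The two functions have the same Taylor expansion to second order at 0,
    because the variables are centered with variance one, and both are
    bounded by 1 when |s| > 1. *)
Lemma phi_taylor (i0 : I) : exists2 K : R, 0 <= K &
  forall s : R, normc (phi xi i0 s - (expR (- (s ^+ 2 / 2)))%:C%C) <= K * `|s| ^+ 3.
Proof.
pose M3 := Ex (fun w => `|xi i0 w| ^+ 3).
have int3 : int (fun w => `|xi i0 w| ^+ 3) by apply: int_pow.
have M30 : 0 <= M3 by apply: Rintegral_ge0 => w _; rewrite exprn_ge0.
have normc_le (z : R[i]) : normc z <= `|complex.Re z| + `|complex.Im z|.
  rewrite -ler_sqr ?nnegrE ?normc_ge0 ?addr_ge0// normc_sqr.
  rewrite -(real_normK (num_real (complex.Re z))) -(real_normK (num_real (complex.Im z))).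
  have := normr_ge0 (complex.Re z); have := normr_ge0 (complex.Im z).
  by set x := `|_|; set y := `|_|; nra.
exists (2 * M3 + 2) => [|s]; first lra.
have s3 : 0 <= `|s| ^+ 3 by rewrite exprn_ge0.
have m1 : measurable_fun setT (fun w => s * xi i0 w) by exact: measurable_funM.
have ic : int (fun w => cos (s * xi i0 w)) by apply: bounded_meas_int; exact: bounded_meas_cos.
have is_ : int (fun w => sin (s * xi i0 w)) by apply: bounded_meas_int; exact: bounded_meas_sin.
have isq : int (fun w => s ^+ 2 / 2 * xi i0 w ^+ 2) by apply: intZ; exact: int_sqr.
have ilin : int (fun w => s * xi i0 w) by apply: intZ; exact: int_id.
have hc : `|Ex (fun w => cos (s * xi i0 w)) - (1 - s ^+ 2 / 2)| <= M3 * `|s| ^+ 3.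
  have -> : 1 - s ^+ 2 / 2 = Ex (fun w => 1 - s ^+ 2 / 2 * xi i0 w ^+ 2).
    by rewrite ExB ?ExZ ?Ex_cst ?Ex_sqr1 ?mulr1//; [exact: int_sqr|exact: int_cst].
  rewrite -ExB//; last by apply: intB => //; exact: int_cst.
  rewrite [leRHS]mulrC -ExZ//; apply: Ex_norm_le; [|exact: intZ|].
    by apply: intB => //; apply: intB => //; exact: int_cst.
  move=> w; rewrite -exprMn -normrM.
  have -> : s ^+ 2 / 2 * xi i0 w ^+ 2 = (s * xi i0 w) ^+ 2 / 2 by rewrite exprMn; ring.
  exact: norm_cos_sub_le.
have hs : `|Ex (fun w => sin (s * xi i0 w))| <= M3 * `|s| ^+ 3.
  have -> : Ex (fun w => sin (s * xi i0 w)) = Ex (fun w => sin (s * xi i0 w) - s * xi i0 w).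
    by rewrite ExB// ExZ ?Ex_centered ?mulr0 ?subr0//; exact: int_id.
  rewrite [leRHS]mulrC -ExZ//; apply: Ex_norm_le; [exact: intB|exact: intZ|].
  by move=> w; rewrite -exprMn -normrM; exact: norm_sin_sub_le.
have [s1|s1] := leP `|s| 1; last first.
  apply: (@le_trans _ _ 2).
    apply: (le_trans (le_normcD _ _)); rewrite normcN.
    have : normc ((expR (- (s ^+ 2 / 2)))%:C%C) <= 1.
      by rewrite normcR ger0_norm ?expR_ge0// -expR0 ler_expR oppr_le0 divr_ge0// sqr_ge0.
    by have := normc_phi_le1 xi i0 s; lra.
  have : 1 <= `|s| ^+ 3 by rewrite exprn_ege1// ltW.
  nra.
apply: (le_trans (normc_le _)).
have -> : complex.Im (phi xi i0 s - (expR (- (s ^+ 2 / 2)))%:C%C) = Ex (fun w => sin (s * xi i0 w)).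
  by rewrite /phi /chf /= subr0.
have -> : complex.Re (phi xi i0 s - (expR (- (s ^+ 2 / 2)))%:C%C) =
   Ex (fun w => cos (s * xi i0 w)) - expR (- (s ^+ 2 / 2)).
  by rewrite /phi /chf /=.
have s20 : 0 <= s ^+ 2 / 2 by rewrite divr_ge0// sqr_ge0.
have he := expR_sub_le s20.
have s4 : (s ^+ 2 / 2) ^+ 2 <= `|s| ^+ 3.
  have -> : (s ^+ 2 / 2) ^+ 2 = `|s| * `|s| ^+ 3 / 4.
    by rewrite -exprS (exprM _ 2 2) real_normK ?num_real//; field.
  by have := normr_ge0 s; nra.
have := ler_distD (1 - s ^+ 2 / 2) (Ex (fun w => cos (s * xi i0 w))) (expR (- (s ^+ 2 / 2))).
move: hc hs he; rewrite (distrC (expR _) (1 - _)).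
lra.
Qed.

(** Telescoping: the factors are exchanged one at a time. *)
Lemma normc_prod_sub_le (J : Type) (s : seq J) (F G : J -> R[i]) :
  (forall j, normc (F j) <= 1) -> (forall j, normc (G j) <= 1) ->
  normc (\prod_(j <- s) F j - \prod_(j <- s) G j) <= \sum_(j <- s) normc (F j - G j).
Proof.
move=> F1 G1.
have pG : normc (\prod_(j <- s) G j) <= 1.
  by rewrite normc_prod; apply: prodr_ile1 => j _; rewrite normc_ge0 G1.
elim: s pG => [|k s IH] pG; first by rewrite !big_nil subrr ComplexField.Normc.normc0.
rewrite !big_cons.
have pG' : normc (\prod_(j <- s) G j) <= 1.
  by rewrite normc_prod; apply: prodr_ile1 => j _; rewrite normc_ge0 G1.
set p := \prod_(j <- s) F j; set q := \prod_(j <- s) G j.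
have -> : F k * p - G k * q = F k * (p - q) + (F k - G k) * q by ring.
apply: (le_trans (le_normcD _ _)); rewrite !ComplexField.Normc.normcM addrC.
have h1 := IH pG'; have h2 := F1 k; have h3 := normc_ge0 (F k); have h4 := normc_ge0 (p - q).
have h5 := normc_ge0 (F k - G k); have h6 := normc_ge0 q.
apply: lerD; first by rewrite ler_piMr.
by apply: le_trans h1; rewrite ler_piMl.
Qed.

(** Lyapunov's form of the central limit theorem at the level of
    characteristic functions: the product of the phi (c i) is compared factor
    by factor with the product of the exp(- c_i^2 / 2). The phase p makes the
    bound cover sines too. *)
Lemma clt_cos (i0 : I) : exists2 K : R, 0 <= K &
  forall (s : seq I) (c : I -> R) (p : R), uniq s ->
  `|Ex (fun w => cos (lin xi s c w + p)) - expR (- ((\sum_(i <- s) c i ^+ 2) / 2)) * cos p|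
     <= K * \sum_(i <- s) `|c i| ^+ 3.
Proof.
have [K K0 HK] := phi_taylor i0.
exists (2 * K) => [|s c p us]; first lra.
pose z := chf P (lin xi s c).
pose e := expR (- ((\sum_(i <- s) c i ^+ 2) / 2)).
have zE : z = \prod_(i <- s) phi xi i0 (c i).
  by rewrite /z chf_lin//; apply: eq_bigr => i _; rewrite /phi; exact: chf_idistr.
have eE : e%:C%C = \prod_(i <- s) (expR (- (c i ^+ 2 / 2)))%:C%C.
  rewrite /e -rmorph_prod; congr (_%:C%C).
  by rewrite -expR_sum; congr expR; rewrite mulr_suml -sumrN.
have zle : normc (z - e%:C%C) <= K * \sum_(i <- s) `|c i| ^+ 3.
  rewrite zE eE; apply: (le_trans (normc_prod_sub_le _ _ _)).
  - by move=> i; exact: normc_phi_le1.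
  - move=> i; rewrite normcR ger0_norm ?expR_ge0// -expR0 ler_expR oppr_le0.
    by rewrite divr_ge0// sqr_ge0.
  - by rewrite mulr_sumr; apply: ler_sum => i _; exact: HK.
have -> : Ex (fun w => cos (lin xi s c w + p)) = complex.Re z * cos p - complex.Im z * sin p.
  have m1 := measurable_lin xi s c.
  rewrite /z /chf /= mulrC [X in _ = _ - X]mulrC -!ExZ; first last.
  - by apply: bounded_meas_int; exact: bounded_meas_cos.
  - by apply: bounded_meas_int; exact: bounded_meas_sin.
  rewrite -ExB.
  - by apply: eq_Ex => w; rewrite cosD; ring.
  - by apply: intZ; apply: bounded_meas_int; exact: bounded_meas_cos.
  - by apply: intZ; apply: bounded_meas_int; exact: bounded_meas_sin.
have hR : `|complex.Re z - e| <= normc (z - e%:C%C).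
  by have := normc_Re (z - e%:C%C); case: (z).
have hI : `|complex.Im z| <= normc (z - e%:C%C).
  rewrite -ler_sqr ?nnegrE ?normc_ge0// normc_sqr real_normK ?num_real//.
  by case: (z) => a b /=; rewrite subr0 lerDr sqr_ge0.
have -> : complex.Re z * cos p - complex.Im z * sin p - e * cos p =
  (complex.Re z - e) * cos p - complex.Im z * sin p by ring.
apply: (le_trans (ler_normB _ _)); rewrite !normrM.
have := cos_max p; have := sin_max p.
have := normr_ge0 (cos p); have := normr_ge0 (sin p).
have := normr_ge0 (complex.Re z - e); have := normr_ge0 (complex.Im z).
move: hR hI zle; set x := `|_ - e|; set y := `|complex.Im z|; set u := `|cos p|; set v := `|sin p|.
by set N := normc _; set S := \sum_(_ <- _) _; nra.
Qed.

End family_moments.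

(** * Trigonometric polynomials that imitate the sign *)

Section trigonometric_algebra.
Context (R : realType).

(** Trigonometric polynomials in two real variables: the test functions whose
    expectations are combinations of characteristic functions. They form an
    algebra. *)
Inductive trig2 : (R -> R -> R) -> Prop :=
| trig2_cos a b p : trig2 (fun x y => cos (a * x + b * y + p))
| trig2_add F G : trig2 F -> trig2 G -> trig2 (fun x y => F x y + G x y)
| trig2_scale c F : trig2 F -> trig2 (fun x y => c * F x y).

Lemma trig2_ext F G : (forall x y, F x y = G x y) -> trig2 F -> trig2 G.
Proof. by move=> FG; have -> : G = F by apply/funext => x; apply/funext => y. Qed.

Lemma trig2_mul F G : trig2 F -> trig2 G -> trig2 (fun x y => F x y * G x y).
Proof.
move=> hF; elim: hF G => [a b p|F1 F2 _ IH1 _ IH2|c F1 _ IH1] G hG.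
- elim: hG => [a' b' p'|G1 G2 _ IH1 _ IH2|c' G1 _ IH1].
  + apply: (@trig2_ext (fun x y =>
      2^-1 * cos ((a + a') * x + (b + b') * y + (p + p')) +
      2^-1 * cos ((a - a') * x + (b - b') * y + (p - p')))); last first.
      by apply: trig2_add; apply: trig2_scale; exact: trig2_cos.
    move=> x y.
    have -> : (a + a') * x + (b + b') * y + (p + p') =
      (a * x + b * y + p) + (a' * x + b' * y + p') by ring.
    have -> : (a - a') * x + (b - b') * y + (p - p') =
      (a * x + b * y + p) - (a' * x + b' * y + p') by ring.
    by rewrite cosD cosB; field.
  + by apply: trig2_ext (trig2_add IH1 IH2) => x y; ring.
  + by apply: trig2_ext (trig2_scale c' IH1) => x y; ring.
- by apply: trig2_ext (trig2_add (IH1 _ hG) (IH2 _ hG)) => x y; ring.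
- by apply: trig2_ext (trig2_scale c (IH1 _ hG)) => x y; ring.
Qed.

(** A cubic with attracting fixed points -1 and 1 and repelling fixed point
    0, so that its iterates push [-1, 1] minus a neighbourhood of 0 towards
    the signs. *)
Definition smoothstep (y : R) : R := (3 * y - y ^+ 3) / 2.

(** A trigonometric polynomial that is odd, bounded by 1, and close to the
    sign where delta <= |x| <= L. *)
Definition soft_sign (a : R) (m : nat) (x : R) := iter m smoothstep (sin (a * x)).

Lemma trig2_soft_sign a m :
  trig2 (fun x _ => soft_sign a m x) /\ trig2 (fun _ y => soft_sign a m y).
Proof.
have step F : trig2 F -> trig2 (fun x y => smoothstep (F x y)).
  move=> hF; have h3 := trig2_mul hF (trig2_mul hF hF).
  apply: trig2_ext (trig2_add (trig2_scale (3 / 2) hF) (trig2_scale (- 2^-1) h3)) => x y.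
  by rewrite /smoothstep; field.
elim: m => [|m [IH1 IH2]].
  by split; [apply: trig2_ext (trig2_scale (- 1) (trig2_cos a 0 (pi / 2)))
            |apply: trig2_ext (trig2_scale (- 1) (trig2_cos 0 a (pi / 2)))] => x y;
    rewrite cosDpihalf /soft_sign /=; (have -> : forall z : R, -1 * - z = z by move=> z; ring);
    congr sin; ring.
by split; exact: step.
Qed.

Lemma smoothstep_bound y : -1 <= y <= 1 -> -1 <= smoothstep y <= 1.
Proof.
move=> /andP[h1 h2]; rewrite /smoothstep.
have e1 : 1 - (3 * y - y ^+ 3) / 2 = (1 - y) ^+ 2 * (2 + y) / 2 by field.
have e2 : (3 * y - y ^+ 3) / 2 + 1 = (1 + y) ^+ 2 * (2 - y) / 2 by field.
have p1 : 0 <= (1 - y) ^+ 2 * (2 + y) / 2.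
  by rewrite divr_ge0// mulr_ge0 ?sqr_ge0//; lra.
have p2 : 0 <= (1 + y) ^+ 2 * (2 - y) / 2.
  by rewrite divr_ge0// mulr_ge0 ?sqr_ge0//; lra.
by move: p1 p2; rewrite -e1 -e2 => p1 p2; apply/andP; split; lra.
Qed.

Lemma soft_sign_bound a m x : `|soft_sign a m x| <= 1.
Proof.
rewrite ler_norml; elim: m => [|m IH]; first by rewrite sin_geN1 sin_le1.
exact: smoothstep_bound.
Qed.

Lemma soft_signN a m x : soft_sign a m (- x) = - soft_sign a m x.
Proof.
elim: m => [|m IH]; first by rewrite /soft_sign /= mulrN sinN.
by rewrite [LHS]/soft_sign iterS -/(soft_sign a m (- x)) IH /smoothstep
  [RHS]/=; rewrite /soft_sign /smoothstep /=; ring.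
Qed.

(** With y away from 0, the distance to 1 shrinks by the factor (1 - z)(2 +
    z)/2 <= 1 - eta / 2 at each step. *)
Lemma smoothstep_iter_ge (eta y : R) m : 0 < eta -> eta <= y <= 1 ->
  1 - (1 - eta / 2) ^+ m <= iter m smoothstep y /\ eta <= iter m smoothstep y <= 1.
Proof.
move=> e0 /andP[h1 h2]; elim: m => [|m [IH1 IH2]].
  by rewrite expr0 subrr /=; split; [lra|apply/andP].
rewrite iterS; move: IH1 IH2; set z := iter m _ _ => IH1 /andP[z1 z2].
have e1 : smoothstep z = 1 - (1 - z) ^+ 2 * (2 + z) / 2 by rewrite /smoothstep; field.
have eta1 : eta <= 1 by lra.
have k1 : (1 - z) * (2 + z) / 2 <= 1 - eta / 2.
  have : 0 <= (z - eta) * (z + eta + 1) by rewrite mulr_ge0//; lra.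
  have : 0 <= eta ^+ 2 by exact: sqr_ge0.
  lra.
have k2 : (1 - z) ^+ 2 * (2 + z) / 2 <= (1 - z) * (1 - eta / 2).
  by rewrite expr2 -!mulrA; apply: ler_wpM2l; [lra|rewrite mulrA].
have p0 : 0 <= (1 - z) ^+ 2 * (2 + z) / 2.
  by rewrite divr_ge0// mulr_ge0 ?sqr_ge0//; lra.
split.
  rewrite exprS e1.
  have : (1 - z) * (1 - eta / 2) <= (1 - eta / 2) ^+ m * (1 - eta / 2).
    by rewrite ler_wpM2r//; lra.
  by move: k2; set A := _ * (2 + z) / 2; lra.
rewrite e1; apply/andP; split; last lra.
have : (1 - z) * (1 - eta / 2) <= (1 - z) * 1 by rewrite ler_wpM2l//; lra.
lra.
Qed.

Lemma sin_ge_half (x : R) : 0 <= x <= 1 -> x / 2 <= sin x.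
Proof.
move=> /andP[x0 x1]; apply: le_trans (sin_ge x0).
have : x ^+ 3 <= x by rewrite exprS ler_piMr// exprn_ile1.
lra.
Qed.

Lemma soft_sign_approx (kappa delta L : R) : 0 < kappa -> 0 < delta -> delta < L ->
  exists a m, forall x, delta <= x <= L -> 1 - kappa <= soft_sign a m x.
Proof.
move=> k0 d0 dL; have L0 : 0 < L by lra.
pose eta := delta / L / 2.
have eta0 : 0 < eta by rewrite !divr_gt0.
have dL1 : delta / L < 1 by rewrite ltr_pdivrMr// mul1r.
have eta1 : eta < 1 by rewrite /eta; lra.
have [m mk] : exists m, (1 - eta / 2) ^+ m < kappa.
  have c : (1 - eta / 2) ^+ m @[m --> \oo] --> (0 : R).
    by apply: cvg_expr; rewrite ger0_norm; lra.
  have /cvgrPdist_lt /(_ _ k0) [m _ /(_ m (leqnn m))] := c.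
  by rewrite /= sub0r normrN ger0_norm; [exists m|apply: exprn_ge0; lra].
exists L^-1, m => x /andP[x1 x2].
have x0 : 0 < x by lra.
have u : 0 <= L^-1 * x <= 1.
  by rewrite mulrC divr_ge0 ?(ltW L0) ?(ltW x0)//= ler_pdivrMr// mul1r.
have s1 : eta <= sin (L^-1 * x) <= 1.
  rewrite sin_le1 andbT; apply: (le_trans _ (sin_ge_half u)).
  by rewrite /eta ler_pM2r// mulrC ler_pM2l// invr_gt0.
have [h _] := smoothstep_iter_ge m eta0 s1.
by apply: le_trans h; lra.
Qed.

Lemma measurable_soft_sign a m : measurable_fun setT (soft_sign a m).
Proof.
elim: m => [|m IH].
  apply: (@measurableT_comp _ _ _ _ _ _ sin).
    by apply: continuous_measurable_fun; exact: continuous_sin.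
  by apply: measurable_funM.
rewrite /soft_sign; under eq_fun do rewrite iterS.
apply: measurable_funM => //; apply: measurable_funB.
  by apply: measurable_funM.
exact: measurable_funX.
Qed.

End trigonometric_algebra.

Section sign_comparison.
Context (d : measure_display) (T : measurableType d) (R : realType).
Variable P : probability T R.
Local Notation Ex := (Ex P).
Local Notation pr := (pr P).

Lemma bounded_meas_trig2 (F : R -> R -> R) (X Y : T -> R) : trig2 F ->
  measurable_fun setT X -> measurable_fun setT Y ->
  bounded_meas (fun w => F (X w) (Y w)).
Proof.
move=> hF mX mY; elim: hF => [a b p|F1 F2 _ IH1 _ IH2|c F1 _ IH1].
- apply: bounded_meas_cos; apply: measurable_funD => //.
  by apply: measurable_funD; apply: measurable_funM.
- exact: bounded_measD.
- by apply: bounded_measM => //; exact: bounded_meas_cst.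
Qed.

Context (X Y : T -> R) (h : R -> R) (kappa delta L : R).
Hypothesis mX : measurable_fun setT X.
Hypothesis mY : measurable_fun setT Y.
Hypothesis mh : measurable_fun setT h.
Hypothesis h1 : forall x, `|h x| <= 1.
Hypothesis hN : forall x, h (- x) = - h x.
Hypothesis kappa0 : 0 < kappa.
Hypothesis delta_ge0 : 0 <= delta.
Hypothesis hsgn : forall x, delta <= x <= L -> 1 - kappa <= h x.

(** The price of replacing the sign of Z by h: Z may lie too close to 0 or
    too far out, and elsewhere h is off by at most kappa. *)
Definition sign_error (Z : T -> R) :=
  pr [set w | `|Z w| <= delta] + pr [set w | L <= `|Z w|] + kappa.

Let mabs (Z : T -> R) : measurable_fun setT Z -> measurable_fun setT (fun w => `|Z w|).
Proof. by move=> mZ; exact: measurableT_comp. Qed.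

Let bad (Z : T -> R) w : R :=
  \1_[set w | `|Z w| <= delta] w + \1_[set w | L <= `|Z w|] w + kappa.

Let bbad (Z : T -> R) : measurable_fun setT Z -> bounded_meas (bad Z).
Proof.
move=> mZ; apply: bounded_measD; last exact: bounded_meas_cst.
by apply: bounded_measD; apply: bounded_meas_indic; apply: measurable_le => //;
  exact: mabs.
Qed.

Let Ex_bad (Z : T -> R) : measurable_fun setT Z -> Ex (bad Z) = sign_error Z.
Proof.
move=> mZ.
have m1 : measurable [set w | `|Z w| <= delta] by apply: measurable_le => //; exact: mabs.
have m2 : measurable [set w | L <= `|Z w|] by apply: measurable_le => //; exact: mabs.
have i1 := bounded_meas_int P (bounded_meas_indic R m1).
have i2 := bounded_meas_int P (bounded_meas_indic R m2).
rewrite ExD; [|exact: intD|exact: int_cst].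
by rewrite ExD// Ex_cst !Ex_indic.
Qed.

Let bad_cases (Z : T -> R) w : 1 <= bad Z w \/
  (kappa <= bad Z w /\ delta < `|Z w| < L).
Proof.
rewrite /bad; set A := [set w | `|Z w| <= delta]; set B := [set w | L <= `|Z w|].
have A0 : 0 <= \1_A w :> R by rewrite indicE ler0n.
have B0 : 0 <= \1_B w :> R by rewrite indicE ler0n.
have k0 := kappa0.
case: (leP `|Z w| delta) => h2.
  left; have -> : \1_A w = 1 :> R by rewrite indicE mem_set.
  lra.
case: (leP L `|Z w|) => h3; last by right; split => //; lra.
left; have -> : \1_B w = 1 :> R by rewrite indicE mem_set.
lra.
Qed.

Let bad_ge0 (Z : T -> R) w : 0 <= bad Z w.
Proof.
by have k0 := kappa0; have [hb|[hb _]] := bad_cases Z w; apply: le_trans hb => //; exact: ltW.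
Qed.

Let hcase x : delta < `|x| < L -> (0 < x /\ 1 - kappa <= h x) \/ (x < 0 /\ h x <= -1 + kappa).
Proof.
move=> /andP[a1 a2]; case: (ltrgt0P x) a1 a2 => [x0 a1 a2|x0 a1 a2|->].
- by left; split => //; apply: hsgn; rewrite !ltW.
- right; split => //; have := @hsgn (- x); rewrite hN (ltW a1) (ltW a2) => /(_ isT); lra.
- by move=> d0; have := delta_ge0; lra.
Qed.

(** If h were the sign, (1 - h(X) h(Y)) / 2 would be the indicator of
    opposite signs. *)
Lemma pointwise_sign_comparison w :
  (1 - h (X w) * h (Y w)) / 2 <= \1_[set w | X w * Y w < 0] w + (bad X w + bad Y w) /\
  \1_[set w | X w * Y w <= 0] w <= (1 - h (X w) * h (Y w)) / 2 + (bad X w + bad Y w).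
Proof.
have normrN_le1 (x : R) : `|x| <= 1 -> `|- x| <= 1 by rewrite normrN.
have p0 A : 0 <= \1_A w :> R by rewrite indicE ler0n.
have p1 A : \1_A w <= 1 :> R by rewrite indicE lern1 leq_b1.
have hx := h1 (X w); have hy := h1 (Y w).
have bX := bad_ge0 X w; have bY := bad_ge0 Y w.
have key (u v : R) : 1 - kappa <= u -> 1 - kappa <= v -> `|u| <= 1 -> `|v| <= 1 ->
    1 - 2 * kappa <= u * v <= 1.
  rewrite !ler_norml => u1 v1 /andP[u2 u3] /andP[v2 v3].
  have : 0 <= (1 - u) * (1 - v) by rewrite mulr_ge0; lra.
  have : `|u * v| <= 1 by rewrite normrM mulr_ile1// ler_norml; apply/andP; split.
  by rewrite ler_norml => /andP[m1 m2] m3; rewrite m2 andbT; lra.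
have hxy : -1 <= h (X w) * h (Y w) <= 1.
  by rewrite -ler_norml normrM mulr_ile1.
set lt0 := [set w | X w * Y w < 0]; set le0 := [set w | X w * Y w <= 0].
have l0 := p0 lt0; have l1 := p1 lt0; have r0 := p0 le0; have r1 := p1 le0.
move: hxy => /andP[hxy1 hxy2].
have [cX|[kX gX]] := bad_cases X w; first by split; lra.
have [cY|[kY gY]] := bad_cases Y w; first by split; lra.
have [[x0 ux]|[x0 ux]] := hcase gX; have [[y0 uy]|[y0 uy]] := hcase gY.
- have /andP[q1 q2] := key _ _ ux uy hx hy.
  have -> : \1_le0 w = 0 :> R.
    by rewrite indicE memNset//= => /=; apply/negP; rewrite -ltNge mulr_gt0.
  by split; lra.
- have uy' : 1 - kappa <= - h (Y w) by lra.
  have /andP[q1 q2] := key _ _ ux uy' hx (normrN_le1 _ hy).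
  have -> : \1_lt0 w = 1 :> R by rewrite indicE mem_set//= /lt0 /= pmulr_rlt0.
  by rewrite mulrN in q1 q2; split; lra.
- have ux' : 1 - kappa <= - h (X w) by lra.
  have /andP[q1 q2] := key _ _ ux' uy (normrN_le1 _ hx) hy.
  have -> : \1_lt0 w = 1 :> R by rewrite indicE mem_set//= /lt0 /= pmulr_llt0.
  by rewrite mulNr in q1 q2; split; lra.
- have ux' : 1 - kappa <= - h (X w) by lra.
  have uy' : 1 - kappa <= - h (Y w) by lra.
  have /andP[q1 q2] := key _ _ ux' uy' (normrN_le1 _ hx) (normrN_le1 _ hy).
  have -> : \1_le0 w = 0 :> R.
    by rewrite indicE memNset//= => /=; apply/negP; rewrite -ltNge nmulr_lgt0.
  by rewrite mulrNN in q1 q2; split; lra.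
Qed.

Let Ex_half (f : T -> R) : bounded_meas f ->
  P.-integrable setT (EFin \o (fun w => 2^-1 * (1 - f w))) /\
  Ex (fun w => 2^-1 * (1 - f w)) = (1 - Ex f) / 2.
Proof.
move=> bf; have i1 := bounded_meas_int P bf; have i0 := int_cst P 1.
have i2 := intB i0 i1; split; first exact: intZ.
by rewrite (ExZ _ i2) (ExB i0 i1) Ex_cst mulrC.
Qed.

Lemma pr_sign_change :
  let D := (1 - Ex (fun w => h (X w) * h (Y w))) / 2 in
  let err := sign_error X + sign_error Y in
  D - err <= pr [set w | X w * Y w < 0] /\ pr [set w | X w * Y w <= 0] <= D + err.
Proof.
have bh Z : measurable_fun setT Z -> bounded_meas (fun w => h (Z w)).
  by move=> mZ; apply: bounded_meas_comp => //; exists 1.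
have bXY : bounded_meas (fun w => h (X w) * h (Y w)) by apply: bounded_measM; exact: bh.
have mXY : measurable_fun setT (fun w => X w * Y w) by exact: measurable_funM.
have m1 : measurable [set w | X w * Y w < 0] by exact: measurable_lt.
have m2 : measurable [set w | X w * Y w <= 0] by exact: measurable_le.
have i1 := bounded_meas_int P (bounded_meas_indic R m1).
have i2 := bounded_meas_int P (bounded_meas_indic R m2).
have iX := bounded_meas_int P (bbad mX); have iY := bounded_meas_int P (bbad mY).
have ie := intD iX iY; have [ih DE] := Ex_half bXY.
move=> D err; rewrite /D /err -DE lerBlDr -!Ex_indic// -!Ex_bad// -!ExD//.
split; apply: Ex_le => //; try exact: intD;
  move=> w; rewrite [2^-1 * _]mulrC; have [] := pointwise_sign_comparison w; by [].
Qed.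

End sign_comparison.

(** * Pairs of linear forms and sinusoids *)

Section rotation_invariance.
Context (d : measure_display) (T : measurableType d) (R : realType).
Variable P : probability T R.
Local Notation Ex := (Ex P).
Local Notation pr := (pr P).
Context (xi : nat + nat -> {RV P >-> R}).
Hypothesis indep : mutually_independent xi.
Hypothesis idistr : identically_distributed xi.
Hypothesis centered : forall i, ('E_P[xi i] = 0)%E.
Hypothesis variance1 : forall i, ('V_P[xi i] = 1)%E.
Hypothesis moment5 : forall i, ('E_P[(fun w => `|xi i w| ^+ 5)%R] < +oo)%E.

(** Normalised pairs of linear forms with correlation close to rho and no
    dominating coefficient. For these the central limit theorem holds
    uniformly with rate 1 / sqrt n, with a limit that depends on rho alone. *)
Definition covariance_near (n : nat) (rho : R) (c1 c2 : nat + nat -> R) :=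
  [/\ `|\sum_(i <- idx n) c1 i ^+ 2 - 1| <= 2 / n%:R,
      `|\sum_(i <- idx n) c2 i ^+ 2 - 1| <= 2 / n%:R,
      `|\sum_(i <- idx n) c1 i * c2 i - rho| <= 2 / n%:R &
      forall i, i \in idx n ->
        `|c1 i| <= 2 / Num.sqrt n%:R /\ `|c2 i| <= 2 / Num.sqrt n%:R].

Lemma clt_pair (a b p rho : R) : -1 <= rho <= 1 -> exists2 C : R, 0 <= C &
  forall n c1 c2, (0 < n)%N -> covariance_near n rho c1 c2 ->
  `|Ex (fun w => cos (a * lin xi (idx n) c1 w + b * lin xi (idx n) c2 w + p)) -
    expR (- ((a ^+ 2 + b ^+ 2 + 2 * a * b * rho) / 2)) * cos p| <= C / Num.sqrt n%:R.
Proof.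
move=> /andP[rho1 rho2].
have [K K0 HK] := clt_cos indep idistr centered variance1 moment5 (inl 0%N).
pose A := `|a| + `|b|.
have A0 : 0 <= A by rewrite addr_ge0.
exists (16 * K * A ^+ 3 + A ^+ 2).
  by rewrite addr_ge0 ?sqr_ge0// mulr_ge0 ?exprn_ge0// mulr_ge0.
move=> n c1 c2 n0 [h1 h2 h12 hB].
have nR : 0 < n%:R :> R by rewrite ltr0n.
have sn : 0 < Num.sqrt n%:R :> R by rewrite sqrtr_gt0.
have sn2 : Num.sqrt n%:R ^+ 2 = n%:R :> R by rewrite sqr_sqrtr// ler0n.
have sn1 : 1 <= Num.sqrt n%:R :> R by rewrite -[leLHS]sqrtr1 ler_wsqrtr// ler1n.
pose c i := a * c1 i + b * c2 i.
have -> : (fun w => cos (a * lin xi (idx n) c1 w + b * lin xi (idx n) c2 w + p)) =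
   (fun w => cos (lin xi (idx n) c w + p)).
  apply/funext => w; congr (cos (_ + _)); rewrite /lin !mulr_sumr -big_split /=.
  by apply: eq_bigr => i _; rewrite /c; ring.
set S1 := \sum_(i <- idx n) c1 i ^+ 2 in h1.
set S2 := \sum_(i <- idx n) c2 i ^+ 2 in h2.
set S12 := \sum_(i <- idx n) c1 i * c2 i in h12.
have SE : \sum_(i <- idx n) c i ^+ 2 = a ^+ 2 * S1 + b ^+ 2 * S2 + 2 * a * b * S12.
  rewrite /S1 /S2 /S12 !mulr_sumr -!big_split /=; apply: eq_bigr => i _.
  by rewrite /c; ring.
have := HK (idx n) c p (uniq_idx n); set Q := a ^+ 2 + _ + _; set S := \sum_(_ <- _) _ => hS.
have S0 : 0 <= S / 2 by rewrite divr_ge0// sumr_ge0// => i _; exact: sqr_ge0.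
have Q0 : 0 <= Q / 2.
  apply: divr_ge0 => //.
  have -> : Q = (a + rho * b) ^+ 2 + (1 - rho ^+ 2) * b ^+ 2 by rewrite /Q; ring.
  by rewrite addr_ge0 ?sqr_ge0// mulr_ge0 ?sqr_ge0//; nra.
have a2 : `|a| ^+ 2 = a ^+ 2 by rewrite real_normK ?num_real.
have b2 : `|b| ^+ 2 = b ^+ 2 by rewrite real_normK ?num_real.
have SQ : `|S - Q| <= A ^+ 2 * (2 / n%:R).
  have -> : S - Q = a ^+ 2 * (S1 - 1) + b ^+ 2 * (S2 - 1) + 2 * a * b * (S12 - rho).
    by rewrite /S SE /Q; ring.
  apply: (le_trans (ler_normD _ _)).
  apply: (@le_trans _ _ ((a ^+ 2 * (2 / n%:R) + b ^+ 2 * (2 / n%:R)) +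
     2 * `|a| * `|b| * (2 / n%:R))).
    apply: lerD.
      apply: (le_trans (ler_normD _ _)); rewrite (normrM (a ^+ 2)) (normrM (b ^+ 2)) !(ger0_norm (sqr_ge0 _)).
      by apply: lerD; apply: ler_wpM2l => //; exact: sqr_ge0.
    rewrite !normrM (ger0_norm (_ : 0 <= 2))//.
    by apply: ler_wpM2l => //; rewrite !mulr_ge0.
  by rewrite le_eqVlt; apply/orP; left; apply/eqP; rewrite -a2 -b2 /A; ring.
have cub : \sum_(i <- idx n) `|c i| ^+ 3 <= 16 * A ^+ 3 / Num.sqrt n%:R.
  have ci i : i \in idx n -> `|c i| ^+ 3 <= (A * (2 / Num.sqrt n%:R)) ^+ 3.
    move=> /hB[b1 b2']; apply: lerXn2r; rewrite ?nnegrE ?mulr_ge0 ?invr_ge0 ?(ltW sn)//.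
    rewrite /c /A mulrDl; apply: (le_trans (ler_normD _ _)).
    by rewrite !normrM; apply: lerD; apply: ler_wpM2l.
  rewrite big_seq; apply: (le_trans (ler_sum _ ci)); rewrite -big_seq big_const_seq.
  rewrite iter_addr_0 count_predT size_cat !size_map size_iota addnn -mul2n.
  rewrite le_eqVlt; apply/orP; left; apply/eqP.
  rewrite -[LHS]mulr_natr natrM.
  set r := Num.sqrt n%:R in sn sn2 *; rewrite -sn2; field; by rewrite gt_eqF.
have eS : `|expR (- (S / 2)) * cos p - expR (- (Q / 2)) * cos p| <= A ^+ 2 / n%:R.
  rewrite -mulrBl normrM.
  apply: (@le_trans _ _ (`|S - Q| / 2)).
    rewrite -[leRHS]mulr1; apply: ler_pM => //; last exact: cos_max.
    apply: (le_trans (expR_lipschitz S0 Q0)).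
    by rewrite -mulrBl normrM (ger0_norm (_ : 0 <= 2^-1)) ?invr_ge0.
  by have := SQ; set x := `|_|; rewrite mulrA; lra.
have inn : A ^+ 2 / n%:R <= A ^+ 2 / Num.sqrt n%:R.
  rewrite ler_wpM2l ?sqr_ge0// lef_pV2 ?posrE// -[leRHS]sn2 expr2.
  by rewrite ler_peMr// ltW.
rewrite -[X in `|X|](subrKA (expR (- (S / 2)) * cos p)).
apply: (le_trans (ler_normD _ _)).
have -> : (16 * K * A ^+ 3 + A ^+ 2) / Num.sqrt n%:R =
  K * (16 * A ^+ 3 / Num.sqrt n%:R) + A ^+ 2 / Num.sqrt n%:R by ring.
apply: lerD; last exact: le_trans eS inn.
by apply: (le_trans hS); exact: ler_wpM2l.
Qed.

(** Two pairs with the same limiting covariance share the same limit, hence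
    are close to each other; an expectation may then be evaluated on
    whichever pair is most convenient. *)
Lemma trig2_close (F : R -> R -> R) (rho : R) : -1 <= rho <= 1 -> trig2 F ->
  exists2 C : R, 0 <= C & forall n c1 c2 c1' c2', (0 < n)%N ->
  covariance_near n rho c1 c2 -> covariance_near n rho c1' c2' ->
  `|Ex (fun w => F (lin xi (idx n) c1 w) (lin xi (idx n) c2 w)) -
    Ex (fun w => F (lin xi (idx n) c1' w) (lin xi (idx n) c2' w))| <= C / Num.sqrt n%:R.
Proof.
move=> hrho; elim => [a b p|F1 F2 t1 [C1 C10 H1] t2 [C2 C20 H2]|c F1 t1 [C1 C10 H1]].
- have [C C0 H] := clt_pair a b p hrho; exists (2 * C) => [|n c1 c2 c1' c2' n0 h h'].
    by rewrite mulr_ge0.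
  have h1 := H _ _ _ n0 h; have h2 := H _ _ _ n0 h'; rewrite distrC in h2.
  have -> : 2 * C / Num.sqrt n%:R = C / Num.sqrt n%:R + C / Num.sqrt n%:R by ring.
  exact: le_trans (ler_distD _ _ _) (lerD h1 h2).
- exists (C1 + C2) => [|n c1 c2 c1' c2' n0 h h']; first exact: addr_ge0.
  have i (G : R -> R -> R) c c' : trig2 G ->
      P.-integrable setT (EFin \o (fun w => G (lin xi (idx n) c w) (lin xi (idx n) c' w))).
    by move=> tF; apply: bounded_meas_int; apply: bounded_meas_trig2 => //; exact: measurable_lin.
  rewrite (ExD (i F1 c1 c2 t1) (i F2 c1 c2 t2)) (ExD (i F1 c1' c2' t1) (i F2 c1' c2' t2)).
  rewrite opprD addrACA mulrDl; apply: (le_trans (ler_normD _ _)).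
  by apply: lerD; [exact: H1|exact: H2].
- exists (`|c| * C1) => [|n c1 c2 c1' c2' n0 h h']; first exact: mulr_ge0.
  have i e e' : P.-integrable setT (EFin \o (fun w => F1 (lin xi (idx n) e w) (lin xi (idx n) e' w))).
    by apply: bounded_meas_int; apply: bounded_meas_trig2 => //; exact: measurable_lin.
  rewrite (ExZ c (i c1 c2)) (ExZ c (i c1' c2')) -mulrBr normrM -mulrA.
  by apply: ler_wpM2l => //; exact: H1.
Qed.

End rotation_invariance.

Section sinusoid.
Context (R : realType).

Definition sinusoid (U V phi : R) : R := cos phi * U + sin phi * V.

(** A sinusoid solves a second order equation, so three of its values are
    linearly dependent; all sign arguments below read off this relation,
    where the coefficients are nonnegative on a half period. *)
Lemma sinusoid_interpol U V (x y z : R) :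
  sin (z - x) * sinusoid U V y = sin (z - y) * sinusoid U V x + sin (y - x) * sinusoid U V z.
Proof. by rewrite /sinusoid !sinB; ring. Qed.

Variables (U V theta : R).
Hypothesis theta_gt0 : 0 < theta.
Hypothesis theta_ltpi : theta < pi.
Let L (i : nat) := sinusoid U V (i%:R * theta).

Let sin_ge0 (k : nat) : k%:R * theta <= pi -> 0 <= sin (k%:R * theta).
Proof. by move=> h; apply: sin_ge0_pi; rewrite h andbT mulr_ge0// ltW. Qed.

Let sin_theta : 0 < sin theta.
Proof. by apply: sin_gt0_pi; rewrite theta_gt0. Qed.

Let three (i k : nat) : sin (k.+1%:R * theta) * L i.+1 =
  sin (k%:R * theta) * L i + sin theta * L (i + k.+1)%N.
Proof.
have := sinusoid_interpol U V (i%:R * theta) (i.+1%:R * theta) ((i + k.+1)%:R * theta).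
have -> : (i + k.+1)%:R * theta - i%:R * theta = k.+1%:R * theta by rewrite natrD; ring.
have -> : (i + k.+1)%:R * theta - i.+1%:R * theta = k%:R * theta.
  by rewrite natrD -!natr1; ring.
by have -> : i.+1%:R * theta - i%:R * theta = theta by rewrite -natr1; ring.
Qed.

(** Within a half period, once the sign has changed between i and i + 1 all
    the later values keep the sign of L (i + 1). *)
Lemma sinusoid_no_second_change (M i j : nat) : M%:R * theta <= pi ->
  (i < j)%N -> (j < M)%N -> L i * L i.+1 < 0 -> 0 < L j * L j.+1.
Proof.
move=> Mpi ij jM Li.
suff H l : (i < l)%N -> (l <= M)%N -> 0 < L i.+1 * L l.
  have h1 := H _ ij (ltnW jM); have h2 := H _ (leq_trans ij (leqnSn j)) jM.
  have : 0 < (L i.+1 * L j) * (L i.+1 * L j.+1) by rewrite mulr_gt0.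
  have -> : (L i.+1 * L j) * (L i.+1 * L j.+1) = L i.+1 ^+ 2 * (L j * L j.+1) by ring.
  by rewrite pmulr_rgt0// lt_def sqr_ge0 andbT; apply: contraTneq h1 => /eqP;
    rewrite sqrf_eq0 => /eqP ->; rewrite mul0r ltxx.
move=> il lM.
have Li1 : L i.+1 != 0 by apply: contraTneq Li => ->; rewrite mulr0 ltxx.
have [->|il'] := eqVneq l i.+1; first by rewrite -expr2 lt_def sqr_ge0 andbT sqrf_eq0.
have [k lE] : exists k, l = (i + k.+2)%N by exists (l - i.+2)%N; lia.
have := three i k.+1; rewrite -lE => E.
have kM : (k.+2 <= M)%N by lia.
have s2 : 0 <= sin (k.+2%:R * theta).
  by apply: sin_ge0; apply: le_trans Mpi; rewrite ler_pM2r// ler_nat.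
have s1 : 0 < sin (k.+1%:R * theta).
  apply: sin_gt0_pi; rewrite mulr_gt0//=; apply: lt_le_trans Mpi.
  by rewrite ltr_pM2r// ltr_nat.
have E2 : sin theta * (L i.+1 * L l) =
   sin (k.+2%:R * theta) * L i.+1 ^+ 2 - sin (k.+1%:R * theta) * (L i * L i.+1).
  have -> : sin theta * (L i.+1 * L l) = L i.+1 * (sin theta * L l) by ring.
  have -> : sin theta * L l = sin (k.+2%:R * theta) * L i.+1 - sin (k.+1%:R * theta) * L i.
    by rewrite E; ring.
  by ring.
rewrite -(pmulr_rgt0 _ sin_theta) E2 subr_gt0.
apply: (@lt_le_trans _ _ 0); first by rewrite pmulr_rlt0.
by rewrite mulr_ge0// sqr_ge0.
Qed.

(** The value at pi is the opposite of the value at 0. If there were no sign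
    change all L l would have the sign of L 0, and so would the value at pi,
    which is a nonnegative combination of L M and L (M + 1). *)
Lemma sinusoid_has_change (M : nat) : M%:R * theta <= pi -> pi < M.+1%:R * theta ->
  exists2 i, (i <= M)%N & L i * L i.+1 <= 0.
Proof.
move=> Mpi piM; apply: contrapT => H.
have {}H i : (i <= M)%N -> 0 < L i * L i.+1.
  by move=> iM; rewrite ltNge; apply/negP => h; apply: H; exists i.
have S l : (l <= M.+1)%N -> 0 < L 0 * L l.
  elim: l => [_|l IH lM].
    have := H 0%N isT; have [->|h _] := eqVneq (L 0) 0; first by rewrite mul0r ltxx.
    by rewrite -expr2 lt_def sqr_ge0 sqrf_eq0 h.
  have h1 := IH (ltnW lM); have h2 := H l lM.
  have h3 : 0 < (L 0 * L l) * (L l * L l.+1) by exact: mulr_gt0.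
  have e : (L 0 * L l) * (L l * L l.+1) = L l ^+ 2 * (L 0 * L l.+1) by ring.
  by rewrite e in h3; have := sqr_ge0 (L l); move: h3; set x := L l ^+ 2; nra.
have h1 := S M (leqnSn M); have h2 := S M.+1 (leqnn _).
have := sinusoid_interpol U V (M%:R * theta) pi (M.+1%:R * theta).
have -> : M.+1%:R * theta - M%:R * theta = theta by rewrite -natr1; ring.
rewrite -/(L M) -/(L M.+1).
have -> : sinusoid U V pi = - L 0.
  by rewrite /L /sinusoid mul0r cospi sinpi cos0 sin0; ring.
have s1 : 0 <= sin (M.+1%:R * theta - pi).
  apply: sin_ge0_pi; rewrite -natr1 mulrDl mul1r; have := theta_ltpi; lra.
have s2 : 0 <= sin (pi - M%:R * theta).
  apply: sin_ge0_pi; rewrite subr_ge0 Mpi /= gerBl mulr_ge0//; exact: ltW.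
move=> E.
have : L 0 * (sin theta * - L 0) = L 0 * (sin (M.+1%:R * theta - pi) * L M +
   sin (pi - M%:R * theta) * L M.+1) by rewrite E.
have p0 : 0 < L 0 ^+ 2 by have := S 0%N isT; rewrite -expr2.
have p1 : 0 < sin theta * L 0 ^+ 2 by exact: mulr_gt0.
have p2 := mulr_ge0 s1 (ltW h1); have p3 := mulr_ge0 s2 (ltW h2).
have -> : L 0 * (sin theta * - L 0) = - (sin theta * L 0 ^+ 2) by ring.
have -> : L 0 * (sin (M.+1%:R * theta - pi) * L M + sin (pi - M%:R * theta) * L M.+1)
  = sin (M.+1%:R * theta - pi) * (L 0 * L M) + sin (pi - M%:R * theta) * (L 0 * L M.+1) by ring.
lra.
Qed.

End sinusoid.

(** * The probability of a sign change *)

(** The number M of steps of angle theta in a half period is pi / theta up to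
    1. *)
Lemma half_period_steps (R : realType) (theta : R) (M : nat) : 0 < theta -> theta <= 1 -> (0 < M)%N ->
  M%:R * theta <= pi -> pi < M.+1%:R * theta ->
  M%:R^-1 <= theta / pi + theta ^+ 2 /\ theta / pi - theta ^+ 2 <= M.+1%:R^-1.
Proof.
move=> th0 th1 M0 Mpi piM.
have pi2 : 2 <= pi :> R by exact: pi_ge2.
have pi0 : 0 < pi :> R by lra.
have ipi : pi^-1 <= 2^-1 :> R by rewrite lef_pV2 ?posrE.
have MR : 0 < M%:R :> R by rewrite ltr0n.
have pt : 1 < pi / theta by rewrite ltr_pdivlMr//; lra.
have q0 : 0 < theta / pi + theta ^+ 2 by rewrite addr_gt0 ?exprn_gt0// divr_gt0.
have Mge : pi / theta - 1 <= M%:R.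
  by move: piM; rewrite -ltr_pdivrMr// -natr1; lra.
have Mle : M%:R <= pi / theta by rewrite ler_pdivlMr.
have p1 : 0 < pi / theta - 1 by lra.
have upE (x y : R) : 0 < x -> 0 < y ->
    (x / y - 1) * (y / x + y ^+ 2) = 1 + y * (x - y - x^-1).
  by move=> x0 y0; field; rewrite !gt_eqF.
have dnE (x y : R) : 0 < x -> 0 < y ->
    (y / x - y ^+ 2) * (x / y + 1) = 1 - y * (x + y - x^-1).
  by move=> x0 y0; field; rewrite !gt_eqF.
split.
  apply: (@le_trans _ _ (pi / theta - 1)^-1); first by rewrite lef_pV2.
  rewrite invf_ple ?posrE// -[leLHS]mul1r ler_pdivrMr//.
  rewrite (upE _ _ pi0 th0).
  by rewrite lerDl mulr_ge0 ?(ltW th0)//; lra.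
have p2 : 0 < pi / theta + 1 by lra.
apply: (@le_trans _ _ (pi / theta + 1)^-1); last first.
  by rewrite lef_pV2 ?posrE ?ltr0n// -natr1 lerD2r.
rewrite -[leRHS]mul1r ler_pdivlMr//.
rewrite (dnE _ _ pi0 th0).
by rewrite gerBl mulr_ge0 ?(ltW th0)//; lra.
Qed.

Section sign_change_probability.
Context (d : measure_display) (T : measurableType d) (R : realType).
Variable P : probability T R.
Local Notation Ex := (Ex P).
Local Notation pr := (pr P).
Context (xi : nat + nat -> {RV P >-> R}).
Hypothesis indep : mutually_independent xi.
Hypothesis idistr : identically_distributed xi.
Hypothesis centered : forall i, ('E_P[xi i] = 0)%E.
Hypothesis variance1 : forall i, ('V_P[xi i] = 1)%E.
Hypothesis moment5 : forall i, ('E_P[(fun w => `|xi i w| ^+ 5)%R] < +oo)%E.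

Lemma pr_lin_ge (s : seq (nat + nat)) c (L : R) : uniq s -> 0 < L ->
  pr [set w | L <= `|lin xi s c w|] <= (\sum_(i <- s) c i ^+ 2) / L ^+ 2.
Proof.
move=> us L0; have [i2 <-] := Ex_lin_sqr indep centered variance1 moment5 c us.
have mlin : measurable_fun setT (fun w => `|lin xi s c w|).
  by apply: measurableT_comp => //; exact: measurable_lin.
rewrite ler_pdivlMr ?exprn_gt0// mulrC; apply: markov_pr => //.
- exact: measurable_le.
- by move=> w; exact: sqr_ge0.
- move=> w /= h; rewrite -[leRHS]real_normK ?num_real//.
  by rewrite ler_sqr ?nnegrE// ltW.
Qed.

Lemma sum_pr (M : nat) (A : nat -> set T) : (forall i, measurable (A i)) ->
  P.-integrable setT (EFin \o (fun w => \sum_(i < M) (\1_(A i) w : R))) /\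
  \sum_(i < M) pr (A i) = Ex (fun w => \sum_(i < M) \1_(A i) w).
Proof.
move=> mA; have iA (i : 'I_M) : P.-integrable setT (EFin \o \1_(A i)).
  by apply: bounded_meas_int; exact: bounded_meas_indic.
split; first exact: int_sum.
by rewrite Ex_sum//; apply: eq_bigr => i _; rewrite Ex_indic.
Qed.

Lemma sum_indic_le1 (M : nat) (A : nat -> set T) :
  (forall i, measurable (A i)) ->
  (forall i j w, (i < j)%N -> (j < M)%N -> A i w -> ~ A j w) ->
  \sum_(i < M) pr (A i) <= 1.
Proof.
move=> mA disj.
have [iA ->] := sum_pr M mA.
rewrite -[leRHS](Ex_cst P 1); apply: Ex_le; [exact: iA|exact: int_cst|].
move=> w.
suff : (\sum_(i < M) (\1_(A i) w : R) <= 1) /\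
  ((forall i, (i < M)%N -> ~ A i w) -> \sum_(i < M) (\1_(A i) w : R) = 0) by case.
elim: M disj {iA} => [|M IH] disj; first by rewrite big_ord0 ler01.
have [IH1 IH2] := IH (fun i j w0 ij jM => disj i j w0 ij (ltnW jM)).
rewrite big_ord_recr /= indicE; split.
  case: (pselect (A M w)) => h.
    rewrite mem_set//= IH2 ?add0r// => i iM hi.
    exact: (disj i M w iM (ltnSn M) hi h).
  by rewrite memNset// addr0.
move=> h; rewrite memNset ?addr0; last exact: h.
by apply: IH2 => i iM; apply: h; exact: ltnW.
Qed.

Lemma sum_indic_ge1 (M : nat) (A : nat -> set T) :
  (forall i, measurable (A i)) ->
  (forall w, exists2 i, (i < M)%N & A i w) ->
  1 <= \sum_(i < M) pr (A i).
Proof.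
move=> mA cover.
have [iA ->] := sum_pr M mA.
rewrite -[leLHS](Ex_cst P 1); apply: Ex_le; [exact: int_cst|exact: iA|].
move=> w; have [i iM Ai] := cover w.
rewrite (bigD1 (Ordinal iM))//= indicE mem_set//= lerDl.
by apply: sumr_ge0 => j _; rewrite indicE ler0n.
Qed.

(** With U and V the normalised sums of the first and of the second half of
    the family, this is the linear form cos x U + sin x V: a random sinusoid
    in x. *)
Definition angle_coef (n : nat) (x : R) (i : nat + nat) : R :=
  match i with inl _ => cos x | inr _ => sin x end / Num.sqrt n%:R.

Lemma lin_angle_coef n x w : lin xi (idx n) (angle_coef n x) w =
  sinusoid (lin xi (idx n) (angle_coef n 0) w)
           (lin xi (idx n) (angle_coef n (pi / 2)) w) x.
Proof.
rewrite /lin /sinusoid !mulr_sumr -big_split /=; apply: eq_bigr => -[k|k] _ /=;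
  by rewrite /angle_coef ?cos0 ?sin0 ?cos_pihalf ?sin_pihalf; ring.
Qed.

Lemma covariance_angle_coef n x y : (0 < n)%N ->
  covariance_near n (cos (y - x)) (angle_coef n x) (angle_coef n y).
Proof.
move=> n0; have nR : 0 < n%:R :> R by rewrite ltr0n.
have sn : 0 < Num.sqrt n%:R :> R by rewrite sqrtr_gt0.
have sn2 : Num.sqrt n%:R ^+ 2 = n%:R :> R by rewrite sqr_sqrtr// ler0n.
have E a b : \sum_(i <- idx n) angle_coef n a i * angle_coef n b i = cos (b - a).
  rewrite big_idx /= /angle_coef /= big_const_ord iter_addr_0 cosB.
  rewrite -[LHS]mulr_natr; move: sn sn2; set s := Num.sqrt _ => s0 <-; field.
  by rewrite gt_eqF.
have E2 a : \sum_(i <- idx n) angle_coef n a i ^+ 2 = 1.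
  have := E a a; rewrite subrr cos0 => <-.
  by apply: eq_bigr => i _; rewrite expr2.
have p : 0 <= 2 / n%:R :> R by rewrite divr_ge0.
split; rewrite ?E2 ?E ?subrr ?normr0//.
have B a i : `|angle_coef n a i| <= 2 / Num.sqrt n%:R.
  rewrite /angle_coef normrM normfV (ger0_norm (ltW sn)) ler_pM2r ?invr_gt0//.
  by case: i => k; [have := cos_max a|have := sin_max a]; set z := `|_|; lra.
by move=> i _; split; exact: B.
Qed.

Context (K : R) (rn : nat -> R).
Hypothesis K0 : 0 <= K.
Hypothesis rn_cvg : rn n @[n --> \oo] --> (0 : R).

(** The conclusion of the small ball estimate for one linear form. *)
Definition spread n c := forall eta, 0 <= eta ->
  pr [set w | `|lin xi (idx n) c w| <= eta] <= K * eta + rn n.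

Hypothesis spread_angle : forall n x, (0 < n)%N -> spread n (angle_coef n x).

(** A pair with correlation cos theta changes sign with probability about
    theta / pi, as a Gaussian pair does. Successive values of the random
    sinusoid cos x U + sin x V at the angles 0, theta, 2 theta, and so on are
    M such pairs, so all of them, and the given pair, have asymptotically the
    same probability D of a sign change. A sinusoid changes sign exactly once
    in a half period, whence D is about 1 / M, and M is about pi / theta. *)
Lemma sign_change_angle (theta e : R) : 0 < theta -> theta <= 1 -> 0 < e ->
  exists n0 : nat, forall n c1 c2, (n0 <= n)%N ->
  covariance_near n (cos theta) c1 c2 -> spread n c1 -> spread n c2 ->
  let X := lin xi (idx n) c1 in let Y := lin xi (idx n) c2 in
  theta / pi - theta ^+ 2 - e <= pr [set w | X w * Y w < 0] /\
  pr [set w | X w * Y w <= 0] <= theta / pi + theta ^+ 2 + e.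
Proof.
move=> th0 th1 e0.
have pi2 : 2 <= pi :> R by exact: pi_ge2.
have thpi : theta < pi by lra.
pose e1 := e / 32.
have e10 : 0 < e1 by rewrite divr_gt0.
pose delta := e1 / (K + 1).
have K1 : 0 < K + 1 by rewrite ltr_wpDl.
have delta0 : 0 < delta by rewrite divr_gt0.
have Kdelta : K * delta <= e1.
  by rewrite /delta mulrCA ler_piMr ?(ltW e10)// ler_pdivrMr// mul1r lerDl.
pose L := 3 / e1 + 1 + delta.
have q0 : 0 < 3 / e1 by rewrite divr_gt0.
have dL : delta < L by rewrite /L; lra.
have L1 : 1 <= L by rewrite /L; lra.
have L0 : 0 < L by lra.
have L3 : 3 / L ^+ 2 <= e1.
  rewrite ler_pdivrMr ?exprn_gt0//.
  have : 3 <= e1 * L by rewrite mulrC -ler_pdivrMr// /L; lra.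
  by have : e1 * L <= e1 * L ^+ 2; [rewrite ler_pM2l// expr2 ler_peMr// ltW|lra].
(* delta and L make the two probabilities in sign_error at most e1 up to the
   remainder rn n *)
have [a [m hsgn]] := soft_sign_approx e10 delta0 dL.
pose h := @soft_sign R a m.
have thh : trig2 (fun x y => h x * h y).
  by have [h1 h2] := trig2_soft_sign a m; exact: trig2_mul.
have crho : -1 <= cos theta <= 1 by rewrite cos_geN1 cos_le1.
have [C C0 HC] := trig2_close indep idistr centered variance1 moment5 crho thh.
have [n1 Hn1] : exists n1, forall n, (n1 <= n)%N -> rn n <= e1.
  have /cvgrPdist_le /(_ _ e10) [n1 _ H1] := rn_cvg.
  exists n1 => n nn1; have := H1 n nn1; rewrite /= sub0r normrN.
  exact: le_trans (ler_norm _).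
have [n2 Hn2] : exists n2, forall n, (n2 <= n)%N -> (0 < n)%N /\ C / Num.sqrt n%:R <= e1.
  exists (Num.truncn ((C / e1) ^+ 2)).+1 => n nn2.
  have n0 : (0 < n)%N by apply: leq_trans nn2.
  split => //.
  have nR : 0 < n%:R :> R by rewrite ltr0n.
  have sn : 0 < Num.sqrt n%:R :> R by rewrite sqrtr_gt0.
  rewrite ler_pdivrMr// mulrC -ler_pdivrMr//.
  have -> : C / e1 = Num.sqrt ((C / e1) ^+ 2).
    by rewrite sqrtr_sqr ger0_norm// divr_ge0// ltW.
  rewrite ler_wsqrtr//.
  apply: (@le_trans _ _ (Num.truncn ((C / e1) ^+ 2)).+1%:R).
    by rewrite ltW// truncnS_gt.
  by rewrite ler_nat.
exists (maxn n1 n2) => n c1 c2; rewrite geq_max => /andP[nn1 nn2] cov s1 s2 X Y.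
have [n0 Cn] := Hn2 _ nn2; have rne := Hn1 _ nn1.
have mlin c : measurable_fun setT (lin xi (idx n) c) by exact: measurable_lin.
have hb x : `|h x| <= 1 by exact: soft_sign_bound.
have hN x : h (- x) = - h x by exact: soft_signN.
have mh : measurable_fun setT h by exact: measurable_soft_sign.
have sq_le (c : nat + nat -> R) : `|\sum_(i <- idx n) c i ^+ 2 - 1| <= 2 / n%:R -> \sum_(i <- idx n) c i ^+ 2 <= 3.
  rewrite ler_norml => /andP[_ hc].
  have : 2 / n%:R <= 2 :> R by rewrite ler_pdivrMr ?ltr0n// ler_peMr// ler1n.
  lra.
have serr (c : nat + nat -> R) : `|\sum_(i <- idx n) c i ^+ 2 - 1| <= 2 / n%:R -> spread n c ->
    sign_error P e1 delta L (lin xi (idx n) c) <= 4 * e1.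
  move=> c2' sc; rewrite /sign_error.
  have h1 := sc delta (ltW delta0).
  have h2 := pr_lin_ge c (uniq_idx n) L0.
  have h3 : (\sum_(i <- idx n) c i ^+ 2) / L ^+ 2 <= 3 / L ^+ 2.
    by rewrite ler_pM2r ?invr_gt0 ?exprn_gt0//; exact: sq_le.
  by move: h1 h2 h3 L3 Kdelta rne; lra.
pose D c c' := (1 - Ex (fun w => h (lin xi (idx n) c w) * h (lin xi (idx n) c' w))) / 2.
have Dbnd c c' : covariance_near n (cos theta) c c' -> spread n c -> spread n c' ->
    D c c' - 8 * e1 <= pr [set w | lin xi (idx n) c w * lin xi (idx n) c' w < 0] /\
    pr [set w | lin xi (idx n) c w * lin xi (idx n) c' w <= 0] <= D c c' + 8 * e1.
  move=> [h1 h2 _ _] sc sc'; have E1 := serr _ h1 sc; have E2 := serr _ h2 sc'.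
  have [lo hi] := pr_sign_change P (mlin c) (mlin c') mh hb hN e10 (ltW delta0) hsgn.
  by split; [apply: le_trans lo|apply: (le_trans hi)]; rewrite /D; lra.
have Dclose c c' : covariance_near n (cos theta) c c' -> `|D c c' - D c1 c2| <= e1.
  move=> hc; have := HC _ _ _ _ _ n0 hc cov; rewrite /D => H.
  have := le_trans H Cn; rewrite !ler_norml => /andP[u1 u2]; apply/andP.
  by split; lra.
pose al i : nat + nat -> R := angle_coef n (i%:R * theta).
have covi i : covariance_near n (cos theta) (al i) (al i.+1).
  have := covariance_angle_coef (i%:R * theta) (i.+1%:R * theta) n0.
  by have -> : i.+1%:R * theta - i%:R * theta = theta by rewrite -natr1; ring.
have spi i : spread n (al i) by exact: spread_angle.
have linE i w : lin xi (idx n) (al i) w =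
  sinusoid (lin xi (idx n) (angle_coef n 0) w)
           (lin xi (idx n) (angle_coef n (pi / 2)) w) (i%:R * theta).
  exact: lin_angle_coef.
pose M := Num.truncn (pi / theta).
have pth : 1 < pi / theta by rewrite ltr_pdivlMr// mul1r.
have M0 : (0 < M)%N by rewrite truncn_gt0 ltW.
have Mle : M%:R <= pi / theta by rewrite truncn_le ltW// (lt_trans ltr01).
have Mgt : pi / theta < M.+1%:R by exact: truncnS_gt.
have Mpi : M%:R * theta <= pi by rewrite -ler_pdivlMr.
have piM : pi < M.+1%:R * theta by rewrite -ltr_pdivrMr.
have MR : 0 < M%:R :> R by rewrite ltr0n.
pose Alt i := [set w | lin xi (idx n) (al i) w * lin xi (idx n) (al i.+1) w < 0].
pose Ale i := [set w | lin xi (idx n) (al i) w * lin xi (idx n) (al i.+1) w <= 0].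
have mlt i : measurable (Alt i) by apply: measurable_lt => //; exact: measurable_funM.
have mle i : measurable (Ale i) by apply: measurable_le => //; exact: measurable_funM.
have up : D c1 c2 <= M%:R^-1 + 9 * e1.
  have h1 : \sum_(i < M) pr (Alt i) <= 1.
    apply: sum_indic_le1 => // i j w ij jM; rewrite /Alt /= !linE => hi hj.
    have := sinusoid_no_second_change th0 thpi Mpi ij jM hi.
    by rewrite ltNge (ltW hj).
  have h2 : \sum_(i < M) (D c1 c2 - 9 * e1) <= \sum_(i < M) pr (Alt i).
    apply: ler_sum => i _.
    have [+ _] := Dbnd _ _ (covi i) (spi i) (spi i.+1); apply: le_trans.
    by have := Dclose _ _ (covi i); rewrite ler_norml => /andP[]; lra.
  have := le_trans h2 h1; rewrite sumr_const card_ord -[_ *+ M]mulr_natr.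
  by rewrite -ler_pdivlMr// mul1r; lra.
have dn : M.+1%:R^-1 - 9 * e1 <= D c1 c2.
  have h1 : 1 <= \sum_(i < M.+1) pr (Ale i).
    apply: sum_indic_ge1 => // w.
    have [i iM hi] := sinusoid_has_change (lin xi (idx n) (angle_coef n 0) w)
       (lin xi (idx n) (angle_coef n (pi / 2)) w) th0 thpi Mpi piM.
    by exists i => //; rewrite /Ale /= !linE.
  have h2 : \sum_(i < M.+1) pr (Ale i) <= \sum_(i < M.+1) (D c1 c2 + 9 * e1).
    apply: ler_sum => i _.
    have [_ /le_trans] := Dbnd _ _ (covi i) (spi i) (spi i.+1); apply.
    by have := Dclose _ _ (covi i); rewrite ler_norml => /andP[]; lra.
  have := le_trans h1 h2; rewrite sumr_const card_ord -[_ *+ M.+1]mulr_natr.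
  by rewrite -ler_pdivrMr// mul1r lerBlDr.
have [Mup Mdn] := half_period_steps th0 th1 M0 Mpi piM.
have [] := Dbnd _ _ cov s1 s2.
rewrite -/X -/Y; have <- : 32 * e1 = e by rewrite /e1; field.
move: up dn Mup Mdn; set x := M%:R^-1; set y := M.+1%:R^-1; set tp := theta / pi.
set t2 := theta ^+ 2; set plt := pr _; set ple := pr _ => up' dn' Mup' Mdn' Dge' Dle'.
clear - up' dn' Mup' Mdn' Dge' Dle' e10; by split; lra.
Qed.

End sign_change_probability.

(** * Zeros on an interval and successive derivatives *)

Section zeros_on_an_interval.
Context (R : realType).
Implicit Types (f : R -> R) (x y z t h : R).

Lemma is_derive_continuous f (f' : R -> R) : (forall x, is_derive x 1 f (f' x)) ->
  continuous f.
Proof.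
move=> df z; apply: differentiable_continuous.
by apply/derivable1_diffP; have := df z => -[].
Qed.

Lemma mean_value f (f' : R -> R) x y : (forall x, is_derive x 1 f (f' x)) ->
  x <= y -> exists2 c, x <= c <= y & f y - f x = f' c * (y - x).
Proof.
move=> df xy; have [|c] := @MVT_segment R f f' x y xy (fun z _ => df z).
  by apply: continuous_subspaceT; exact: (is_derive_continuous df).
by rewrite in_itv; exists c.
Qed.

(** Strict sortedness makes the listed zeros distinct and lets Rolle's
    theorem act between neighbours. *)
Definition zero_list f x y (s : seq R) :=
  sorted <%R s /\ forall z, z \in s -> x <= z <= y /\ f z = 0.

Definition has_zeros f x y k := exists2 s, zero_list f x y s & size s = k.

Lemma has_zerosW f x y k l : (l <= k)%N -> has_zeros f x y k -> has_zeros f x y l.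
Proof.
move=> lk [s [ss sz] sk]; exists (take l s); last by rewrite size_takel// sk.
by split=> [|z /mem_take/sz//]; exact: take_sorted.
Qed.

Lemma rolle_path f (f' : R -> R) z s : (forall x, is_derive x 1 f (f' x)) ->
  path <%R z s -> f z = 0 -> (forall y, y \in s -> f y = 0) ->
  exists s', [/\ size s' = size s, path <%R z s' &
    forall c, c \in s' -> c <= last z s /\ f' c = 0].
Proof.
move=> df; elim: s z => [|y s IH] z /=; first by exists [::].
move=> /andP[zy ys] fz0 fs0.
have fy0 : f y = 0 by apply: fs0; rewrite inE eqxx.
have [|s' [ss' ps' cs']] := IH y ys fy0.
  by move=> c cs; apply: fs0; rewrite inE cs orbT.
have cf := is_derive_continuous df.
have [c cI dc] : exists2 c : R, c \in `]z, y[ & is_derive c 1 f 0.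
  apply: (Rolle zy).
  - by move=> c _; have := df c => -[].
  - exact: continuous_subspaceT.
  - by rewrite fz0 fy0.
move: cI; rewrite in_itv /= => /andP[zc cy].
have f'c : f' c = 0.
  by have [_ <-] := df c; have [_ <-] := dc.
exists (c :: s'); split; first by rewrite /= ss'.
  rewrite /= zc /=; case: s' ps' {ss' cs'} => //= a s' /andP[ya ->].
  by rewrite andbT (lt_trans cy).
move=> b; rewrite inE => /predU1P[->|/cs'//].
split => //; apply: (le_trans (ltW cy)).
have := order_path_min (@lt_trans _ R) ys.
case: (lastP s) => [//|s1 a]; rewrite last_rcons => /allP/(_ a).
by rewrite mem_rcons inE eqxx => /(_ isT)/ltW.
Qed.

Lemma has_zeros_derive f (f' : R -> R) x y k : (forall x, is_derive x 1 f (f' x)) ->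
  has_zeros f x y k.+1 -> has_zeros f' x y k.
Proof.
move=> df [[//|z s] [/= zs sz] [sk]].
have [|s' [ss' ps' cs']] := rolle_path df zs (sz z (mem_head _ _)).2.
  by move=> c cs; apply: (sz _ _).2; rewrite inE cs orbT.
exists s'; last by rewrite ss'.
split; first exact: path_sorted ps'.
move=> c cs; have [cl ->] := cs' c cs; split => //; apply/andP; split.
  apply: (@le_trans _ _ z); first by have [/andP[]] := sz z (mem_head _ _).
  by have /allP/(_ c cs)/ltW := order_path_min (@lt_trans _ R) ps'.
by apply: (le_trans cl); have [/andP[]] := sz _ (mem_last z s).
Qed.

(** A list of zeros of maximal size contains all zeros. *)
Lemma zero_list_max f x y K : ~ has_zeros f x y K.+1 ->
  exists2 s, zero_list f x y s & (size s <= K)%N /\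
    forall z, x <= z <= y -> f z = 0 -> z \in s.
Proof.
move=> H.
have [k [[s zs sk] kmax]] : exists k, has_zeros f x y k /\ ~ has_zeros f x y k.+1.
  elim: K H => [|K IH] H; first by exists 0%N; split => //; exists [::].
  by have [h|h] := pselect (has_zeros f x y K.+1); [exists K.+1|exact: IH].
have kK : (k <= K)%N.
  rewrite leqNgt; apply/negP => Kk; apply: H; apply: has_zerosW Kk _.
  by exists s.
exists s => //; split; first by rewrite sk.
move=> z zxy fz; apply: contrapT => /negP zns; apply: kmax.
exists (sort <=%R (z :: s)); last by rewrite size_sort /= sk.
split.
  rewrite lt_sorted_uniq_le sort_uniq /= zns /=.
  rewrite sort_sorted ?andbT; last exact: le_total.
  by move: zs.1; rewrite lt_sorted_uniq_le => /andP[].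
by move=> a; rewrite mem_sort inE => /predU1P[->//|]; exact: zs.2.
Qed.

Section derivative_tower.
Variables (F : nat -> R -> R) (nu : R).
Hypothesis nu_gt0 : 0 < nu.
Let nu0 : 0 <= nu := ltW nu_gt0.
Hypothesis dF : forall m t, is_derive t 1 (F m) (nu * F m.+1 t).
Variables (x h : R).
Hypothesis h0 : 0 <= h.
Local Notation eps := (nu * h).
Local Notation bounded_on m M := (forall t, x <= t <= x + h -> `|F m t| <= M).

Lemma increment_bound m M s t : bounded_on m.+1 M ->
  x <= s <= x + h -> x <= t <= x + h -> `|F m t - F m s| <= eps * M.
Proof.
move=> B; wlog st : s t / s <= t => [H hs ht|].
  case: (leP s t) => [/H|/ltW/H]; first exact.
  by rewrite distrC; exact.
move=> /andP[xs sh] /andP[xt th].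
have [c /andP[c1 c2] ->] := mean_value (dF m) st.
have cB : `|F m.+1 c| <= M by apply: B; apply/andP; split; lra.
rewrite !normrM (ger0_norm nu0) -[leLHS]mulrA -[leRHS]mulrA ler_wpM2l//.
by rewrite [leRHS]mulrC ler_pM// ger0_norm; lra.
Qed.

Lemma zero_bound m M z t : bounded_on m.+1 M -> x <= z <= x + h -> F m z = 0 ->
  x <= t <= x + h -> `|F m t| <= eps * M.
Proof.
by move=> B hz Fz ht; have := increment_bound B hz ht; rewrite Fz subr0.
Qed.

(** By Rolle's theorem k zeros of F m leave k - 1 zeros of F (m + 1), which
    is therefore small by induction; and F m has a zero, so it is smaller by
    a further factor eps. *)
Lemma many_zeros_bound k m M : bounded_on (m + k)%N M ->
  has_zeros (F m) x (x + h) k -> bounded_on m (eps ^+ k * M).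
Proof.
elim: k m => [|k IH] m B Z t ht; first by rewrite addn0 in B; rewrite expr0 mul1r; exact: B.
have B1 : bounded_on m.+1 (eps ^+ k * M).
  apply: IH; first by rewrite addSnnS.
  have [s [ss sz] sk] := has_zeros_derive (dF m) Z.
  exists s => //; split => // z /sz[hz /eqP]; rewrite mulf_eq0 gt_eqF//= => /eqP.
  by [].
rewrite exprS -mulrA.
case: Z => -[//|z s] [_ /(_ z (mem_head _ _))[hz Fz]] _.
exact: zero_bound B1 hz Fz ht.
Qed.

(** Iterated mean value inequality: each derivative is bounded on the
    interval by its value at x plus eps times a bound on the next. *)
Lemma taylor_sup_bound N m B : bounded_on (m + N)%N B ->
  bounded_on m (\sum_(i < N) eps ^+ i * `|F (m + i)%N x| + eps ^+ N * B).
Proof.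
elim: N m => [|N IH] m HB t ht.
  by rewrite addn0 in HB; rewrite big_ord0 add0r expr0 mul1r; exact: HB.
have B1 := IH m.+1; rewrite addSnnS in B1; have {}B1 := B1 HB.
have hx : x <= x <= x + h by rewrite lexx lerDl.
have := increment_bound B1 hx ht.
rewrite big_ord_recl expr0 mul1r addn0 /= => H.
have -> : F m t = F m x + (F m t - F m x) by ring.
apply: (le_trans (ler_normD _ _)); rewrite -addrA lerD2l; apply: (le_trans H).
rewrite mulrDr mulrA -exprS lerD2r mulr_sumr; apply: ler_sum => i _.
by rewrite mulrA -exprS addSnnS.
Qed.

(** A zero between two end values of the same sign: the slopes before and
    after it have opposite signs, so the derivative vanishes too, and the
    function is as small as near a double zero. *)
Lemma same_sign_zero_bound M : bounded_on 2 M ->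
  has_zeros (F 0) x (x + h) 1 -> 0 < F 0 x * F 0 (x + h) -> `|F 0 x| <= eps ^+ 2 * M.
Proof.
move=> B [[//|z s] [_ /(_ z (mem_head _ _))[/andP[xz zh] Fz]] _] pos.
have hx : x <= x <= x + h by rewrite lexx lerDl.
suff [y hy Fy] : exists2 y, x <= y <= x + h & F 1 y = 0.
  rewrite expr2 -mulrA; apply: (@zero_bound 0 (eps * M) z) => //; last exact/andP.
  by move=> t ht; exact: (@zero_bound 1 M y).
have [c /andP[c1 c2] Ec] := mean_value (dF 0) xz.
have [c' /andP[c1' c2'] Ec'] := mean_value (dF 0) zh.
have cF : continuous (F 1) by exact: is_derive_continuous (dF 1).
have [||y] := @IVT R (F 1) c c' 0 (le_trans c2 c1').
- exact: continuous_subspaceT.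
- rewrite Fz sub0r in Ec; rewrite Fz subr0 in Ec'.
  have hc : F 1 c * F 1 c' <= 0.
    rewrite leNgt; apply/negP => cc.
    have : 0 <= (nu * F 1 c * (z - x)) * (nu * F 1 c' * (x + h - z)).
      have -> : (nu * F 1 c * (z - x)) * (nu * F 1 c' * (x + h - z)) =
        nu ^+ 2 * ((z - x) * (x + h - z)) * (F 1 c * F 1 c') by ring.
      by rewrite mulr_ge0 ?(ltW cc)// mulr_ge0 ?sqr_ge0// mulr_ge0; lra.
    by rewrite -Ec -Ec' mulNr; lra.
  have : (F 1 c <= 0 /\ 0 <= F 1 c') \/ (0 <= F 1 c /\ F 1 c' <= 0).
    case: (leP (F 1 c) 0) => l1; last by right; split; nra.
    by case: (leP 0 (F 1 c')) => l2; [left|right; split; nra].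
  by rewrite ge_min le_max => -[[-> ->]|[-> ->]]; rewrite ?orbT.
- by rewrite in_itv /= => /andP[y1 y2] Fy; exists y => //; apply/andP; split; lra.
Qed.

Lemma linearization_bound M : bounded_on 2 M ->
  `|F 0 (x + h) - (F 0 x + eps * F 1 x)| <= eps ^+ 2 * M.
Proof.
move=> B; have xh : x <= x + h by rewrite lerDl.
have hx : x <= x <= x + h by rewrite lexx.
have [c hc E] := mean_value (dF 0) xh.
have -> : F 0 (x + h) - (F 0 x + eps * F 1 x) = eps * (F 1 c - F 1 x).
  by rewrite opprD addrA E; ring.
have e0 : 0 <= eps by exact: mulr_ge0.
rewrite normrM ger0_norm// expr2 -mulrA ler_wpM2l//.
exact: increment_bound B hx hc.
Qed.

End derivative_tower.

Lemma counting_le_size (A : set R) (s : seq R) : (forall z, A z -> z \in s) ->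
  (counting A <= (size s)%:R%:E :> \bar R)%E.
Proof.
move=> As; have fA : finite_set A.
  by apply: (@sub_finite_set _ _ [set` s]) => //; exact: finite_seq.
rewrite /counting asboolT// lee_fin ler_nat.
by apply: uniq_leq_size => // z; rewrite in_fset_set// inE => /As.
Qed.

Lemma counting_ge_size (A : set R) (s : seq R) : uniq s -> (forall z, z \in s -> A z) ->
  ((size s)%:R%:E <= counting A :> \bar R)%E.
Proof.
move=> us sA; rewrite /counting; case: ifPn => [/asboolP fA|_]; last exact: leey.
rewrite lee_fin ler_nat; apply: uniq_leq_size => // z zs.
by rewrite in_fset_set// inE; exact: sA.
Qed.

End zeros_on_an_interval.

(** * The number of zeros of a trigonometric polynomial *)

Section zeros_of_trigonometric_polynomials.
Context (R : realType).
Implicit Types (s t : R).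

Definition expi t : R[i] := Complex (cos t) (sin t).

Lemma expiD s t : expi (s + t) = expi s * expi t.
Proof.
by apply/eqP; rewrite eq_complex /= cosD sinD; apply/andP; split; apply/eqP; ring.
Qed.

Lemma expi0 : expi 0 = 1.
Proof. by apply/eqP; rewrite eq_complex /= cos0 sin0 !eqxx. Qed.

Lemma expi_nat k t : expi (k%:R * t) = expi t ^+ k.
Proof.
elim: k => [|k IH]; first by rewrite mul0r expi0 expr0.
by rewrite exprS -IH -expiD -natr1; congr expi; ring.
Qed.

Lemma expi_neq0 t : expi t != 0.
Proof.
apply/eqP => h; have : expi t * expi (- t) = 0 by rewrite h mul0r.
by rewrite -expiD subrr expi0 => /eqP; rewrite oner_eq0.
Qed.

(** On an interval of length 1 the point exp(i t) determines t, so distinct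
    zeros of a trigonometric polynomial give distinct roots of the polynomial
    attached to it. *)
Lemma expi_inj s t : `|s - t| <= 1 -> expi s = expi t -> s = t.
Proof.
move=> st E; apply/eqP; rewrite -subr_eq0; apply/eqP.
have : expi (s - t) = 1 by rewrite expiD E -expiD subrr expi0.
set u := s - t in st *; move=> [cu _].
have := cos_le u; rewrite cu => h.
have u2 : u ^+ 2 <= 1 by rewrite -real_normK ?num_real// expr_le1.
have u4 : u ^+ 4 <= u ^+ 2 by rewrite (exprD _ 2 2) ler_piMl// sqr_ge0.
have : u ^+ 2 <= 0 by lra.
by move=> u20; apply/eqP; rewrite -sqrf_eq0 eq_le u20 sqr_ge0.
Qed.

Lemma wave_expi (a b x : R) : ((a * cos x + b * sin x)%:C)%C =
  (Complex (a / 2) (- b / 2)) * expi x + (Complex (a / 2) (b / 2)) * expi (- x) :> R[i].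
Proof.
by apply/eqP; rewrite eq_complex /= cosN sinN; apply/andP; split; apply/eqP; field.
Qed.

(** Multiplied by exp(i n t) the trigonometric polynomial becomes an
    algebraic polynomial of degree 2 n in exp(i t). *)
Lemma trig_poly_few_zeros (n : nat) (a b theta : nat -> R) (x y : R) :
  let f t := \sum_(1 <= k < n.+1)
    (a k * cos (k%:R * t + theta k) + b k * sin (k%:R * t + theta k)) in
  y - x <= 1 -> ~ (forall t, f t = 0) -> ~ has_zeros f x y (2 * n).+1.
Proof.
move=> f yx fn0 [s [ss sz] sk].
pose al k : R[i] := Complex (a k / 2) (- b k / 2) * expi (theta k).
pose be k : R[i] := Complex (a k / 2) (b k / 2) * expi (- theta k).
pose Q : {poly R[i]} := \sum_(1 <= k < n.+1)
   (al k *: 'X^(n + k) + be k *: 'X^(n - k)).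
have QE t : Q.[expi t] = expi t ^+ n * ((f t)%:C)%C.
  rewrite /Q horner_sum /f rmorph_sum /= mulr_sumr; apply: eq_big_nat => k /andP[k1 kn].
  rewrite wave_expi hornerD !hornerZ !hornerXn mulrDr; congr (_ + _).
    rewrite /al expiD expi_nat exprD; ring.
  rewrite /be opprD expiD.
  have -> : expi t ^+ n = expi t ^+ (n - k) * expi t ^+ k by rewrite -exprD subnK.
  have : expi t ^+ k * expi (- (k%:R * t)) = 1 by rewrite -expi_nat -expiD subrr expi0.
  move=> E; rewrite -[LHS]mulr1 -E; ring.
have Qs : (size Q <= (2 * n).+1)%N.
  rewrite /Q big_nat; apply: (big_ind (fun p : {poly R[i]} => (size p <= (2 * n).+1)%N)).
  - by rewrite size_poly0.
  - by move=> p q hp hq; apply: (leq_trans (size_polyD _ _)); rewrite geq_max hp hq.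
  - move=> k /andP[_ kn]; apply: (leq_trans (size_polyD _ _)); rewrite geq_max.
    apply/andP; split; apply: (leq_trans (size_scale_leq _ _)); rewrite size_polyXn; lia.
have Q0 : Q != 0.
  apply/eqP => Q0; apply: fn0 => t; have := QE t; rewrite Q0 horner0 => /esym/eqP.
  by rewrite mulf_eq0 expf_eq0 (negbTE (expi_neq0 t)) andbF /= => /eqP [].
have rts : all (root Q) (map expi s).
  by apply/allP => _ /mapP[z /sz[_ fz] ->]; rewrite /root QE fz mulr0.
have urs : uniq (map expi s).
  rewrite map_inj_in_uniq; first by move: ss; rewrite lt_sorted_uniq_le => /andP[].
  move=> z z' /sz[/andP[h1 h2] _] /sz[/andP[h3 h4] _]; apply: expi_inj.
  by rewrite ler_norml; apply/andP; split; lra.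
have := leq_trans (max_poly_roots Q0 rts urs) Qs.
by rewrite size_map sk ltnn.
Qed.

End zeros_of_trigonometric_polynomials.

(** * Normalised derivatives of the random polynomial *)

Section integral_comparison.
Context (d : measure_display) (T : measurableType d) (R : realType).
Variable mu : {measure set T -> \bar R}.

(** The integral of a nonnegative function is the supremum of the integrals
    of the simple functions below it, so it is monotone on all functions; the
    number of zeros is compared in this way with finite sums of indicators. *)
Lemma le_integral_nomeas (f g : T -> \bar R) : (forall x, 0 <= f x)%E ->
  (forall x, f x <= g x)%E -> (\int[mu]_x f x <= \int[mu]_x g x)%E.
Proof.
move=> f0 fg; have g0 x : (0 <= g x)%E by exact: le_trans (f0 x) (fg x).
rewrite !ge0_integralTE//; apply: ge_ereal_sup => _ [h /= hf <-]; apply: ereal_sup_ubound.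
by exists h => // x; exact: le_trans (hf x) (fg x).
Qed.

End integral_comparison.

Section weighted_sums.
Context (R : realType).

(** Cauchy-Schwarz for the weights c. *)
Lemma sqr_weighted_sum_le (c y : nat -> R) N : (forall i, 0 <= c i) ->
  (\sum_(i < N) c i * y i) ^+ 2 <= (\sum_(i < N) c i) * \sum_(i < N) c i * y i ^+ 2.
Proof.
move=> c0; elim: N => [|N IH]; first by rewrite !big_ord0 expr0n mul0r.
rewrite !big_ord_recr /=; move: IH.
have : 0 <= \sum_(i < N) c i * y i ^+ 2.
  by apply: sumr_ge0 => i _; rewrite mulr_ge0// sqr_ge0.
have : 0 <= \sum_(i < N) c i by exact: sumr_ge0.
set C := \sum_(i < N) c i; set Q := \sum_(i < N) c i * y i ^+ 2; set S := \sum_(_ < _) _.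
move=> C0 Q0 IH; have a0 := c0 N; set a := c N in a0 *; set z := y N.
have h : 2 * S * z <= C * z ^+ 2 + Q.
  have h0 : 0 <= C * z ^+ 2 + Q by rewrite addr_ge0// mulr_ge0// sqr_ge0.
  case: (leP (2 * S * z) 0) => h1; first exact: le_trans h1 h0.
  rewrite -ler_sqr ?nnegrE ?(ltW h1)//.
  have : 4 * S ^+ 2 * z ^+ 2 <= 4 * (C * Q) * z ^+ 2.
    by rewrite ler_wpM2r ?sqr_ge0// ler_pM2l.
  have : 0 <= (C * z ^+ 2 - Q) ^+ 2 by exact: sqr_ge0.
  have -> : (C * z ^+ 2 - Q) ^+ 2 = (C * z ^+ 2 + Q) ^+ 2 - 4 * (C * Q) * z ^+ 2 by ring.
  have -> : (2 * S * z) ^+ 2 = 4 * S ^+ 2 * z ^+ 2 by ring.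
  lra.
have : a * (2 * S * z) <= a * (C * z ^+ 2 + Q) by rewrite ler_wpM2l.
have -> : (S + a * z) ^+ 2 = S ^+ 2 + a * (2 * S * z) + a ^+ 2 * z ^+ 2 by ring.
have -> : (C + a) * (Q + a * z ^+ 2) = C * Q + a * (C * z ^+ 2 + Q) + a ^+ 2 * z ^+ 2 by ring.
lra.
Qed.

Lemma half_geometric_sum_le N : \sum_(i < N) 2^-1 ^+ i <= 2 :> R.
Proof.
have q : 0 <= (2^-1 : R) < 1 by apply/andP; split; lra.
apply: (le_trans (geometric_sum_le N q)).
have -> : 1 - 2^-1 = 2^-1 :> R by lra.
by rewrite invrK.
Qed.

Lemma sum_of_squares n : \sum_(k < n) (k.+1%:R : R) ^+ 2 = n%:R * (n%:R + 1) * (2 * n%:R + 1) / 6.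
Proof.
elim: n => [|n IH]; first by rewrite big_ord0 !mul0r.
by rewrite big_ord_recr /= IH -natr1; field.
Qed.

Lemma is_derive_seq_sum (I : Type) (s : seq I) (f : I -> R -> R) (df : I -> R) (t : R) :
  (forall i, is_derive t 1 (f i) (df i)) ->
  is_derive t 1 (fun t => \sum_(i <- s) f i t) (\sum_(i <- s) df i).
Proof.
move=> H; elim: s => [|i s IH].
  under [X in is_derive _ _ X _]eq_fun do rewrite big_nil.
  by rewrite big_nil; exact: is_derive_cst.
under [X in is_derive _ _ X _]eq_fun do rewrite big_cons.
by rewrite big_cons; exact: is_deriveD.
Qed.

End weighted_sums.

Section normalized_derivatives.
Context (d : measure_display) (T : measurableType d) (R : realType).
Variable P : probability T R.
Local Notation Ex := (Ex P).
Local Notation pr := (pr P).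
Local Notation int f := (P.-integrable setT (EFin \o f)).
Context (xi : nat + nat -> {RV P >-> R}) (theta : nat -> R).

(** The coefficients of the m-th derivative of P_n / sqrt n divided by n^m,
    so that all m share the same scale; differentiation is a shift of the
    phase by pi / 2. *)
Definition wave_coef (n m : nat) (t : R) (i : nat + nat) : R :=
  match i with
  | inl k => (k.+1%:R / n%:R) ^+ m * cos (k.+1%:R * t + theta k.+1 + m%:R * (pi / 2))
  | inr k => (k.+1%:R / n%:R) ^+ m * sin (k.+1%:R * t + theta k.+1 + m%:R * (pi / 2))
  end / Num.sqrt n%:R.

Definition wave n m t w := lin xi (idx n) (wave_coef n m t) w.

Lemma waveE n m t w : wave n m t w = lin xi (idx n) (wave_coef n m t) w.
Proof. by []. Qed.

Lemma wave_derive n (w : T) m (t : R) : (0 < n)%N ->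
  is_derive t 1 (fun t => wave n m t w) (n%:R * wave n m.+1 t w).
Proof.
move=> n0; have nR : n%:R != 0 :> R by rewrite pnatr_eq0 -lt0n.
have mE : m.+1%:R * (pi / 2) = m%:R * (pi / 2) + pi / 2 :> R by rewrite -natr1; ring.
rewrite /wave /lin mulr_sumr; apply: is_derive_seq_sum => -[k|k];
  rewrite /wave_coef mE addrA ?cosDpihalf ?sinDpihalf;
  apply: is_derive_eq; rewrite /GRing.scale /= exprS; field; rewrite nR;
  by rewrite sqrtr_eq0 -ltNge ltr0n n0.
Qed.

Lemma measurable_wave n m t : measurable_fun setT (wave n m t).
Proof. exact: measurable_lin. Qed.

Lemma wave_coef_sqr n m t k : (0 < n)%N ->
  wave_coef n m t (inl k) ^+ 2 + wave_coef n m t (inr k) ^+ 2 = (k.+1%:R / n%:R) ^+ (2 * m) / n%:R.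
Proof.
move=> n0; rewrite /wave_coef [(2 * m)%N]mulnC exprM.
set c := cos _; set s := sin _; set r := _ ^+ m.
have -> : (r * c / Num.sqrt n%:R) ^+ 2 + (r * s / Num.sqrt n%:R) ^+ 2 =
  r ^+ 2 * (c ^+ 2 + s ^+ 2) / Num.sqrt n%:R ^+ 2.
  by field; rewrite sqrtr_eq0 -ltNge ltr0n.
by rewrite cos2Dsin2 mulr1 sqr_sqrtr// ler0n.
Qed.

Lemma ratio_le1 n k : (k < n)%N -> 0 <= (k.+1%:R / n%:R : R) <= 1.
Proof.
move=> kn; rewrite divr_ge0//= ler_pdivrMr ?mul1r ?ler_nat// ltr0n.
exact: leq_trans kn.
Qed.

Lemma wave_coef_le n m t i : (0 < n)%N -> i \in idx n ->
  `|wave_coef n m t i| <= (Num.sqrt n%:R)^-1.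
Proof.
move=> n0; have sn : 0 < Num.sqrt n%:R :> R by rewrite sqrtr_gt0 ltr0n.
have H k (z : R) : (k < n)%N -> `|z| <= 1 ->
    `|(k.+1%:R / n%:R) ^+ m * z / Num.sqrt n%:R| <= (Num.sqrt n%:R)^-1.
  move=> kn z1; rewrite normrM normfV (ger0_norm (ltW sn)) ler_piMl ?invr_ge0 ?(ltW sn)//.
  have /andP[r0 r1] := ratio_le1 kn.
  by rewrite normrM mulr_ile1// ger0_norm ?exprn_ge0// exprn_ile1.
rewrite /idx mem_cat => /orP[] /mapP[k]; rewrite mem_iota add0n => /andP[_ kn] -> /=.
  exact: H kn (cos_max _).
exact: H kn (sin_max _).
Qed.

Lemma sum_wave_coef_sqr n m t : (0 < n)%N ->
  \sum_(i <- idx n) wave_coef n m t i ^+ 2 <= 1.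
Proof.
move=> n0; rewrite big_idx /=.
have nR : 0 < n%:R :> R by rewrite ltr0n.
apply: (@le_trans _ _ (\sum_(k < n) n%:R^-1)); last first.
  by rewrite sumr_const card_ord -[_ *+ n]mulr_natl mulfV// gt_eqF.
apply: ler_sum => k _; rewrite wave_coef_sqr//.
have /andP[r0 r1] := ratio_le1 (ltn_ord k).
by rewrite ler_piMl ?invr_ge0 ?(ltW nR)// exprn_ile1.
Qed.

(** Bounds every normalised derivative everywhere; too large to be useful
    alone, it closes the Taylor expansion, where its weight is 2^-n. *)
Definition mass n w : R := (Num.sqrt n%:R)^-1 * \sum_(i <- idx n) `|xi i w|.

Lemma wave_le_mass n m t w : (0 < n)%N -> `|wave n m t w| <= mass n w.
Proof.
move=> n0; rewrite /wave /lin /mass mulr_sumr; apply: (le_trans (ler_norm_sum _ _ _)).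
rewrite big_seq [leRHS]big_seq; apply: ler_sum => i ii.
by rewrite normrM ler_wpM2r// wave_coef_le.
Qed.

(** Bounds the k-th normalised derivative on a whole step starting at x by
    values at the single point x, whose second moments are at most 1. *)
Definition sup_bound n k x w : R :=
  \sum_(i < n) 2^-1 ^+ i * `|wave n (k + i) x w| + 2^-1 ^+ n * mass n w.

Lemma mass_ge0 n w : 0 <= mass n w.
Proof. by rewrite mulr_ge0 ?invr_ge0 ?sqrtr_ge0// sumr_ge0. Qed.

Lemma sup_bound_ge0 n k x w : 0 <= sup_bound n k x w.
Proof.
rewrite addr_ge0//; last by rewrite mulr_ge0 ?mass_ge0.
by rewrite sumr_ge0// => i _; rewrite mulr_ge0.
Qed.

(** Taylor expansion of order n at x, with n h <= 1/2. *)
Lemma wave_sup_bound n k x h w t : (0 < n)%N -> 0 <= h -> n%:R * h <= 2^-1 ->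
  x <= t <= x + h -> `|wave n k t w| <= sup_bound n k x w.
Proof.
move=> n0 h0 e2 ht; have nR : 0 < n%:R :> R by rewrite ltr0n.
have e0 : 0 <= n%:R * h by rewrite mulr_ge0// ltW.
have dF m (s : R) : is_derive s 1 (fun t => wave n m t w) (n%:R * wave n m.+1 s w).
  exact: wave_derive.
have := @taylor_sup_bound _ (fun m t => wave n m t w) n%:R nR dF x h h0 n k (mass n w)
  (fun t _ => wave_le_mass _ t w n0) t ht.
move/le_trans; apply; apply: lerD.
  apply: ler_sum => i _; rewrite ler_wpM2r//.
  by apply: lerXn2r; rewrite ?nnegrE ?invr_ge0.
rewrite ler_wpM2r ?mass_ge0//; by apply: lerXn2r; rewrite ?nnegrE ?invr_ge0.
Qed.

Lemma measurable_mass n : measurable_fun setT (mass n).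
Proof.
apply: measurable_funM => //; apply: measurable_sum => i.
exact: measurableT_comp.
Qed.

Lemma measurable_sup_bound n k x : measurable_fun setT (sup_bound n k x).
Proof.
apply: measurable_funD; last by apply: measurable_funM => //; exact: measurable_mass.
apply: measurable_sum => i; apply: measurable_funM => //.
by apply: measurableT_comp => //; exact: measurable_wave.
Qed.

Hypothesis indep : mutually_independent xi.
Hypothesis idistr : identically_distributed xi.
Hypothesis centered : forall i, ('E_P[xi i] = 0)%E.
Hypothesis variance1 : forall i, ('V_P[xi i] = 1)%E.
Hypothesis moment5 : forall i, ('E_P[(fun w => `|xi i w| ^+ 5)%R] < +oo)%E.

Lemma mass_sqr n : (0 < n)%N ->
  int (fun w => mass n w ^+ 2) /\ Ex (fun w => mass n w ^+ 2) <= 4 * n%:R.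
Proof.
move=> n0; have nR : 0 < n%:R :> R by rewrite ltr0n.
pose g w := 2 * \sum_(i <- idx n) xi i w ^+ 2.
have ig : int g.
  by apply: intZ; apply: int_sum => i; exact: int_sqr.
have mg w : mass n w ^+ 2 <= g w.
  rewrite /mass /g exprMn exprVn sqr_sqrtr ?ler0n// mulrC ler_pdivrMr//.
  rewrite (big_nth (inl 0%N)) big_mkord [in leRHS](big_nth (inl 0%N)) big_mkord.
  have := @sqr_weighted_sum_le R (fun=> 1) (fun i => `|xi (nth (inl 0%N) (idx n) i) w|)
     (size (idx n)) (fun=> ler01).
  under eq_bigr do rewrite mul1r.
  under [X in _ <= _ * X]eq_bigr do rewrite mul1r real_normK ?num_real//.
  rewrite sumr_const card_ord size_cat !size_map size_iota addnn -mul2n natrM.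
  by move/le_trans; apply; rewrite mulrAC.
have im : int (fun w => mass n w ^+ 2).
  apply: (int_le _ ig); first by apply: measurable_funX; exact: measurable_mass.
  by move=> w; rewrite ger0_norm ?sqr_ge0.
split => //; apply: (le_trans (Ex_le im ig mg)).
rewrite /g ExZ; last by apply: int_sum => i; exact: int_sqr.
rewrite Ex_sum; last by move=> i; exact: int_sqr.
rewrite (eq_bigr (fun=> 1)); last by move=> i _; rewrite Ex_sqr1.
rewrite big_const_seq iter_addr_0 count_predT size_cat !size_map size_iota addnn -mul2n natrM.
by rewrite mulrA; lra.
Qed.

(** Chebyshev's inequality: since the weights 2^-i sum to at most 2, the
    second moment of sup_bound is bounded uniformly in n, k and x. *)
Lemma pr_sup_bound n k x (L : R) : (0 < n)%N -> 0 < L ->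
  pr [set w | L <= sup_bound n k x w] <= 12 / L ^+ 2.
Proof.
move=> n0 L0; have nR : 0 < n%:R :> R by rewrite ltr0n.
pose g w := 2 * (\sum_(i < n) 2^-1 ^+ i * wave n (k + i) x w ^+ 2 + 2^-1 ^+ n * mass n w ^+ 2).
have iw (i : 'I_n) : int (fun w => wave n (k + i) x w ^+ 2).
  by have [] := Ex_lin_sqr indep centered variance1 moment5 (wave_coef n (k + i) x) (uniq_idx n).
have [im mE] := mass_sqr n0.
have is1 : int (fun w => \sum_(i < n) 2^-1 ^+ i * wave n (k + i) x w ^+ 2).
  by apply: int_sum => i; apply: intZ.
have im1 : int (fun w => 2^-1 ^+ n * mass n w ^+ 2) by apply: intZ.
have ig : int g by apply: intZ; apply: intD.
have Eg : Ex g <= 12.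
  rewrite /g ExZ; last exact: intD.
  rewrite ExD// Ex_sum; last by move=> i; exact: intZ.
  have h1 : \sum_(i < n) Ex (fun w => 2^-1 ^+ i * wave n (k + i) x w ^+ 2) <= 2.
    apply: le_trans (half_geometric_sum_le R n); apply: ler_sum => i _.
    rewrite ExZ// ler_piMr//.
    have [_ ->] := Ex_lin_sqr indep centered variance1 moment5 (wave_coef n (k + i) x) (uniq_idx n).
    exact: sum_wave_coef_sqr.
  have h2 : Ex (fun w => 2^-1 ^+ n * mass n w ^+ 2) <= 4.
    rewrite ExZ// exprVn mulrC ler_pdivrMr ?exprn_gt0//.
    apply: (le_trans mE); rewrite ler_pM2l// -natrX ler_nat.
    by rewrite ltnW// ltn_expl.
  lra.
have p2 (i : nat) : 0 <= 2^-1 ^+ i :> R by rewrite exprn_ge0// invr_ge0.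
have key w : sup_bound n k x w ^+ 2 <= g w.
  pose y i := if (i < n)%N then `|wave n (k + i) x w| else mass n w.
  have yE : \sum_(i < n.+1) 2^-1 ^+ i * y i = sup_bound n k x w.
    rewrite big_ord_recr /= /y ltnn; congr (_ + _).
    by apply: eq_bigr => i _; rewrite ltn_ord.
  have y2E : \sum_(i < n.+1) 2^-1 ^+ i * y i ^+ 2 =
     \sum_(i < n) 2^-1 ^+ i * wave n (k + i) x w ^+ 2 + 2^-1 ^+ n * mass n w ^+ 2.
    rewrite big_ord_recr /= /y ltnn; congr (_ + _).
    by apply: eq_bigr => i _; rewrite ltn_ord real_normK ?num_real.
  have := @sqr_weighted_sum_le R (fun i => 2^-1 ^+ i) y n.+1 p2.
  rewrite yE y2E; move/le_trans; apply.
  apply: ler_wpM2r; last exact: half_geometric_sum_le.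
  apply: addr_ge0; last by apply: mulr_ge0; [exact: p2|exact: sqr_ge0].
  by apply: sumr_ge0 => i _; apply: mulr_ge0; [exact: p2|exact: sqr_ge0].
rewrite ler_pdivlMr ?exprn_gt0// mulrC; apply: (le_trans _ Eg).
apply: markov_pr => //.
- by apply: measurable_le => //; exact: measurable_sup_bound.
- by move=> w; apply: le_trans (key w); exact: sqr_ge0.
- move=> w /= h; apply: le_trans (key w).
  by apply: lerXn2r; rewrite ?nnegrE ?(ltW L0) ?sup_bound_ge0.
Qed.

End normalized_derivatives.

(** * Events on one step of the grid *)

Section interval_probabilities.
Context (d : measure_display) (T : measurableType d) (R : realType).
Variable P : probability T R.
Local Notation Ex := (Ex P).
Local Notation pr := (pr P).
Local Notation int f := (P.-integrable setT (EFin \o f)).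
Context (xi : nat + nat -> {RV P >-> R}) (theta : nat -> R).
Hypothesis indep : mutually_independent xi.
Hypothesis idistr : identically_distributed xi.
Hypothesis centered : forall i, ('E_P[xi i] = 0)%E.
Hypothesis variance1 : forall i, ('V_P[xi i] = 1)%E.
Hypothesis moment5 : forall i, ('E_P[(fun w => `|xi i w| ^+ 5)%R] < +oo)%E.
Context (K : R) (rn : nat -> R).
Hypothesis K0 : 0 <= K.
Hypothesis rn0 : forall n, 0 <= rn n.
Hypothesis nrn_cvg : n%:R * rn n @[n --> \oo] --> (0 : R).
Hypothesis small : forall (n : nat) (a : nat + nat -> R), (0 < n)%N ->
  (forall k, (k < n)%N -> n%:R^-1 <= a (inl k) ^+ 2 + a (inr k) ^+ 2 <= 4 / n%:R) ->
  spread xi K rn n a.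

Local Notation wave := (wave xi theta).
Local Notation sup_bound := (sup_bound xi theta).

Lemma rn_cvg : rn n @[n --> \oo] --> (0 : R).
Proof.
apply: (@squeeze_cvgr _ _ _ _ (fun=> 0) (fun n => n%:R * rn n)) => //; last exact: cvg_cst.
near=> n; rewrite rn0 /= ler_peMl// ler1n.
by near: n; exists 1%N.
Unshelve. all: by end_near. Qed.

Lemma wave_coef0 n t k : exists2 a, wave_coef theta n 0 t (inl k) = cos a / Num.sqrt n%:R &
  [/\ wave_coef theta n 0 t (inr k) = sin a / Num.sqrt n%:R,
      wave_coef theta n 1 t (inl k) = - (k.+1%:R / n%:R * sin a) / Num.sqrt n%:R &
      wave_coef theta n 1 t (inr k) = k.+1%:R / n%:R * cos a / Num.sqrt n%:R].
Proof.
exists (k.+1%:R * t + theta k.+1); first by rewrite /wave_coef expr0 mul1r mul0r addr0.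
by split; rewrite /wave_coef ?expr0 ?mul1r ?mul0r ?addr0 // expr1
  ?cosDpihalf ?sinDpihalf ?mulrN.
Qed.

(** With X and X' the values of P_n / sqrt n and of its normalised
    derivative, this is the form cos phi X + sqrt 3 sin phi X'. As X' has
    variance about 1/3 and is uncorrelated with X, it is X turned by the
    angle phi; when tan phi = eps / sqrt 3 it equals cos phi (X + eps X'),
    which approximates cos phi times the value of P_n / sqrt n one step
    further. *)
Definition tilt_coef n (phi t : R) i :=
  cos phi * wave_coef theta n 0 t i + Num.sqrt 3 * sin phi * wave_coef theta n 1 t i.

Lemma lin_tilt n phi t w : lin xi (idx n) (tilt_coef n phi t) w =
  cos phi * wave n 0 t w + Num.sqrt 3 * sin phi * wave n 1 t w.
Proof.
rewrite !waveE /lin !mulr_sumr -big_split /=; apply: eq_bigr => i _.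
by rewrite /tilt_coef; ring.
Qed.

Lemma sqrt3_sqr : (Num.sqrt 3 : R) ^+ 2 = 3.
Proof. by rewrite sqr_sqrtr. Qed.

Lemma tilt_coef_sqr n phi t k : (0 < n)%N ->
  tilt_coef n phi t (inl k) ^+ 2 + tilt_coef n phi t (inr k) ^+ 2 =
  (cos phi ^+ 2 + 3 * sin phi ^+ 2 * (k.+1%:R / n%:R) ^+ 2) / n%:R.
Proof.
move=> n0; have sn2 : Num.sqrt n%:R ^+ 2 = n%:R :> R by rewrite sqr_sqrtr// ler0n.
have sn : Num.sqrt n%:R != 0 :> R by rewrite sqrtr_eq0 -ltNge ltr0n.
have [a E1 [E2 E3 E4]] := wave_coef0 n t k.
rewrite /tilt_coef E1 E2 E3 E4 -[X in _ = _ / X]sn2; set r := _ / n%:R.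
set s3 := Num.sqrt 3; have <- : s3 ^+ 2 = 3 by exact: sqrt3_sqr.
have := cos2Dsin2 a; set c := cos a; set s := sin a => h.
transitivity ((c ^+ 2 + s ^+ 2) * (cos phi ^+ 2 + s3 ^+ 2 * sin phi ^+ 2 * r ^+ 2) / Num.sqrt n%:R ^+ 2).
  by field.
by rewrite h mul1r.
Qed.

Lemma spread_wave n t : (0 < n)%N -> spread xi K rn n (wave_coef theta n 0 t).
Proof.
move=> n0; apply: small => // k kn; rewrite wave_coef_sqr// muln0 expr0 mul1r lexx /=.
by rewrite ler_peMl ?invr_ge0 ?ler0n ?ler1n.
Qed.

(** The form divided by cos phi satisfies the bounds required by the small
    ball estimate; the factor 2 comes from cos phi >= 1/2. *)
Lemma spread_tilt n phi t : (0 < n)%N -> 1 / 2 <= cos phi -> sin phi ^+ 2 <= cos phi ^+ 2 ->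
  spread xi (2 * K) rn n (tilt_coef n phi t).
Proof.
move=> n0 c2 sc eta eta0.
have c0 : 0 < cos phi by lra.
pose y i := (cos phi)^-1 * tilt_coef n phi t i.
have nR : 0 < n%:R :> R by rewrite ltr0n.
have sy : spread xi K rn n y.
  apply: small => // k kn.
  have -> : y (inl k) ^+ 2 + y (inr k) ^+ 2 =
    (1 + 3 * (sin phi ^+ 2 / cos phi ^+ 2) * (k.+1%:R / n%:R) ^+ 2) / n%:R.
    rewrite /y !exprMn -mulrDr tilt_coef_sqr// exprVn; field.
    by rewrite !gt_eqF.
  have /andP[r0 r1] := @ratio_le1 R n k kn.
  set r := _ / n%:R in r0 r1 *; set q := _ / _ ^+ 2.
  have q0 : 0 <= q by rewrite divr_ge0 ?sqr_ge0.
  have q1 : q <= 1 by rewrite ler_pdivrMr ?exprn_gt0// mul1r.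
  have r2 : 0 <= r ^+ 2 <= 1 by rewrite sqr_ge0 exprn_ile1.
  have qr : 0 <= q * r ^+ 2 <= 1.
    by case/andP: r2 => r20 r21; rewrite mulr_ge0//= mulr_ile1.
  by rewrite -[X in X <= _ <= _]mul1r !ler_pM2r ?invr_gt0//; apply/andP; split; lra.
have e2 : 0 <= 2 * eta by rewrite mulr_ge0.
have ml c : measurable_fun setT (fun w => `|lin xi (idx n) c w|).
  by apply: measurableT_comp => //; exact: measurable_lin.
apply: (@le_trans _ _ (pr [set w | `|lin xi (idx n) y w| <= 2 * eta])).
  apply: pr_le; [exact: measurable_le|exact: measurable_le|].
  move=> w /= hw.
  have -> : lin xi (idx n) y w = (cos phi)^-1 * lin xi (idx n) (tilt_coef n phi t) w.
    by rewrite /lin mulr_sumr; apply: eq_bigr => i _; rewrite /y mulrA.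
  rewrite normrM gtr0_norm ?invr_gt0// mulrC ler_pdivrMr//.
  by apply: (le_trans hw); nra.
by apply: (le_trans (sy _ e2)); rewrite mulrCA mulrA.
Qed.

(** The mean of (k / n)^2 over k <= n tends to 1/3, which is the origin of
    sqrt 3; the covariance of X and X' vanishes because cos and sin of the
    same angle appear with opposite signs in each pair. *)
Lemma covariance_tilt n phi t : (0 < n)%N ->
  covariance_near n (cos phi) (wave_coef theta n 0 t) (tilt_coef n phi t).
Proof.
move=> n0; have nR : 0 < n%:R :> R by rewrite ltr0n.
have p : 0 <= 2 / n%:R :> R by rewrite divr_ge0.
have sn2 : Num.sqrt n%:R ^+ 2 = n%:R :> R by rewrite sqr_sqrtr// ler0n.
have sn : 0 < Num.sqrt n%:R :> R by rewrite sqrtr_gt0.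
have cn : \sum_(k < n) n%:R^-1 = 1 :> R.
  by rewrite sumr_const card_ord -[_ *+ n]mulr_natl mulfV// gt_eqF.
split.
- rewrite big_idx /= (eq_bigr (fun=> n%:R^-1)); last first.
    by move=> k _; rewrite wave_coef_sqr// muln0 expr0 mul1r.
  by rewrite cn subrr normr0.
- rewrite big_idx /= (eq_bigr (fun k : 'I_n => cos phi ^+ 2 / n%:R +
     3 * sin phi ^+ 2 / n%:R ^+ 3 * k.+1%:R ^+ 2)); last first.
    by move=> k _; rewrite tilt_coef_sqr//; field; rewrite gt_eqF.
  rewrite big_split /= -!mulr_sumr cn sum_of_squares mulr1.
  have -> : cos phi ^+ 2 + 3 * sin phi ^+ 2 / n%:R ^+ 3 * (n%:R * (n%:R + 1) * (2 * n%:R + 1) / 6) - 1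
    = (cos phi ^+ 2 + sin phi ^+ 2 - 1) + sin phi ^+ 2 * ((3 + n%:R^-1) / (2 * n%:R)).
    have : n%:R != 0 :> R by rewrite gt_eqF.
    by move: (n%:R) (cos phi) (sin phi) => N c s N0; field.
  have q0 : 0 <= (3 + n%:R^-1) / (2 * n%:R) :> R.
    by apply: divr_ge0; [apply: addr_ge0|apply: mulr_ge0]; rewrite ?invr_ge0 ?ler0n.
  rewrite cos2Dsin2 subrr add0r normrM (ger0_norm (sqr_ge0 _)) (ger0_norm q0).
  have s1 : sin phi ^+ 2 <= 1 by rewrite -(cos2Dsin2 phi) lerDr sqr_ge0.
  have n1 : n%:R^-1 <= 1 :> R by rewrite invf_le1// ler1n.
  have q : (3 + n%:R^-1) / (2 * n%:R) <= 2 / n%:R :> R.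
    by rewrite invfM mulrA ler_pM2r ?invr_gt0//; lra.
  by apply: le_trans q; rewrite ler_piMl.
- rewrite big_idx /= (eq_bigr (fun=> cos phi * n%:R^-1)); last first.
    move=> k _; have [a E1 [E2 E3 E4]] := wave_coef0 n t k.
    rewrite /tilt_coef E1 E2 E3 E4 -[X in _ = _ * X^-1]sn2; set r := k.+1%:R / _.
    have := cos2Dsin2 a; set c := cos a; set s := sin a => h.
    transitivity ((c ^+ 2 + s ^+ 2) * cos phi / Num.sqrt n%:R ^+ 2); last by rewrite h mul1r.
    by field; rewrite gt_eqF.
  by rewrite -mulr_sumr cn mulr1 subrr normr0.
- move=> i ii; have w0 := wave_coef_le theta 0 t n0 ii; have w1 := wave_coef_le theta 1 t n0 ii.
  have q : 0 < (Num.sqrt n%:R)^-1 :> R by rewrite invr_gt0.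
  split; first by apply: (le_trans w0); move: q; lra.
  apply: (@le_trans _ _ ((`|cos phi| + Num.sqrt 3 * `|sin phi|) / Num.sqrt n%:R)).
    rewrite /tilt_coef mulrDl; apply: (le_trans (ler_normD _ _)).
    rewrite (normrM (cos phi)) (normrM (Num.sqrt 3 * sin phi)) (normrM (Num.sqrt 3)).
    rewrite (ger0_norm (sqrtr_ge0 3)).
    by apply: lerD; apply: ler_wpM2l => //; rewrite mulr_ge0// sqrtr_ge0.
  rewrite ler_pM2r//.
  have := cos2Dsin2 phi; rewrite -(real_normK (num_real (cos phi))) -(real_normK (num_real (sin phi))).
  have := sqrt3_sqr; have := sqrtr_ge0 (3 : R).
  have := normr_ge0 (cos phi); have := normr_ge0 (sin phi).
  set c := `|cos phi|; set s := `|sin phi|; set s3 := Num.sqrt 3 => s0 c0 s30 s32 h.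
  have cs : (c + s3 * s) ^+ 2 + (s3 * c - s) ^+ 2 = (c ^+ 2 + s ^+ 2) * (1 + s3 ^+ 2) by ring.
  rewrite h s32 in cs.
  have := sqr_ge0 (s3 * c - s) => z.
  have : (c + s3 * s) ^+ 2 <= 2 ^+ 2 by lra.
  by rewrite ler_sqr// nnegrE ?addr_ge0 ?mulr_ge0.
Qed.

Definition crossing n x h := [set w | wave n 0 x w * wave n 0 (x + h) w < 0].
Definition touching n x h := [set w | wave n 0 x w * wave n 0 (x + h) w <= 0].
(** What k zeros within the step from x force: either the value at x is of
    order eps^k, or the k-th derivative is exceptionally large. *)
Definition cluster n k x (eps L : R) :=
  [set w | `|wave n 0 x w| <= eps ^+ k * L] `|` [set w | L <= sup_bound n k x w].

Let mw n m t : measurable_fun setT (wave n m t). Proof. exact: measurable_wave. Qed.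
Let mabs (f : T -> R) : measurable_fun setT f -> measurable_fun setT (fun w => `|f w|).
Proof. by move=> mf; exact: measurableT_comp. Qed.

Lemma measurable_crossing n x h : measurable (crossing n x h).
Proof. by apply: measurable_lt => //; exact: measurable_funM. Qed.

Lemma measurable_touching n x h : measurable (touching n x h).
Proof. by apply: measurable_le => //; exact: measurable_funM. Qed.

Lemma measurable_cluster n k x eps L : measurable (cluster n k x eps L).
Proof.
apply: measurableU; apply: measurable_le => //; first exact: mabs.
exact: measurable_sup_bound.
Qed.

Lemma pr_cluster n k x (eps L : R) : (0 < n)%N -> 0 <= eps -> 0 < L ->
  pr (cluster n k x eps L) <= K * (eps ^+ k * L) + rn n + 12 / L ^+ 2.
Proof.
move=> n0 e0 L0; apply: (le_trans (pr_leU _ _ _)).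
- by apply: measurable_le => //; exact: mabs.
- by apply: measurable_le => //; exact: measurable_sup_bound.
apply: lerD.
  by apply: (spread_wave x n0); rewrite mulr_ge0 ?exprn_ge0// ltW.
exact: (pr_sup_bound theta indep centered variance1 moment5 k x n0 L0).
Qed.

(** Off the event B, the tilted form Z differs from cos phi times the value
    at the end of the step by less than |Z|, so it has the sign of that
    value; the sign change of the pair (X, Z), of correlation cos phi, is
    then that of the polynomial. *)
Lemma pr_sign_change_interval (phi eps e : R) :
  0 < phi -> phi <= 1 -> 1 / 2 <= cos phi -> sin phi ^+ 2 <= cos phi ^+ 2 ->
  Num.sqrt 3 * sin phi = cos phi * eps -> 0 <= eps <= 2^-1 -> 0 < e ->
  exists n0 : nat, forall n, (n0 <= n)%N -> forall x (L : R), 0 < L ->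
  let err := 2 * K * (eps ^+ 2 * L) + rn n + 12 / L ^+ 2 in
  phi / pi - phi ^+ 2 - e - err <= pr (crossing n x (eps / n%:R)) /\
  pr (touching n x (eps / n%:R)) <= phi / pi + phi ^+ 2 + e + err.
Proof.
move=> phi0 phi1 c2 sc tane /andP[eps0 eps2] e0.
have c0 : 0 < cos phi by lra.
have K20 : 0 <= 2 * K by rewrite mulr_ge0.
have spread2 n c : spread xi K rn n c -> spread xi (2 * K) rn n c.
  move=> s eta eta0; apply: (le_trans (s _ eta0)); rewrite lerD2r.
  by rewrite -mulrA ler_peMl ?mulr_ge0//; lra.
have sang n x : (0 < n)%N -> spread xi (2 * K) rn n (angle_coef n x : nat + nat -> R).
  move=> n0; apply: spread2; apply: small => // k kn; rewrite /angle_coef.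
  rewrite !expr_div_n -mulrDl cos2Dsin2 sqr_sqrtr ?ler0n// mul1r lexx /=.
  by rewrite ler_peMl ?invr_ge0 ?ler0n ?ler1n.
have [n1 H] := sign_change_angle indep idistr centered variance1 moment5 K20 rn_cvg
  sang phi0 phi1 e0.
exists (maxn n1 1) => n; rewrite geq_max => /andP[nn1 n0] x L L0 err.
have nR : 0 < n%:R :> R by rewrite ltr0n.
have [lo hi] := H n _ _ nn1 (covariance_tilt phi x n0) (spread2 _ _ (spread_wave x n0))
  (spread_tilt x n0 c2 sc).
pose h := eps / n%:R.
have h0 : 0 <= h by rewrite divr_ge0// ltW.
have nh : n%:R * h = eps by rewrite /h mulrC divfK// gt_eqF.
pose Z w := lin xi (idx n) (tilt_coef n phi x) w.
have mZ : measurable_fun setT Z by exact: measurable_lin.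
pose B := [set w | `|Z w| <= eps ^+ 2 * L] `|` [set w | L <= sup_bound n 2 x w].
have mB1 : measurable [set w | `|Z w| <= eps ^+ 2 * L] by apply: measurable_le => //; exact: mabs.
have mB2 : measurable [set w | L <= sup_bound n 2 x w].
  by apply: measurable_le => //; exact: measurable_sup_bound.
have mB : measurable B by exact: measurableU.
have prB : pr B <= err.
  apply: (le_trans (pr_leU _ mB1 mB2)); apply: lerD.
    by apply: (spread_tilt x n0 c2 sc); rewrite mulr_ge0 ?exprn_ge0// ltW.
  exact: (pr_sup_bound theta indep centered variance1 moment5 2 x n0 L0).
have close w : ~ B w -> `|Z w - cos phi * wave n 0 (x + h) w| < `|Z w|.
  move=> nB.
  have [b1 b2] : eps ^+ 2 * L < `|Z w| /\ sup_bound n 2 x w < L.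
    by split; rewrite ltNge; apply/negP => hh; apply: nB; [left|right].
  have dF m (s : R) : is_derive s 1 (fun t => wave n m t w) (n%:R * wave n m.+1 s w).
    exact: wave_derive.
  have := @linearization_bound _ (fun m t => wave n m t w) n%:R nR dF x h h0
    (sup_bound n 2 x w) (fun t ht => wave_sup_bound xi theta 2 w n0 h0 _ ht).
  rewrite nh => /(_ eps2) lb.
  have -> : Z w - cos phi * wave n 0 (x + h) w =
     - (cos phi * (wave n 0 (x + h) w - (wave n 0 x w + eps * wave n 1 x w))).
    by rewrite /Z lin_tilt tane; ring.
  rewrite normrN normrM gtr0_norm//; apply: le_lt_trans b1.
  apply: (@le_trans _ _ (1 * (eps ^+ 2 * sup_bound n 2 x w))).
    by apply: ler_pM; rewrite ?cos_le1 ?(ltW c0).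
  by rewrite mul1r ler_wpM2l ?exprn_ge0// ltW.
pose X w := wave n 0 x w.
have mX : measurable_fun setT X by exact: mw.
have mlt : measurable [set w | X w * Z w < 0] by apply: measurable_lt => //; exact: measurable_funM.
have mle : measurable [set w | X w * Z w <= 0] by apply: measurable_le => //; exact: measurable_funM.
split.
- have : pr [set w | X w * Z w < 0] <= pr (crossing n x h) + pr B.
    apply: le_trans (pr_leU _ (measurable_crossing n x h) mB).
    apply: pr_le => //; first by apply: measurableU => //; exact: measurable_crossing.
    move=> w /= XZ; have [Bw|/close cl] := pselect (B w); [by right|left].
    rewrite /crossing /= -/(X w) -(pmulr_rlt0 _ c0) mulrCA.
    move: cl XZ; rewrite ltr_norml; set z := Z w; set y := cos phi * _; set a := X w.
    by case: (ltrP z 0) => z0; [rewrite ltr0_norm//|rewrite ger0_norm//] => /andP[g1 g2] g3; nra.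
  by move: lo; rewrite -/(Z _) -/(X _) -/h; move: prB; lra.
- have : pr (touching n x h) <= pr [set w | X w * Z w <= 0] + pr B.
    apply: le_trans (pr_leU _ mle mB).
    apply: pr_le => //; [exact: measurable_touching|exact: measurableU|].
    move=> w XX; have [Bw|/close cl] := pselect (B w); [by right|left].
    move: XX; rewrite /touching /= -/(X w) -(pmulr_rle0 _ c0) mulrCA.
    move: cl; rewrite ltr_norml; set z := Z w; set y := cos phi * _; set a := X w.
    by case: (ltrP z 0) => z0; [rewrite ltr0_norm//|rewrite ger0_norm//] => /andP[g1 g2] g3; nra.
  by move: hi; rewrite -/(Z _) -/(X _) -/h; move: prB; lra.
Qed.

End interval_probabilities.

(** * From events to the number of zeros *)

Section counting_on_a_grid.
Context (R : realType).
Variables (g : R -> R) (x h : R).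
Hypothesis h0 : 0 <= h.
Local Notation node j := (x + j%:R * h).

Let nodeS j : node j + h = node j.+1.
Proof. by rewrite -natr1; ring. Qed.

Lemma zeros_cover (q : nat -> nat) J :
  (forall j k, (j < J)%N -> has_zeros g (node j) (node j + h) k -> (k <= q j)%N) ->
  exists2 s : seq R, (size s <= \sum_(j < J) q j)%N &
    forall z, (0 < J)%N -> x <= z <= node J -> g z = 0 -> z \in s.
Proof.
elim: J => [|J IH] H; first by exists [::].
have [|s ss cs] := IH; first by move=> j k jJ; apply: H; exact: ltnW.
have [|s' [ss' zs'] [ss1 cs']] := @zero_list_max _ g (node J) (node J + h) (q J).
  by move=> hz; have := H J _ (ltnSn J) hz; rewrite ltnn.
exists (s ++ s'); first by rewrite size_cat big_ord_recr leq_add.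
move=> z _ /andP[xz zJ] gz; rewrite mem_cat; apply/orP.
case: (leP (node J) z) => zJ'; first by right; apply: cs' => //; rewrite zJ' nodeS.
left; apply: cs => //; last by rewrite xz ltW.
rewrite lt0n; apply/eqP => J0; move: zJ'; rewrite J0 mul0r addr0 => /(le_lt_trans xz).
by rewrite ltxx.
Qed.

(** Zeros of different steps are distinct because they are taken in the open
    intervals. *)
Lemma sign_change_zeros J : continuous g ->
  exists2 s : seq R, size s = (\sum_(j < J) (g (node j) * g (node j + h) < 0)%R)%N &
    uniq s /\ forall z, z \in s -> x <= z < node J /\ g z = 0.
Proof.
move=> cg; elim: J => [|J [s ss [us zs]]]; first by exists [::]; rewrite ?big_ord0.
have nJ : node J <= node J + h by rewrite lerDl.
case: (ltP (g (node J) * g (node J + h)) 0) => gJ; last first.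
  exists s; first by rewrite big_ord_recr /= ss ltNge gJ addn0.
  split => // z /zs[/andP[-> zJ] gz]; split => //.
  by rewrite -nodeS (lt_le_trans zJ nJ).
have [z /andP[z1 z2] gz] : exists2 z, node J < z < node J + h & g z = 0.
  have [||z] := @IVT R g (node J) (node J + h) 0 nJ.
  - exact: continuous_subspaceT.
  - rewrite ge_min le_max; case: (ltrP (g (node J)) 0) => l1.
      by rewrite (ltW l1) /=; nra.
    by rewrite /= andbT; apply/orP; right; nra.
  - rewrite in_itv /= => /andP[z1 z2] gz; exists z => //; rewrite !lt_neqAle z1 z2 !andbT.
    apply/andP; split; apply/eqP => E; move: gJ; rewrite -gz.
      by rewrite E gz mul0r ltxx.
    by rewrite -E gz mulr0 ltxx.
have zns : z \notin s.
  by apply/negP => /zs[/andP[_ /(lt_trans z1)]]; rewrite ltxx.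
exists (z :: s); first by rewrite big_ord_recr /= ss gJ addn1.
split => [|y]; first by rewrite /= zns.
rewrite inE => /predU1P[->|/zs[/andP[-> yJ] gy]]; split => //.
  rewrite -nodeS z2 andbT; apply: le_trans (ltW z1).
  by rewrite lerDl mulr_ge0.
by rewrite -nodeS (lt_le_trans yJ nJ).
Qed.

End counting_on_a_grid.

Section zeros_and_events.
Context (d : measure_display) (T : measurableType d) (R : realType).
Variable P : probability T R.
Local Notation Ex := (Ex P).
Local Notation pr := (pr P).
Local Notation int f := (P.-integrable setT (EFin \o f)).
Context (a b : nat -> {RV P >-> R}) (theta : nat -> R).
Local Notation xi := (coefficients a b).
Local Notation wave := (wave xi theta).
Local Notation touching := (touching xi theta).
Local Notation crossing := (crossing xi theta).
Local Notation cluster := (cluster xi theta).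

Lemma trig_poly_wave n w t : (0 < n)%N ->
  trig_poly a b theta n w t = Num.sqrt n%:R * wave n 0 t w.
Proof.
move=> n0; have sn : Num.sqrt n%:R != 0 :> R by rewrite sqrtr_eq0 -ltNge ltr0n.
rewrite /trig_poly waveE /lin big_idx big_add1 big_mkord mulr_sumr.
apply: eq_bigr => k _; rewrite /= /wave_coef expr0 !mul1r mul0r addr0.
by field.
Qed.

Lemma trig_poly_eq0 n w t : (0 < n)%N -> (trig_poly a b theta n w t = 0) <-> (wave n 0 t w = 0).
Proof.
move=> n0; rewrite trig_poly_wave//; split => [/eqP|->]; last by rewrite mulr0.
by rewrite mulf_eq0 sqrtr_eq0 leNgt ltr0n n0 => /eqP.
Qed.

(** A single zero needs either a sign change or the event cluster of order 2.
    If there are k >= 2 zeros then the events cluster of orders 2 to k all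
    occur, and k <= 2 (k - 1). *)
Lemma zeros_le_events n x (h : R) w k (L : nat -> R) : (0 < n)%N -> 0 <= h ->
  n%:R * h <= 2^-1 -> (k <= 2 * n)%N -> has_zeros (fun t => wave n 0 t w) x (x + h) k ->
  (k <= (w \in touching n x h) +
     2 * \sum_(2 <= i < (2 * n).+1) (w \in cluster n i x (n%:R * h) (L i)))%N.
Proof.
move=> n0 h0 e2 kn Z; have nR : 0 < n%:R :> R by rewrite ltr0n.
have e0 : 0 <= n%:R * h by rewrite mulr_ge0// ltW.
have dF m (s : R) : is_derive s 1 (fun t => wave n m t w) (n%:R * wave n m.+1 s w).
  exact: wave_derive.
have B i t : x <= t <= x + h -> `|wave n i t w| <= sup_bound xi theta n i x w.
  exact: wave_sup_bound.
have hx : x <= x <= x + h by rewrite lexx lerDl.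
have clusterI i : `|wave n 0 x w| <= (n%:R * h) ^+ i * sup_bound xi theta n i x w ->
    w \in cluster n i x (n%:R * h) (L i).
  move=> hb; rewrite inE; case: (leP (L i) (sup_bound xi theta n i x w)) => hL; [by right|left].
  by apply: (le_trans hb); rewrite ler_wpM2l ?exprn_ge0// ltW.
case: k kn Z => [//|[|k]] kn Z.
  have [//|nt] := boolP (w \in touching n x h).
  have c2 : w \in cluster n 2 x (n%:R * h) (L 2).
    apply: clusterI.
    apply: (@same_sign_zero_bound _ (fun m t => wave n m t w) n%:R nR dF x h h0 _ (B 2)) => //.
    by rewrite ltNge; apply: contra nt; rewrite inE.
  by rewrite big_ltn ?c2//; lia.
have cl i : (2 <= i < k.+3)%N -> w \in cluster n i x (n%:R * h) (L i).
  move=> /andP[i2 ik]; apply: clusterI.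
  apply: (@many_zeros_bound _ (fun m t => wave n m t w) n%:R nR dF x h i 0 _ (B i) _ x hx).
  by apply: has_zerosW Z; lia.
apply: (@leq_trans (2 * k.+1)); first lia.
apply: leq_trans (leq_addl _ _); rewrite leq_mul2l /=.
rewrite (big_cat_nat (n := k.+3)) //=.
apply: leq_trans (leq_addr _ _).
rewrite big_nat (eq_bigr (fun=> 1%N)); last by move=> i /cl ->.
by rewrite -big_nat sum_nat_const_nat; lia.
Qed.

(** The cap 2 n on the number of zeros in a step ends the sum over the events
    cluster. *)
Lemma nb_zeros_le n x (h : R) J w (L : nat -> R) : (0 < n)%N -> (0 < J)%N -> 0 <= h ->
  n%:R * h <= 2^-1 ->
  (nb_zeros (trig_poly a b theta n w) x (x + J%:R * h) <=
   (\sum_(j < J) (\1_(touching n (x + j%:R * h) h) w +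
     2 * \sum_(2 <= i < (2 * n).+1) \1_(cluster n i (x + j%:R * h) (n%:R * h) (L i)) w))%:E)%E.
Proof.
move=> n0 J0 h0 e2; rewrite /nb_zeros; case: ifPn => [_|/asboolP nz].
  rewrite lee_fin sumr_ge0// => j _; rewrite addr_ge0 ?mulr_ge0//.
  by rewrite sumr_ge0.
pose q j := ((w \in touching n (x + j%:R * h) h) +
     2 * \sum_(2 <= i < (2 * n).+1) (w \in cluster n i (x + j%:R * h) (n%:R * h) (L i)))%N.
have h1 : h <= 1.
  have : h <= n%:R * h by rewrite ler_peMl// ler1n.
  lra.
have [|s ss cs] := @zeros_cover R (fun t => wave n 0 t w) x h q J.
  move=> j k jJ Z; apply: zeros_le_events => //.
  rewrite leqNgt; apply/negP => kn.
  have Z1 := has_zerosW kn Z.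
  apply: (@trig_poly_few_zeros R n (fun k => a k w) (fun k => b k w) theta
    (x + j%:R * h) (x + j%:R * h + h) _ nz); first by rewrite addrAC subrr add0r.
  case: Z1 => s [s1 s2] s3; exists s => //; split => // z /s2[hz fz]; split => //.
  by apply/trig_poly_eq0.
apply: (le_trans (counting_le_size (s := s) _)).
  by move=> z [zI fz]; apply: cs => //; exact/trig_poly_eq0.
rewrite lee_fin; apply: (@le_trans _ _ (\sum_(j < J) q j)%N%:R); first by rewrite ler_nat.
rewrite natr_sum; apply: ler_sum => j _; rewrite /q natrD natrM natr_sum !indicE.
by rewrite lerD2l ler_pM2l//; apply: ler_sum => i _; rewrite indicE.
Qed.

(** When P_n vanishes identically no crossing occurs. *)
Lemma nb_zeros_ge n x (h : R) J w : (0 < n)%N -> 0 <= h ->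
  ((\sum_(j < J) \1_(crossing n (x + j%:R * h) h) w)%:E <=
   nb_zeros (trig_poly a b theta n w) x (x + J%:R * h))%E.
Proof.
move=> n0 h0; rewrite /nb_zeros; case: ifPn => [/asboolP nz|_].
  rewrite lee_fin big1// => j _; rewrite indicE; case: (boolP (w \in _)) => //.
  rewrite inE /crossing /= (_ : wave n 0 _ w = 0) ?mul0r ?ltxx//.
  exact/trig_poly_eq0.
have cg : continuous (fun t => wave n 0 t w).
  by apply: is_derive_continuous => t; exact: wave_derive.
have [s ss [us zs]] := @sign_change_zeros R (fun t => wave n 0 t w) x h h0 J cg.
apply: le_trans (counting_ge_size us _); last first.
  move=> z /zs[/andP[z1 z2] fz]; split; last exact/trig_poly_eq0.
  by rewrite in_itv /= z1 ltW.
rewrite lee_fin ss natr_sum; apply: ler_sum => j _; rewrite indicE ler_nat.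
case: (boolP (w \in _)) => //; rewrite inE /crossing /= => -> //.
Qed.

Lemma nb_zeros_ge0 (f : R -> R) u v : (0 <= nb_zeros f u v)%E.
Proof.
rewrite /nb_zeros; case: ifP => // _; apply: le_trans (@counting_ge_size R _ [::] _ _) => //.
Qed.

Lemma integral_Ex (f : T -> R) : int f -> (\int[P]_w (f w)%:E = (Ex f)%:E)%E.
Proof. by move=> fi; rewrite /Ex /Rintegral fineK//; exact: integrable_fin_num. Qed.

Let int_indic A : measurable A -> int (\1_A : T -> R).
Proof. by move=> mA; apply: bounded_meas_int; exact: bounded_meas_indic. Qed.

Lemma integral_nb_zeros_le n x (h : R) J (L : nat -> R) B : (0 < n)%N -> (0 < J)%N -> 0 <= h ->
  n%:R * h <= 2^-1 ->
  (forall y, pr (touching n y h) +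
    2 * \sum_(2 <= i < (2 * n).+1) pr (cluster n i y (n%:R * h) (L i)) <= B) ->
  (\int[P]_w nb_zeros (trig_poly a b theta n w) x (x + J%:R * h) <= (J%:R * B)%:E)%E.
Proof.
move=> n0 J0 h0 e2 HB.
apply: (le_trans (le_integral_nomeas _ (fun w => nb_zeros_ge0 _ _ _)
  (fun w => nb_zeros_le x w L n0 J0 h0 e2))).
have ic y : int (fun w => \sum_(2 <= i < (2 * n).+1) \1_(cluster n i y (n%:R * h) (L i)) w).
  by apply: int_sum => i; apply: int_indic; exact: measurable_cluster.
have it y : int (\1_(touching n y h)) by apply: int_indic; exact: measurable_touching.
have ij y : int (fun w => \1_(touching n y h) w +
     2 * \sum_(2 <= i < (2 * n).+1) \1_(cluster n i y (n%:R * h) (L i)) w).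
  by apply: intD => //; exact: intZ.
rewrite integral_Ex; last by apply: int_sum => j; exact: ij.
rewrite lee_fin Ex_sum; last by move=> j; exact: ij.
rewrite (_ : J%:R * B = \sum_(j < J) B); last by rewrite sumr_const card_ord mulr_natl.
  apply: ler_sum => j _.
rewrite ExD//; last exact: intZ.
rewrite ExZ// Ex_sum; last by move=> i; apply: int_indic; exact: measurable_cluster.
rewrite Ex_indic; last exact: measurable_touching.
rewrite (eq_bigr (fun i => pr (cluster n i (x + j%:R * h) (n%:R * h) (L i)))); last first.
  by move=> i _; rewrite Ex_indic//; exact: measurable_cluster.
exact: HB.
Qed.

Lemma integral_nb_zeros_ge n x (h : R) J B : (0 < n)%N -> 0 <= h ->
  (forall y, B <= pr (crossing n y h)) ->
  ((J%:R * B)%:E <= \int[P]_w nb_zeros (trig_poly a b theta n w) x (x + J%:R * h))%E.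
Proof.
move=> n0 h0 HB.
apply: (@le_trans _ _ (\int[P]_w (\sum_(j < J) \1_(crossing n (x + j%:R * h) h) w)%:E)%E).
  have ij y : int (\1_(crossing n y h)) by apply: int_indic; exact: measurable_crossing.
  rewrite integral_Ex; last by apply: int_sum => j; exact: ij.
  rewrite lee_fin Ex_sum; last by move=> j; exact: ij.
  rewrite (_ : J%:R * B = \sum_(j < J) B); last by rewrite sumr_const card_ord mulr_natl.
  apply: ler_sum => j _.
  by rewrite Ex_indic//; exact: measurable_crossing.
apply: le_integral_nomeas => w; last exact: nb_zeros_ge.
by rewrite lee_fin sumr_ge0.
Qed.

End zeros_and_events.

(** * Choice of the grid and passage to the limit *)

Section elementary_estimates.
Context (R : realType).

Lemma atan_bounds (c : R) : 0 <= c -> c - c ^+ 3 <= atan c <= c.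
Proof.
move=> c0; have [z /andP[z0 zc]] := @mean_value R atan _ 0 c (fun x => is_derive1_atan x) c0.
rewrite atan0 !subr0 => ->.
have d0 : 0 < 1 + z ^+ 2 by rewrite ltr_pwDl// sqr_ge0.
have zc2 : z ^+ 2 <= c ^+ 2 by apply: lerXn2r; rewrite ?nnegrE.
have i1 : (1 + z ^+ 2)^-1 <= 1 by rewrite invf_le1// lerDl sqr_ge0.
have i2 : 1 - c ^+ 2 <= (1 + z ^+ 2)^-1.
  rewrite -[leRHS]mul1r ler_pdivlMr//.
  by have := sqr_ge0 z; have := sqr_ge0 c; nra.
apply/andP; split; last by rewrite ler_piMl.
have -> : c - c ^+ 3 = (1 - c ^+ 2) * c by ring.
exact: ler_wpM2r i2.
Qed.

Lemma geometric_tail_le (y : R) N : 0 <= y <= 2^-1 -> \sum_(2 <= i < N) y ^+ i <= 2 * y ^+ 2.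
Proof.
move=> /andP[y0 y2]; rewrite (big_addn 0 N 2) big_mkord.
under eq_bigr do rewrite exprD.
rewrite -mulr_suml ler_wpM2r ?sqr_ge0//.
have q : 0 <= y < 1 by apply/andP; split; lra.
apply: (le_trans (geometric_sum_le _ q)).
by rewrite -[leRHS]invrK lef_pV2 ?posrE; lra.
Qed.

(** The angle phi = atan (eps / sqrt 3) attached to a step of normalised
    length eps = l / q^3. It equals eps / sqrt 3 up to a cubic error, so q^3
    such angles add up to l / sqrt 3 up to l^3 / q. *)
Lemma step_angle (l q : R) : 0 < l -> 2 <= q -> 2 * l <= q ->
  exists phi, [/\ 0 < phi, phi <= 1, phi ^+ 2 <= (l / q ^+ 2) ^+ 2,
    Num.sqrt 3 * sin phi = cos phi * (l / q ^+ 3) &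
    l / (pi * Num.sqrt 3) - l ^+ 3 / q <= q ^+ 3 * (phi / pi) <= l / (pi * Num.sqrt 3)].
Proof.
move=> l0 q2 lq; have q0 : 0 < q by lra.
pose s3 : R := Num.sqrt 3.
have s32 : s3 ^+ 2 = 3 by exact: sqr_sqrtr.
have s30 : 0 < s3 by rewrite sqrtr_gt0.
have s31 : 1 <= s3 by have := sqrtr_ge0 (3 : R); rewrite -/s3; nra.
pose eps := l / q ^+ 3; pose c := eps / s3.
have /andP[iq0 iq1] : 0 < q^-1 <= 2^-1 by rewrite invr_gt0 q0 lef_pV2 ?posrE.
have lq1 : l * q^-1 <= 2^-1 by rewrite ler_pdivrMr//; lra.
have epsE : eps = l / q ^+ 2 * q^-1 by rewrite /eps; field; rewrite gt_eqF.
have lq20 : 0 < l / q ^+ 2 by rewrite divr_gt0// exprn_gt0.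
have eps0 : 0 < eps by rewrite divr_gt0// exprn_gt0.
have epslq : eps <= l / q ^+ 2 by rewrite epsE ler_piMr ?(ltW lq20)//; lra.
have lq21 : l / q ^+ 2 <= 2^-1.
  have -> : l / q ^+ 2 = l * q^-1 * q^-1 by field; rewrite gt_eqF.
  nra.
have c0 : 0 < c by rewrite divr_gt0.
have ce : c <= eps by rewrite ler_pdivrMr// ler_peMr// ltW.
have c1 : c <= 2^-1 by exact: le_trans ce (le_trans epslq lq21).
have /andP[phi_ge phi_le] := atan_bounds (ltW c0); set phi := atan c in phi_ge phi_le.
have phi0 : 0 < phi.
  apply: lt_le_trans phi_ge.
  have -> : c - c ^+ 3 = c * (1 - c ^+ 2) by ring.
  by apply: mulr_gt0 => //; nra.
have phi1 : phi <= 1 by lra.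
have cos0 : 0 < cos phi by apply: cos_gt0_pihalf; rewrite atan_gtNpi2 atan_ltpi2.
exists phi; split => //.
- apply: lerXn2r; rewrite ?nnegrE ?(ltW phi0) ?(ltW lq20)//.
  exact: le_trans phi_le (le_trans ce epslq).
- have -> : sin phi = c * cos phi.
    by rewrite -[in RHS](atanK c) -/phi /tan divfK// gt_eqF.
  by rewrite /c -/s3 -/eps; field; rewrite gt_eqF.
have pi1 : 1 <= pi :> R by apply: le_trans (pi_ge2 R); rewrite ler1n.
have pi0 : 0 < pi :> R by exact: pi_gt0.
have q3 : 0 < q ^+ 3 by rewrite exprn_gt0.
have tE : l / (pi * s3) = q ^+ 3 * c / pi.
  have gen (x y w : R) : 0 < x -> 0 < y -> 0 < w -> l / (w * x) = y ^+ 3 * (l / y ^+ 3 / x) / w.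
    by move=> x0 y0 w0; field; rewrite !gt_eqF.
  exact: gen.
have c3 : q ^+ 3 * c ^+ 3 <= l ^+ 3 / q.
  have ce3 : c ^+ 3 <= eps ^+ 3 by apply: lerXn2r; rewrite ?nnegrE ?(ltW c0) ?(ltW eps0).
  apply: (@le_trans _ _ (q ^+ 3 * eps ^+ 3)); first by rewrite ler_pM2l.
  have -> : q ^+ 3 * eps ^+ 3 = l ^+ 3 * (q^-1 ^+ 6) by rewrite /eps; field; rewrite gt_eqF.
  rewrite ler_pM2l ?exprn_gt0// exprS ler_piMr ?(ltW iq0)//.
  by rewrite exprn_ile1 ?(ltW iq0)//; lra.
rewrite -/s3 tE (mulrA _ phi) ler_pM2r ?invr_gt0// ler_pM2l// phi_le andbT.
have : q ^+ 3 * (c - c ^+ 3) / pi <= q ^+ 3 * phi / pi.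
  by rewrite ler_pM2r ?invr_gt0// ler_pM2l.
apply: le_trans.
have -> : q ^+ 3 * (c - c ^+ 3) / pi = q ^+ 3 * c / pi - q ^+ 3 * c ^+ 3 / pi by ring.
rewrite lerD2l lerN2; apply: le_trans c3; rewrite ler_piMr ?invf_le1//.
by rewrite mulr_ge0 ?(ltW q3)// exprn_ge0// ltW.
Qed.

(** The grid parameter p is fixed first, and n tends to infinity for each p. *)
Lemma cvg_div_nat (s : nat -> \bar R) (t C : R) (p0 : nat) : 0 <= C ->
  (forall p, (p0 < p)%N -> exists n0, forall n, (n0 < n)%N ->
    ((n%:R * (t - C / p%:R))%:E <= s n <= (n%:R * (t + C / p%:R))%:E)%E) ->
  (s n / n%:R%:E)%E @[n --> \oo] --> t%:E.
Proof.
move=> C0 H.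
have key p : (p0 < p)%N -> exists n0, forall n, (n0 < n)%N ->
    exists2 r : R, (s n / n%:R%:E = r%:E)%E & `|t - r| <= C / p%:R.
  move=> /H[n0 {}H]; exists n0 => n nn0; have nR : 0 < n%:R :> R by rewrite ltr0n; lia.
  have /andP[lo hi] := H n nn0.
  have fs : s n \is a fin_num.
    by rewrite fin_numElt (lt_le_trans _ lo) ?ltNyr//= (le_lt_trans hi) ?ltry.
  move: lo hi; rewrite -(fineK fs); set A := fine (s n); rewrite !lee_fin => lo hi.
  exists (A / n%:R); first by rewrite inver gt_eqF.
  have lo' : t - C / p%:R <= A / n%:R by rewrite ler_pdivlMr// mulrC.
  have hi' : A / n%:R <= t + C / p%:R by rewrite ler_pdivrMr// mulrC.
  by rewrite ler_norml; apply/andP; split; lra.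
apply/fine_cvgP; split.
  have [n0 H0] := key p0.+1 (ltnSn _).
  by exists n0.+1 => // n /= nn0; have [r ->] := H0 n nn0.
apply/cvgrPdist_le => e e0.
pose p := (p0 + Num.trunc (C / e)).+1.
have pe : C / p%:R <= e.
  rewrite ler_pdivrMr ?ltr0n// mulrC -ler_pdivrMr//.
  apply: ltW; apply: (lt_le_trans (truncnS_gt _)).
  by rewrite ler_nat /p -addnS leq_addl.
have [n0 H0] := key p (leq_trans (ltnSn _) (leq_addr _ _)).
exists n0.+1 => // n /= nn0; have [r -> /= tr] := H0 n nn0.
exact: le_trans tr pe.
Qed.

End elementary_estimates.

Section zero_count.
Context (d : measure_display) (T : measurableType d) (R : realType).
Variable P : probability T R.
Context (a b : nat -> {RV P >-> R}) (theta : nat -> R).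
Local Notation xi := (coefficients a b).
Hypothesis indep : mutually_independent xi.
Hypothesis idistr : identically_distributed xi.
Hypothesis centered : forall i, ('E_P[xi i] = 0)%E.
Hypothesis variance1 : forall i, ('V_P[xi i] = 1)%E.
Hypothesis moment5 : forall i, ('E_P[(fun w => `|xi i w| ^+ 5)%R] < +oo)%E.
Context (K : R) (rn : nat -> R).
Hypothesis K0 : 0 <= K.
Hypothesis rn0 : forall n, 0 <= rn n.
Hypothesis nrn_cvg : n%:R * rn n @[n --> \oo] --> (0 : R).
Hypothesis small : forall (n : nat) (a : nat + nat -> R), (0 < n)%N ->
  (forall k, (k < n)%N -> n%:R^-1 <= a (inl k) ^+ 2 + a (inr k) ^+ 2 <= 4 / n%:R) ->
  spread xi K rn n a.

(** On each of the p^3 n steps the total error is of order p^-4: with the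
    thresholds L k = p^k the events cluster of order k have probability O((l
    / p^2)^k + p^(-2 k)) + rn n, and their sum over k >= 2 is O(p^-4) once n
    rn n is below p^-4. Hence the error in the mean number of zeros is of
    order n / p. *)
Lemma zero_count_estimate (u l : R) (p : nat) : 0 < l -> (1 < p)%N -> 2 * l <= p%:R ->
  let C := l ^+ 3 + (l ^+ 2 + 1 + 2 * K * l ^+ 2 + 12 + 4 * K * l ^+ 2 + 48 + 1) in
  exists n0, forall n, (n0 < n)%N ->
    ((n%:R * (l / (pi * Num.sqrt 3) - C / p%:R))%:E <=
      \int[P]_w nb_zeros (trig_poly a b theta n w) u (u + l) <=
     (n%:R * (l / (pi * Num.sqrt 3) + C / p%:R))%:E)%E.
Proof.
move=> l0 p1 lp C; pose q : R := p%:R.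
have q2 : 2 <= q by rewrite /q ler_nat.
have q0 : 0 < q by lra.
have lq : 2 * l <= q by [].
pose z := q^-1 ^+ 2; pose eps := l / q ^+ 3.
have iq : 0 < q^-1 <= 2^-1 by rewrite invr_gt0 q0 lef_pV2 ?posrE.
have [iq0 iq1] := andP iq.
have z0 : 0 < z by rewrite exprn_gt0.
have z1 : z <= 2^-1 by rewrite /z; nra.
have lq1 : l * q^-1 <= 2^-1 by rewrite ler_pdivrMr//; lra.
have lz1 : l * z <= 2^-1.
  have -> : l * z = l * q^-1 * q^-1 by rewrite /z; ring.
  nra.
have lz0 : 0 < l * z by rewrite mulr_gt0.
have epsE : eps = l * z * q^-1 by rewrite /eps /z; field; rewrite gt_eqF.
have eps0 : 0 < eps by rewrite epsE mulr_gt0.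
have eps2 : eps <= 2^-1 by rewrite epsE; nra.
have [phi [phi0 phi1 phi_lq tane phit]] := step_angle l0 q2 lq.
have cos2 : 1 / 2 <= cos phi by apply: cos_ge_half; rewrite ger0_norm// ltW.
have sc2 : sin phi ^+ 2 <= cos phi ^+ 2.
  have : 3 * sin phi ^+ 2 = cos phi ^+ 2 * eps ^+ 2.
    by rewrite -exprMn -tane exprMn sqrt3_sqr.
  have : cos phi ^+ 2 * eps ^+ 2 <= cos phi ^+ 2 by rewrite ler_piMr ?sqr_ge0//; nra.
  by have := sqr_ge0 (sin phi); lra.
have z20 : 0 < z ^+ 2 by rewrite exprn_gt0.
have epsI : 0 <= eps <= 2^-1 by rewrite ltW.
have [n1 Hn1] := pr_sign_change_interval theta indep idistr centered variance1 moment5 K0 rn0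
  nrn_cvg small phi0 phi1 cos2 sc2 tane epsI z20.
have [n2 _ Hn2] : \forall n \near \oo, rn n + 4 * (n%:R * rn n) <= z ^+ 2.
  have : rn n + 4 * (n%:R * rn n) @[n --> \oo] --> (0 + 4 * 0 : R).
    apply: cvgD; first exact: (rn_cvg rn0 nrn_cvg).
    by apply: cvgM => //; exact: cvg_cst.
  rewrite mulr0 addr0 => /cvgrPdist_le/(_ _ z20); apply: filterS => n.
  by rewrite sub0r normrN; exact: le_trans (ler_norm _).
exists (maxn n1 n2) => n; rewrite gtn_max => /andP[nn1 nn2].
have n0 : (0 < n)%N := leq_ltn_trans (leq0n _) nn1.
have nR : 0 < n%:R :> R by rewrite ltr0n.
have rnn := Hn2 n (ltnW nn2); rewrite /= in rnn.
pose h := eps / n%:R; pose J := (p ^ 3 * n)%N.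
have h0 : 0 <= h by rewrite divr_ge0// ltW.
have nh : n%:R * h = eps by rewrite /h mulrC divfK// gt_eqF.
have JE : J%:R = q ^+ 3 * n%:R :> R by rewrite /J natrM natrX.
have lE : l = J%:R * h.
  by rewrite JE /h /eps; field; rewrite !gt_eqF.
have J0 : (0 < J)%N by rewrite muln_gt0 expn_gt0 n0 (ltnW p1).
pose L i := q ^+ i.
have phi_sqr : phi ^+ 2 <= l ^+ 2 * z ^+ 2 by rewrite -exprMn /z exprVn.
have err : 2 * K * (eps ^+ 2 * L 2) + rn n + 12 / L 2 ^+ 2 =
    2 * K * l ^+ 2 * z ^+ 2 + rn n + 12 * z ^+ 2.
  by rewrite /L /eps /z; field; rewrite gt_eqF.
have Hsc y := Hn1 n (ltnW nn1) y (L 2) (exprn_gt0 2 q0).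
pose C0 := l ^+ 2 + 1 + 2 * K * l ^+ 2 + 12 + 4 * K * l ^+ 2 + 48 + 1.
have nrn_ge0 : 0 <= n%:R * rn n by rewrite mulr_ge0 ?rn0.
have Kl : 0 <= K * l ^+ 2 * z ^+ 2 by rewrite mulr_ge0 ?(ltW z20)// mulr_ge0 ?sqr_ge0.
have lower y : phi / pi - C0 * z ^+ 2 <= pr P (crossing xi theta n y h).
  have [+ _] := Hsc y; rewrite /= err -/h; apply: le_trans.
  by rewrite /C0; lra.
have upper y : pr P (touching xi theta n y h) + 2 * \sum_(2 <= i < (2 * n).+1)
    pr P (cluster xi theta n i y (n%:R * h) (L i)) <= phi / pi + C0 * z ^+ 2.
  have [_] := Hsc y; rewrite /= err -/h => Ht.
  have Hc : \sum_(2 <= i < (2 * n).+1) pr P (cluster xi theta n i y (n%:R * h) (L i)) <=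
      K * (2 * (l * z) ^+ 2) + 2 * (n%:R * rn n) + 12 * (2 * z ^+ 2).
    apply: (@le_trans _ _ (\sum_(2 <= i < (2 * n).+1) (K * (l * z) ^+ i + rn n + 12 * z ^+ i))).
      apply: ler_sum => i _; rewrite nh.
      have := pr_cluster theta indep centered variance1 moment5 small i y n0 (ltW eps0)
        (exprn_gt0 i q0).
      have -> : eps ^+ i * q ^+ i = (l * z) ^+ i.
        by rewrite -exprMn epsE divfK// gt_eqF.
      have -> : 12 / (q ^+ i) ^+ 2 = 12 * z ^+ i by rewrite /z -!exprVn -!exprM mulnC.
      by [].
    rewrite !big_split /= -!mulr_sumr; apply: lerD; first apply: lerD.
    - by rewrite ler_wpM2l// geometric_tail_le// ltW.
    - rewrite sumr_const_nat -[_ *+ _]mulr_natl mulrA ler_wpM2r// -natrM ler_nat leq_subLR ltnW// leqW.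
    - rewrite ler_pM2l// geometric_tail_le//; apply/andP; split; [exact: ltW|exact: z1].
  move: Hc; rewrite exprMn => Hc.
  by rewrite /C0; lra.
pose t := l / (pi * Num.sqrt 3).
rewrite -/t in phit.
have zq : q ^+ 3 * z ^+ 2 = q^-1 by rewrite /z; field; rewrite gt_eqF.
have l3q : 0 <= l ^+ 3 / q by rewrite divr_ge0// ?exprn_ge0 ?ltW.
have CE : C / q = l ^+ 3 / q + C0 * q^-1 by exact: mulrDl.
rewrite -/t -/q CE [in u + l]lE; apply/andP; split.
- apply: le_trans (integral_nb_zeros_ge u J n0 h0 lower).
  rewrite lee_fin JE (mulrC (q ^+ 3)) -(mulrA n%:R) ler_pM2l// mulrBr (mulrCA _ C0) zq.
  by move: phit l3q; lra.
- apply: (le_trans (integral_nb_zeros_le u n0 J0 h0 _ upper)); first by rewrite nh.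
  rewrite lee_fin JE (mulrC (q ^+ 3)) -(mulrA n%:R) ler_pM2l// mulrDr (mulrCA _ C0) zq.
  by move: phit l3q; lra.
Qed.

End zero_count.

Theorem theorem1p1 (d : measure_display) (T : measurableType d) (R : realType)
    (P : probability T R) (a b : nat -> {RV P >-> R}) (theta : nat -> R)
    (beta u v : R)
    (beta_ge0 : 0 <= beta) (beta_lt1 : beta < 1)
    (indep : mutually_independent (coefficients a b))
    (idistr : identically_distributed (coefficients a b))
    (centered : forall i, ('E_P[coefficients a b i] = 0)%E)
    (variance1 : forall i, ('V_P[coefficients a b i] = 1)%E)
    (moment5 : forall i,
      ('E_P[(fun w => `|coefficients a b i w| ^+ 5)%R] < +oo)%E)
    (cramer : forall i,
      cramer_class P beta (fun w => \row_(j < 1) coefficients a b i w))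
    (ltuv : u < v) :
  ((\int[P]_w nb_zeros (trig_poly a b theta n w) u v) / n%:R%:E)%E
    @[n --> \oo] --> ((v - u) / (pi * Num.sqrt 3))%:E.
Proof.
have [K [rn [K0 rn0 nrn small]]] := small_ball indep idistr beta_ge0 beta_lt1 (cramer (inl 0%N)).
set l := v - u; have l0 : 0 < l by rewrite subr_gt0.
have -> : v = u + l by rewrite addrC subrK.
pose p0 := (2 + Num.trunc (2 * l))%N.
apply: (@cvg_div_nat _ _ _ _ p0); last first.
  move=> p pp; apply: (zero_count_estimate theta indep idistr centered variance1 moment5 K0
    rn0 nrn small u l0).
    by apply: leq_ltn_trans pp; exact: leq_addr.
  apply: ltW; apply: (lt_le_trans (truncnS_gt _)).
  rewrite ler_nat; apply: leq_trans (ltnW pp); exact: (leq_add2r _ 1 2).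
have Kl : 0 <= K * l ^+ 2 by rewrite mulr_ge0 ?sqr_ge0.
have := sqr_ge0 l; have : 0 < l ^+ 3 by rewrite exprn_gt0.
lra.
Qed.
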